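(* Consider the periodic Camassa–Holm equation on $\mathbb{T}=\mathbb{R}/2\pi\mathbb{Z}$, $$\partial_t u+u\,\partial_x u=-\partial_x(1-\partial_x^2)^{-1}\Big(u^2+\tfrac12(\partial_x u)^2\Big),\qquad u(0,x)=u_0(x).$$ For every sufficiently large $n\in\mathbb{Z}^+$ there exists a real-valued initial datum $u_0\in H^\infty(\mathbb{T})$ with $$\|u_0\|_{B^1_{\infty,1}(\mathbb{T})}\le \frac{1}{\log\log n}$$ such that, denoting by $u\in\mathcal{C}([0,T);H^\infty(\mathbb{T}))$ the solution of the periodic Camassa–Holm equation with initial datum $u_0$, there is a time $t_0\in\big(0,\frac{1}{\log n}\big]$ with $$\|u(t_0)\|_{B^1_{\infty,1}(\mathbb{T})}\ge \log\log n .$$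
   Context: Periodic Fourier transform: for $u$ on $\mathbb{T}$, $\widehat u(\xi)=\int_{\mathbb{T}}e^{-\mathrm{i}x\xi}u(x)\,dx$ for $\xi\in\mathbb{Z}$, and $u(x)=\frac1{2\pi}\sum_{\xi\in\mathbb{Z}}\widehat u(\xi)e^{\mathrm{i}x\xi}$. Fix a smooth function $\chi$ supported in the ball of radius $4/3$ and equal to $1$ on the ball of radius $3/4$; set $\varphi(\xi)=\chi(\xi/2)-\chi(\xi)$ and $\varphi_j(\xi)=\varphi(2^{-j}\xi)$. Periodic dyadic blocks: $\Delta_j u=0$ for $j\le -2$, $\Delta_{-1}u=\frac1{2\pi}\sum_{\xi\in\mathbb{Z}}\chi(\xi)\widehat u(\xi)e^{\mathrm{i}x\xi}$, and $\Delta_j u=\frac1{2\pi}\sum_{\xi\in\mathbb{Z}}\varphi_j(\xi)\widehat u(\xi)e^{\mathrm{i}x\xi}$ for $j\ge0$. The Besov norm is $\|f\|_{B^s_{p,r}(\mathbb{T})}=\big(\sum_{j\ge-1}2^{sjr}\|\Delta_jf\|^r_{L^p(\mathbb{T})}\big)^{1/r}$ for $r<\infty$ (with the usual supremum for $r=\infty$); in particular $\|f\|_{B^1_{\infty,1}(\mathbb{T})}=\sum_{j\ge-1}2^j\|\Delta_jf\|_{L^\infty(\mathbb{T})}$. *)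

(* Defs.v *)
From Stdlib Require Import Reals Lra.
From Coquelicot Require Import Coquelicot.
Open Scope R_scope.

(** Functions on T = R/2piZ are 2pi-periodic functions R -> R. *)
Definition periodic (u : R -> R) : Prop := forall x, u (x + 2 * PI) = u x.

Definition smooth (u : R -> R) : Prop :=
  forall (k : nat) (x : R), ex_derive (Derive_n u k) x.

(** H^infinity(T) for real-valued functions: smooth 2pi-periodic functions
    (on the torus H^infinity = C^infinity by Sobolev embedding). *)
Definition H_infty (u : R -> R) : Prop := periodic u /\ smooth u.

Definition admissible_chi (chi : R -> R) : Prop :=
  smooth chi /\
  (forall xi, 4/3 < Rabs xi -> chi xi = 0) /\
  (forall xi, Rabs xi <= 3/4 -> chi xi = 1).

Definition cexp_i (theta : R) : C := (cos theta, sin theta).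

Definition fourier (u : R -> R) (xi : R) : C :=
  (RInt (fun x => cos (x * xi) * u x) 0 (2 * PI),
   - RInt (fun x => sin (x * xi) * u x) 0 (2 * PI)).

(** Multiplier of the block with index k = j+1 (k = 0 is Delta_{-1}):
    chi for k = 0, phi_j(xi) = chi(2^{-j} xi / 2) - chi(2^{-j} xi) for k = j+1. *)
Definition block_mult (chi : R -> R) (k : nat) (xi : R) : R :=
  match k with
  | O => chi xi
  | S j => chi (xi / 2 ^ j / 2) - chi (xi / 2 ^ j)
  end.

(** Periodic dyadic block Delta_{k-1} u (x)
    = 1/(2pi) sum_{xi in Z} m(xi) hat u(xi) e^{i x xi}.
    The multiplier vanishes for |xi| > 2^(k+1) (support of chi), so the sum
    over Z reduces to the finite sum over -2^(k+1) <= xi <= 2^(k+1). *)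
Definition dyadic_block (chi : R -> R) (k : nat) (u : R -> R) (x : R) : C :=
  let N := (2 ^ (S k))%nat in
  Cmult (RtoC (/ (2 * PI)))
    (sum_n (fun i : nat =>
       let xi := INR i - INR N in
       Cmult (RtoC (block_mult chi k xi)) (Cmult (fourier u xi) (cexp_i (x * xi))))
     (2 * N)%nat).

(** L^infinity(T) norm (sup over a period = sup over R for periodic functions). *)
Definition Linf_norm (f : R -> C) : R :=
  real (Lub_Rbar (fun r => exists x, r = Cmod (f x))).

(** Besov norm B^1_{infty,1}(T): sum_{j >= -1} 2^j ||Delta_j f||_infty,
    as an extended real (supremum of the nonnegative partial sums). *)
Definition besov_1_inf_1 (chi : R -> R) (f : R -> R) : Rbar :=
  Sup_seq (fun M : nat =>
    Finite (sum_n (fun k : nat => (2 ^ k / 2) * Linf_norm (dyadic_block chi k f)) M)).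

(** u : [0,T) -> H^infinity(T) is a solution of the periodic Camassa-Holm
    equation with initial datum u0, with u in C([0,T); H^infinity(T)):
    every x-derivative of u is jointly continuous on [0,T) x R, and on (0,T)
      u_t + u u_x = - d_x (1 - d_x^2)^{-1} (u^2 + 1/2 u_x^2),
    where (1 - d_x^2)^{-1} f is the unique 2pi-periodic C^2 solution P of
    P - P'' = f. *)
Definition CH_solution (T : R) (u0 : R -> R) (u : R -> R -> R) : Prop :=
  0 < T /\
  (forall x, u 0 x = u0 x) /\
  (forall t, 0 <= t < T -> H_infty (u t)) /\
  (forall (k : nat) t x, 0 <= t < T ->
     forall eps, 0 < eps -> exists delta, 0 < delta /\
       forall s y, 0 <= s < T -> Rabs (s - t) < delta -> Rabs (y - x) < delta ->
         Rabs (Derive_n (u s) k y - Derive_n (u t) k x) < eps) /\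
  (forall t, 0 < t < T ->
     (forall x, ex_derive (fun s => u s x) t) /\
     exists P : R -> R,
       periodic P /\
       (forall y, ex_derive P y /\ ex_derive (Derive P) y /\
          P y - Derive (Derive P) y = (u t y) ^ 2 + / 2 * (Derive (u t) y) ^ 2) /\
       (forall y, Derive (fun s => u s y) t + u t y * Derive (u t) y = - Derive P y)).

(* Main.v *)
(** The gradient [u_x] is bounded along the solution, but [u_x^2] is a source of the equation for [u_x], and the
    Besov norm [B^0_{oo,1}] is not controlled by the sup norm under squaring.  The datum is a wave of frequency [L] with the
    slowly varying envelope [1 + amp * saw n], where [saw n] is a truncated Fourier series of a sawtooth.  All its
    frequencies lie where a single block is the identity, so its [B^1_{oo,1}] norm is of order [eps].  The square of its
    gradient contains the low-frequency part [eps^2 amp saw], each of whose [log n] dyadic blocks has size of order [eps^2].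
    In Lagrangian coordinates [u_x (t)] equals [u0' + (t / 2) u0'^2] up to a Lipschitz term and an [O(eps^3 t^2)]
    error; pairing it with test functions localized in frequency and concentrated at the jump shows that about [log n] blocks
    of [u_x (t)] have size at least [c t eps^2], and [n] is arbitrarily large, independently of [eps] and [t].

    The solution is built from the flow [psi]: for the diagonal variables [u + u_x] and [u - u_x] the nonlocal operators
    become one-sided first-order integral operators, and the logarithm [r] of the Jacobian [psi_x] solves an ordinary differential
    equation with a Lipschitz right-hand side as long as [r] is bounded, which a truncation and an a priori bound ensure on
    [[0, 1]].  Uniqueness follows from an [L^2] estimate of the difference. *)
Require Import Defs.
From Stdlib Require Import Reals Lra Lia Arith FunctionalExtensionality.
From Coquelicot Require Import Coquelicot.
Open Scope R_scope.

(** Write [d] for the derivative of [u0]. Along the flow the equation for [u_x] has the Riccati term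
    [- u_x ^ 2 / 2], which gives [d - (t / 2) d ^ 2], with the opposite sign to the expansion
    announced above. A pairing with a test function brings in the Jacobian, [1 + t d] to first
    order, and [(1 + t d) (d - (t / 2) d ^ 2)] has quadratic part [+ (t / 2) d ^ 2]. Blocks are
    bounded below only by duality, so no commutator or composition estimate in Besov spaces is
    involved. Each error is beaten for its own reason. The linear term [d] is the derivative of a
    function of size [eps / L], with [L] chosen last. The Lipschitz term, tested at scale [2^(-i)],
    costs a factor [2^(-i)] and is negligible past a fixed index. The cubic error has an extra
    factor [eps t], which must be below an absolute constant. The number of modes of the sawtooth is
    unrelated to the [n] of the statement, which enters only through [eps = 1 / (2 log log n)],
    [t = 1 / log n] and the target value. The datum is small in [W^{1,oo}] uniformly in [L], so the
    solution lives on the fixed interval [[0, 1]]. *)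

Lemma continuous_pow_comp (f : R -> R) n x : continuous f x -> continuous (fun x => f x ^ n) x.
Proof.
  intros Hf. induction n as [|n IH]; simpl; [apply continuous_const|].
  now apply (continuous_mult f (fun x => f x ^ n)).
Qed.

Ltac cont := lazymatch goal with
  | |- continuous (fun _ => ?c) _ => apply continuous_const
  | |- continuous (fun x => @?f x + @?g x) _ => apply (continuous_plus f g); cont
  | |- continuous (fun x => @?f x - @?g x) _ => apply (continuous_minus f g); cont
  | |- continuous (fun x => @?f x * @?g x) _ => apply (continuous_mult f g); cont
  | |- continuous (fun x => - @?f x) _ => apply (continuous_opp f); cont
  | |- continuous (fun x => @?f x ^ ?n) _ => apply (continuous_pow_comp f n); cont
  | |- continuous (fun x => x) _ => apply continuous_id
  | _ => auto
  end.

Lemma is_derive_eq (f : R -> R) (x l l' : R) : is_derive f x l -> l = l' -> is_derive f x l'.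
Proof. now intros H <-. Qed.

Ltac der_rec := lazymatch goal with
  | |- is_derive (fun _ => ?c) _ _ => apply is_derive_const
  | |- is_derive (fun x => @?f x + @?g x) _ _ => eapply (is_derive_plus f g); der_rec
  | |- is_derive (fun x => @?f x - @?g x) _ _ => eapply (is_derive_minus f g); der_rec
  | |- is_derive (fun x => - @?f x) _ _ => eapply (is_derive_opp f); der_rec
  | |- is_derive (fun x => @?f x * @?g x) _ _ => eapply (is_derive_mult f g); [der_rec|der_rec|intros; apply Rmult_comm]
  | |- is_derive (fun x => x) _ _ => apply is_derive_id
  | _ => eauto
  end.

(** Computes a derivative from derivatives of the atoms found in the context. *)
Ltac der := eapply is_derive_eq; [der_rec|
  unfold plus, minus, opp, mult, scal, zero, one; simpl; unfold plus, minus, opp, mult, scal, zero, one; simpl;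
  lazymatch goal with |- @eq _ ?a ?b => change (@eq R a b) end; try ring].

(** * Joint continuity in time and space, and integrals with a parameter *)

(** Continuity is asked on the whole plane: functions of time are extended by [clamp] outside their
    interval, so that no domain has to be carried along. *)
Definition cont2 (f : R -> R -> R) : Prop := forall t x, continuity_2d_pt f t x.

Lemma continuity_pt_of_continuous (f : R -> R) x : continuous f x -> continuity_pt f x.
Proof. intros H. now apply continuity_pt_filterlim. Qed.

Lemma continuous_of_derive (f : R -> R) x l : is_derive f x l -> continuous f x.
Proof. intros H. apply (ex_derive_continuous f). now exists l. Qed.

Lemma continuous_exp x : continuous exp x.
Proof. apply (continuous_of_derive _ _ (exp x)). apply is_derive_exp. Qed.

Lemma continuous_Rinv_pt x : x <> 0 -> continuous Rinv x.
Proof. intros H. apply (continuous_of_derive _ _ (- / x ^ 2)). auto_derive; [exact H|]. field. exact H. Qed.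

Lemma ex_RInt_cont (f : R -> R) a b : (forall x : R, continuous f x) -> ex_RInt f a b.
Proof. intros H. apply (ex_RInt_continuous f). auto. Qed.

Lemma cont2_const c : cont2 (fun _ _ => c).
Proof. intros t x. apply continuity_2d_pt_const. Qed.

Lemma cont2_plus f g : cont2 f -> cont2 g -> cont2 (fun t x => f t x + g t x).
Proof. intros H1 H2 t x. now apply continuity_2d_pt_plus. Qed.

Lemma cont2_minus f g : cont2 f -> cont2 g -> cont2 (fun t x => f t x - g t x).
Proof. intros H1 H2 t x. now apply continuity_2d_pt_minus. Qed.

Lemma cont2_mult f g : cont2 f -> cont2 g -> cont2 (fun t x => f t x * g t x).
Proof. intros H1 H2 t x. now apply continuity_2d_pt_mult. Qed.

Lemma cont2_opp f : cont2 f -> cont2 (fun t x => - f t x).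
Proof. intros H1 t x. now apply continuity_2d_pt_opp. Qed.

Lemma cont2_fst : cont2 (fun t _ => t).
Proof. intros t x. apply continuity_2d_pt_id1. Qed.

Lemma cont2_snd : cont2 (fun _ x => x).
Proof. intros t x. apply continuity_2d_pt_id2. Qed.

Lemma cont2_comp1 (g : R -> R) f : (forall z : R, continuous g z) -> cont2 f -> cont2 (fun t x => g (f t x)).
Proof.
  intros Hg Hf t x. apply continuity_1d_2d_pt_comp; [|apply Hf].
  now apply continuity_pt_of_continuous.
Qed.

Lemma cont2_comp2 f g h : cont2 f -> cont2 g -> cont2 h -> cont2 (fun t x => f (g t x) (h t x)).
Proof.
  intros Hf Hg Hh t x eps.
  destruct (Hf (g t x) (h t x) eps) as [d Hd].
  destruct (Hg t x d) as [d1 H1]. destruct (Hh t x d) as [d2 H2].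
  exists (mkposreal _ (Rmin_stable_in_posreal d1 d2)). simpl.
  intros u v Hu Hv.
  assert (Rmin d1 d2 <= d1) by apply Rmin_l. assert (Rmin d1 d2 <= d2) by apply Rmin_r.
  apply Hd; [apply H1|apply H2]; lra.
Qed.

Lemma cont2_inv f : cont2 f -> (forall t x, f t x <> 0) -> cont2 (fun t x => / f t x).
Proof. intros H1 H2 t x. now apply continuity_2d_pt_inv. Qed.

Lemma cont2_ext f g : (forall t x, f t x = g t x) -> cont2 f -> cont2 g.
Proof. intros H Hf t x. apply continuity_2d_pt_ext with f; auto. Qed.

Lemma cont2_slice f t x : cont2 f -> continuous (f t) x.
Proof.
  intros H. apply continuity_pt_filterlim. apply continuity_pt_locally.
  intros eps. destruct (H t x eps) as [d Hd]. exists d. intros y Hy.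
  apply Hd; [|exact Hy]. rewrite Rminus_diag. rewrite Rabs_R0. apply cond_pos.
Qed.

Lemma cont2_swap f : cont2 f -> cont2 (fun t x => f x t).
Proof.
  intros H. apply (cont2_comp2 f (fun _ x => x) (fun t _ => t)); auto using cont2_fst, cont2_snd.
Qed.

Lemma cont2_slice1 f t x : cont2 f -> continuous (fun s => f s x) t.
Proof. intros H. exact (cont2_slice (fun x t => f t x) x t (cont2_swap f H)). Qed.

Lemma cont2_of_1d (f : R -> R) : (forall x : R, continuous f x) -> cont2 (fun _ x => f x).
Proof. intros H. apply cont2_comp1; auto using cont2_snd. Qed.

Lemma cont2_of_1d_fst (f : R -> R) : (forall x : R, continuous f x) -> cont2 (fun t _ => f t).
Proof. intros H. apply (cont2_comp1 f (fun t _ => t)); auto using cont2_fst. Qed.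

(** Uniform continuity at tolerance 1 gives the bound: the segment from the corner [(a, c)] to
    [(t, x)] is walked in a fixed number of steps, and [f] changes by less than 1 along each. *)
Lemma cont2_bounded f a b c d : cont2 f ->
  exists B, 0 < B /\ forall t x, a <= t <= b -> c <= x <= d -> Rabs (f t x) <= B.
Proof.
  intros Hf.
  destruct (uniform_continuity_2d f a b c d (fun t x _ _ => Hf t x) (mkposreal 1 Rlt_0_1)) as [del Hd].
  simpl in Hd.
  (* [D] dominates both sides of the box, so one number of steps serves both coordinates. *)
  set (D := (b - a) + (d - c)).
  destruct (nfloor_ex (Rmax 0 (D / del))) as [n [_ Hn]]; [apply Rmax_l|].
  assert (HD : D < INR (S n) * del).
  { rewrite S_INR. assert (D / del < INR n + 1). { eapply Rle_lt_trans; [|exact Hn]. apply Rmax_r. }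
    apply Rmult_lt_reg_r with (/ del). apply Rinv_0_lt_compat, cond_pos.
    rewrite Rmult_assoc, Rinv_r, Rmult_1_r; [assumption|]. apply Rgt_not_eq, cond_pos. }
  exists (Rabs (f a c) + INR (S n) + 1). split.
  { assert (0 <= Rabs (f a c)) by apply Rabs_pos. assert (0 <= INR (S n)) by apply pos_INR. lra. }
  intros t x Ht Hx.
  assert (HS : 0 < INR (S n)) by (apply lt_0_INR; lia).
  set (p := fun k : nat => a + INR k / INR (S n) * (t - a)).
  set (q := fun k : nat => c + INR k / INR (S n) * (x - c)).
  assert (Hfrac : forall k, (k <= S n)%nat -> 0 <= INR k / INR (S n) <= 1).
  { intros k Hk. split. apply Rdiv_le_0_compat; [apply pos_INR|exact HS].
    apply Rmult_le_reg_r with (INR (S n)); [exact HS|]. unfold Rdiv. rewrite Rmult_assoc, Rinv_l, Rmult_1_r, Rmult_1_l; [|lra].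
    now apply le_INR. }
  assert (Hk : forall k, (k <= S n)%nat -> Rabs (f (p k) (q k)) <= Rabs (f a c) + INR k).
  { induction k as [|k IH]; intros Hk.
    - unfold p, q. simpl INR. unfold Rdiv. rewrite !Rmult_0_l, !Rplus_0_r. lra.
    - assert (H1 : Rabs (f (p (S k)) (q (S k)) - f (p k) (q k)) < 1).
      { assert (F1 := Hfrac k ltac:(lia)). assert (F2 := Hfrac (S k) Hk).
        assert (E : INR (S k) / INR (S n) - INR k / INR (S n) = / INR (S n)).
        { rewrite (S_INR k). field. lra. }
        assert (Hi : 0 < / INR (S n)) by now apply Rinv_0_lt_compat.
        assert (HDn : D * / INR (S n) < del).
        { apply Rmult_lt_reg_r with (INR (S n)); [exact HS|]. rewrite Rmult_assoc, Rinv_l; lra. }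
        apply Hd; unfold p, q; try nra.
        - replace (a + INR (S k) / INR (S n) * (t - a) - (a + INR k / INR (S n) * (t - a)))
            with ((INR (S k) / INR (S n) - INR k / INR (S n)) * (t - a)) by ring.
          rewrite E. rewrite Rabs_pos_eq; unfold D in *; nra.
        - replace (c + INR (S k) / INR (S n) * (x - c) - (c + INR k / INR (S n) * (x - c)))
            with ((INR (S k) / INR (S n) - INR k / INR (S n)) * (x - c)) by ring.
          rewrite E. rewrite Rabs_pos_eq; unfold D in *; nra. }
      specialize (IH ltac:(lia)). rewrite (S_INR k).
      assert (Rabs (f (p (S k)) (q (S k))) <= Rabs (f (p (S k)) (q (S k)) - f (p k) (q k)) + Rabs (f (p k) (q k))).
      { replace (f (p (S k)) (q (S k))) with (f (p (S k)) (q (S k)) - f (p k) (q k) + f (p k) (q k)) at 1 by ring.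
        apply Rabs_triang. }
      lra. }
  specialize (Hk (S n) (le_n _)).
  unfold p, q in Hk. replace (INR (S n) / INR (S n)) with 1 in Hk by (field; lra).
  replace (a + 1 * (t - a)) with t in Hk by ring. replace (c + 1 * (x - c)) with x in Hk by ring. lra.
Qed.

Lemma RInt_abs_le (f : R -> R) a b K : (forall x : R, continuous f x) ->
  (forall x, Rmin a b <= x <= Rmax a b -> Rabs (f x) <= K) -> Rabs (RInt f a b) <= K * Rabs (b - a).
Proof.
  intros Hf HK. destruct (Rle_dec a b) as [H|H].
  - rewrite Rmult_comm, (Rabs_pos_eq (b - a)) by lra. apply abs_RInt_le_const; auto using ex_RInt_cont.
    intros x Hx. apply HK. rewrite Rmin_left, Rmax_right; lra.
  - rewrite <- opp_RInt_swap by now apply ex_RInt_cont. unfold opp; simpl. rewrite Rabs_Ropp.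
    rewrite Rmult_comm, Rabs_minus_sym, (Rabs_pos_eq (a - b)) by lra.
    apply abs_RInt_le_const; [lra|now apply ex_RInt_cont|].
    intros x Hx. apply HK. rewrite Rmin_right, Rmax_left; lra.
Qed.

Lemma RInt_minus_cont (f g : R -> R) a b : (forall x : R, continuous f x) -> (forall x : R, continuous g x) ->
  RInt (fun x => f x - g x) a b = RInt f a b - RInt g a b.
Proof. intros Hf Hg. apply (RInt_minus f g); now apply ex_RInt_cont. Qed.

Lemma RInt_plus_cont (f g : R -> R) a b : (forall x : R, continuous f x) -> (forall x : R, continuous g x) ->
  RInt (fun x => f x + g x) a b = RInt f a b + RInt g a b.
Proof. intros Hf Hg. apply (RInt_plus f g); now apply ex_RInt_cont. Qed.

Lemma RInt_scal_cont (f : R -> R) k a b : (forall x : R, continuous f x) ->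
  RInt (fun x => k * f x) a b = k * RInt f a b.
Proof. intros Hf. apply (RInt_scal f); now apply ex_RInt_cont. Qed.

Lemma RInt_Chasles_cont (f : R -> R) a b c : (forall x : R, continuous f x) ->
  RInt f a b + RInt f b c = RInt f a c.
Proof. intros Hf. apply (RInt_Chasles f a b c); now apply ex_RInt_cont. Qed.

Lemma RInt_ext_all (f g : R -> R) a b : (forall x, f x = g x) -> RInt f a b = RInt g a b.
Proof. intros H. apply RInt_ext. auto. Qed.

Lemma RInt_const_R (c a b : R) : RInt (fun _ => c) a b = c * (b - a).
Proof. rewrite RInt_const. apply Rmult_comm. Qed.

Lemma RInt_zero_fun (f : R -> R) a b : (forall x, f x = 0) -> RInt f a b = 0.
Proof. intros H. rewrite (RInt_ext_all f (fun _ => 0)), RInt_const_R by auto. apply Rmult_0_l. Qed.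

Lemma is_derive_RInt_cont (f : R -> R) a x : (forall y : R, continuous f y) ->
  is_derive (fun z => RInt f a z) x (f x).
Proof.
  intros Hf. apply is_derive_RInt with a; [|apply Hf].
  apply filter_forall. intros b. apply RInt_correct. now apply ex_RInt_cont.
Qed.

Lemma RInt_derive (f df : R -> R) a b : (forall x : R, is_derive f x (df x)) -> (forall x : R, continuous df x) ->
  RInt df a b = f b - f a.
Proof.
  intros H1 H2. apply is_RInt_unique. apply (is_RInt_derive f df); auto.
Qed.

(** The integral is split at [x0]: on [[0, x0]] uniform continuity on a box compares [f t] with
    [f t0], and the short remaining piece is bounded by its length. *)
Lemma cont2_RInt f : cont2 f -> cont2 (fun t x => RInt (f t) 0 x).
Proof.
  intros Hf t0 x0 eps.
  set (A := Rabs x0 + 1).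
  assert (HA : 0 < A) by (unfold A; assert (0 <= Rabs x0) by apply Rabs_pos; lra).
  destruct (cont2_bounded f (t0 - 1) (t0 + 1) (- A) A Hf) as [B [HB Hbd]].
  assert (He : 0 < eps / (2 * A)) by (apply Rdiv_lt_0_compat; [apply cond_pos|lra]).
  destruct (uniform_continuity_2d f (t0 - 1) (t0 + 1) (- A) A (fun t x _ _ => Hf t x) (mkposreal _ He)) as [d Hd].
  simpl in Hd.
  assert (Hp : 0 < Rmin (Rmin 1 d) (eps / (2 * B))).
  { repeat apply Rmin_glb_lt; try lra. apply cond_pos. apply Rdiv_lt_0_compat; [apply cond_pos|lra]. }
  exists (mkposreal _ Hp). simpl. intros t x Ht Hx.
  assert (M1 : Rmin (Rmin 1 d) (eps / (2 * B)) <= Rmin 1 d) by apply Rmin_l.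
  assert (M2 : Rmin (Rmin 1 d) (eps / (2 * B)) <= eps / (2 * B)) by apply Rmin_r.
  assert (M3 : Rmin 1 d <= 1) by apply Rmin_l. assert (M4 : Rmin 1 d <= d) by apply Rmin_r.
  assert (Ht1 : t0 - 1 <= t <= t0 + 1) by (apply Rabs_lt_between' in Ht; lra).
  assert (Hx0 : - A <= x0 - 1 /\ x0 + 1 <= A).
  { unfold A. generalize (Rle_abs x0) (Rle_abs (- x0)). rewrite Rabs_Ropp. lra. }
  assert (Hx1 : x0 - 1 <= x <= x0 + 1) by (apply Rabs_lt_between' in Hx; lra).
  assert (Hc : forall s y, continuous (f s) y) by (intros; now apply cont2_slice).
  rewrite <- (RInt_Chasles_cont (f t) 0 x0 x) by auto.
  replace (RInt (f t) 0 x0 + RInt (f t) x0 x - RInt (f t0) 0 x0)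
    with (RInt (fun y => f t y - f t0 y) 0 x0 + RInt (f t) x0 x).
  2:{ rewrite RInt_minus_cont by auto. ring. }
  eapply Rle_lt_trans; [apply Rabs_triang|].
  assert (E1 : Rabs (RInt (fun y => f t y - f t0 y) 0 x0) <= eps / (2 * A) * Rabs (x0 - 0)).
  { apply RInt_abs_le. intros y. apply (continuous_minus (f t) (f t0)); auto.
    intros y Hy. left.
    assert (- A <= y <= A).
    { assert (Rmin 0 x0 >= - A). apply Rle_ge, Rmin_glb; lra.
      assert (Rmax 0 x0 <= A). apply Rmax_lub; lra. lra. }
    apply Hd; try lra. rewrite Rminus_diag, Rabs_R0. apply cond_pos. }
  assert (E2 : Rabs (RInt (f t) x0 x) <= B * Rabs (x - x0)).
  { apply RInt_abs_le; auto. intros y Hy. apply Hbd; [lra|].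
    assert (Rmin x0 x >= x0 - 1). apply Rle_ge, Rmin_glb; lra.
    assert (Rmax x0 x <= x0 + 1). apply Rmax_lub; lra. lra. }
  rewrite Rminus_0_r in E1.
  assert (E3 : eps / (2 * A) * Rabs x0 <= eps / 2).
  { replace (eps / 2) with (eps / (2 * A) * A) by (field; lra). apply Rmult_le_compat_l; [lra|]. unfold A; lra. }
  assert (E4 : B * Rabs (x - x0) < eps / 2).
  { replace (eps / 2) with (B * (eps / (2 * B))) by (field; lra). apply Rmult_lt_compat_l; lra. }
  lra.
Qed.

Lemma cont2_RInt_bounds f g h : cont2 f -> cont2 g -> cont2 h ->
  cont2 (fun t x => RInt (f t) (g t x) (h t x)).
Proof.
  intros Hf Hg Hh.
  apply cont2_ext with (fun t x => RInt (f t) 0 (h t x) - RInt (f t) 0 (g t x)).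
  - intros t x. rewrite <- (RInt_Chasles_cont (f t) 0 (g t x) (h t x)). ring.
    intros y. now apply cont2_slice.
  - apply cont2_minus.
    + apply (cont2_comp2 (fun t x => RInt (f t) 0 x) (fun t _ => t) h); auto using cont2_RInt, cont2_fst.
    + apply (cont2_comp2 (fun t x => RInt (f t) 0 x) (fun t _ => t) g); auto using cont2_RInt, cont2_fst.
Qed.

Lemma cont2_RInt_time f (tau : R -> R) : cont2 f -> (forall t : R, continuous tau t) ->
  cont2 (fun t x => RInt (fun s => f s x) 0 (tau t)).
Proof.
  intros Hf Ht.
  apply (cont2_comp2 (fun x t => RInt (fun s => f s x) 0 t) (fun _ x => x) (fun t _ => tau t)).
  - apply (cont2_RInt (fun x s => f s x)). now apply cont2_swap.
  - apply cont2_snd.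
  - now apply cont2_of_1d_fst.
Qed.

(** Differentiability is asked only near [t0], because the flow and the solutions have time
    derivatives only inside their time interval. *)
Lemma is_derive_RInt_param_loc (f g : R -> R -> R) a b t0 :
  locally t0 (fun t => forall y, is_derive (fun s => f s y) t (g t y)) ->
  cont2 g -> (forall t y : R, continuous (f t) y) ->
  is_derive (fun t => RInt (f t) a b) t0 (RInt (g t0) a b).
Proof.
  intros Hd Hg Hf.
  assert (E : RInt (fun y => Derive (fun s => f s y) t0) a b = RInt (g t0) a b).
  { apply RInt_ext_all. intros y. apply is_derive_unique. exact (locally_singleton _ _ Hd y). }
  rewrite <- E.
  apply (is_derive_RInt_param f a b t0).
  - apply filter_imp with (2 := Hd). intros t Ht y _. eexists. apply Ht.
  - intros y _. apply continuity_2d_pt_ext_loc with g; [|apply Hg].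
    destruct Hd as [d Hd]. exists d. intros u v Hu _. symmetry. apply is_derive_unique. apply Hd. exact Hu.
  - apply filter_forall. intros t. apply ex_RInt_cont. auto.
Qed.

Lemma is_derive_RInt_param_all (f g : R -> R -> R) a b t0 :
  (forall t y : R, is_derive (fun s => f s y) t (g t y)) ->
  cont2 g -> (forall t y : R, continuous (f t) y) ->
  is_derive (fun t => RInt (f t) a b) t0 (RInt (g t0) a b).
Proof. intros H. apply is_derive_RInt_param_loc. now apply filter_forall. Qed.

(** * Functions with jointly continuous space derivatives *)

(** The derivative is an existential witness rather than [Derive], so that closure under products,
    exponentials and time integrals reduces to exhibiting its formula. *)
Fixpoint CK (k : nat) (f : R -> R -> R) : Prop :=
  match k with
  | O => cont2 f
  | S k => cont2 f /\ exists g, (forall t x : R, is_derive (f t) x (g t x)) /\ CK k g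
  end.

Lemma CK_cont2 k f : CK k f -> cont2 f.
Proof. destruct k; simpl; tauto. Qed.

Lemma CK_S k f g : cont2 f -> (forall t x : R, is_derive (f t) x (g t x)) -> CK k g -> CK (S k) f.
Proof. intros. split; [assumption|]. now exists g. Qed.

Lemma CK_pred k f : CK (S k) f -> CK k f.
Proof.
  revert f. induction k as [|k IH]; intros f [H [g [Hg HK]]]; [exact H|].
  apply CK_S with g; auto.
Qed.

Lemma CK_ext k f g : (forall t x, f t x = g t x) -> CK k f -> CK k g.
Proof.
  destruct k as [|k]; simpl; intros E.
  - now apply cont2_ext.
  - intros [H [h [Hh HK]]]. split; [now apply cont2_ext with f|]. exists h. split; [|exact HK].
    intros t x. apply is_derive_ext with (f t); auto.
Qed.

Lemma CK_const k c : CK k (fun _ _ => c).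
Proof.
  revert c. induction k as [|k IH]; intros c; [apply cont2_const|].
  apply CK_S with (fun _ _ => 0); auto using cont2_const. intros t x. apply @is_derive_const.
Qed.

Lemma CK_plus k f g : CK k f -> CK k g -> CK k (fun t x => f t x + g t x).
Proof.
  revert f g. induction k as [|k IH]; intros f g; [apply cont2_plus|].
  intros [H1 [f' [Hf Kf]]] [H2 [g' [Hg Kg]]].
  apply CK_S with (fun t x => f' t x + g' t x); auto using cont2_plus.
  intros t x. now apply @is_derive_plus.
Qed.

Lemma CK_mult k f g : CK k f -> CK k g -> CK k (fun t x => f t x * g t x).
Proof.
  revert f g. induction k as [|k IH]; intros f g; [apply cont2_mult|].
  intros Cf Cg. assert (Cf' := CK_pred _ _ Cf). assert (Cg' := CK_pred _ _ Cg).
  destruct Cf as [H1 [f' [Hf Kf]]], Cg as [H2 [g' [Hg Kg]]].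
  apply CK_S with (fun t x => f' t x * g t x + f t x * g' t x); auto using cont2_mult, CK_plus.
  intros t x. apply (is_derive_mult (f t) (g t)); auto. intros; apply Rmult_comm.
Qed.

Lemma CK_scal k c f : CK k f -> CK k (fun t x => c * f t x).
Proof. intros. apply CK_mult; auto using CK_const. Qed.

Lemma CK_opp k f : CK k f -> CK k (fun t x => - f t x).
Proof. intros H. apply CK_ext with (fun t x => (-1) * f t x); [intros; ring|]. now apply CK_scal. Qed.

Lemma CK_minus k f g : CK k f -> CK k g -> CK k (fun t x => f t x - g t x).
Proof. intros. apply CK_plus; auto using CK_opp. Qed.

Lemma CK_exp k f : CK k f -> CK k (fun t x => exp (f t x)).
Proof.
  revert f. induction k as [|k IH]; intros f.
  - apply cont2_comp1. apply continuous_exp.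
  - intros Cf. assert (Cf' := CK_pred _ _ Cf). destruct Cf as [H1 [f' [Hf Kf]]].
    apply CK_S with (fun t x => f' t x * exp (f t x)); auto using CK_mult.
    + apply cont2_comp1; auto using continuous_exp.
    + intros t x. apply (is_derive_comp exp (f t)); auto. apply is_derive_exp.
Qed.

Lemma CK_of_1d (f : R -> R) k : smooth f -> CK k (fun _ x => f x).
Proof.
  intros Hs.
  assert (H : forall j, CK k (fun _ x => Derive_n f j x)).
  { induction k as [|k IH]; intros j.
    - apply cont2_of_1d. intros x. apply (ex_derive_continuous (Derive_n f j)). apply Hs.
    - apply CK_S with (fun _ x => Derive_n f (S j) x); auto.
      + apply cont2_of_1d. intros x. apply (ex_derive_continuous (Derive_n f j)). apply Hs.
      + intros t x. simpl. apply Derive_correct. apply Hs. }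
  apply (H 0%nat).
Qed.

Lemma CK_RInt_time k f (tau : R -> R) : (forall t : R, continuous tau t) -> CK k f ->
  CK k (fun t x => RInt (fun s => f s x) 0 (tau t)).
Proof.
  intros Ht. revert f. induction k as [|k IH]; intros f; [intros; now apply cont2_RInt_time|].
  intros [H1 [f' [Hf Kf]]].
  apply CK_S with (fun t x => RInt (fun s => f' s x) 0 (tau t)); auto using cont2_RInt_time.
  intros t x. apply (is_derive_RInt_param_all (fun x s => f s x) (fun x s => f' s x)).
  - intros y s. apply Hf.
  - apply cont2_swap. now apply CK_cont2 in Kf.
  - intros y s. now apply (cont2_slice1 f s y).
Qed.

Lemma Derive_n_Derive (f : R -> R) k x : Derive_n (Derive f) k x = Derive_n f (S k) x.
Proof.
  revert x. induction k as [|k IH]; intros x; [reflexivity|].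
  simpl. apply Derive_ext. intros y. rewrite IH. reflexivity.
Qed.

(** Returns from the witnesses of [CK] to the iterated [Derive_n] in which [H_infty] and
    [CH_solution] are written. *)
Lemma CK_Derive_n f k : (forall j, CK j f) ->
  cont2 (fun t x => Derive_n (f t) k x) /\ forall t x, ex_derive (Derive_n (f t) k) x.
Proof.
  intros H. assert (H' : CK (S k) f) by auto. clear H. revert f H'.
  induction k as [|k IH]; intros f [H1 [f' [Hf Kf]]].
  - split; [exact H1|]. intros t x. exists (f' t x). apply Hf.
  - assert (E : forall t x, Derive_n (f' t) k x = Derive_n (f t) (S k) x).
    { intros t x. rewrite <- Derive_n_Derive. apply Derive_n_ext. intros y. symmetry. apply is_derive_unique, Hf. }
    destruct (IH f' Kf) as [A B]. split.
    + apply cont2_ext with (2 := A). exact E.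
    + intros t x. apply ex_derive_ext with (2 := B t x). apply E.
Qed.

(** * One-sided first-order integral operators *)

Ltac toR := lazymatch goal with |- @eq _ ?a ?b => change (@eq R a b) end.

Ltac pos := repeat match goal with
  | |- 0 < _ * _ => apply Rmult_lt_0_compat
  | |- 0 < _ + _ => apply Rplus_lt_0_compat
  | |- 0 < _ / _ => apply Rdiv_lt_0_compat
  | |- 0 < / _ => apply Rinv_0_lt_compat
  | |- 0 < _ ^ _ => apply pow_lt
  | |- 0 < exp _ => apply exp_pos
  | |- 0 <= _ * _ => apply Rmult_le_pos
  | |- 0 <= _ + _ => apply Rplus_le_le_0_compat
  | |- 0 <= _ / _ => apply Rdiv_le_0_compat
  | |- 0 <= _ ^ _ => apply pow_le
  | |- 0 <= Rabs _ => apply Rabs_pos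
  end; try lra.

Lemma RInt_shift (f : R -> R) a b c : (forall x : R, continuous f x) ->
  RInt (fun y => f (y + c)) a b = RInt f (a + c) (b + c).
Proof.
  intros Hf. rewrite <- (Rmult_1_l a) at 2. rewrite <- (Rmult_1_l b) at 2.
  rewrite <- (RInt_comp_lin f 1 c a b) by now apply ex_RInt_cont.
  apply RInt_ext_all. intros x. unfold scal; simpl; unfold mult; simpl. now rewrite !Rmult_1_l.
Qed.

Lemma RInt_periodic_shift (f : R -> R) a : (forall x : R, continuous f x) -> periodic f ->
  RInt f a (a + 2 * PI) = RInt f 0 (2 * PI).
Proof.
  intros Hf Hp.
  rewrite <- (RInt_Chasles_cont f a 0 (a + 2 * PI)), <- (RInt_Chasles_cont f 0 (2 * PI) (a + 2 * PI)) by auto.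
  assert (E : RInt f (2 * PI) (a + 2 * PI) = RInt f 0 a).
  { rewrite <- (Rplus_0_l (2 * PI)) at 1. rewrite <- (RInt_shift f 0 a (2 * PI)) by auto.
    apply RInt_ext_all. apply Hp. }
  rewrite E. assert (H := RInt_Chasles_cont f a 0 a Hf). rewrite RInt_point in H.
  unfold zero in H; simpl in H. lra.
Qed.

(** For [phi' = p] and [phi (x - 2 PI) = phi x - Q], [J Q phi f] is the periodic solution [s] of
    [s' = p s - f]; it is the resolvent [(1 - d_x)^{-1}] written in the variable [phi]. *)
Definition J (Q : R) (phi f : R -> R) (x : R) : R :=
  exp (phi x) / (exp Q - 1) * RInt (fun y => exp (- phi y) * f y) (x - 2 * PI) x.

Lemma continuous_exp_opp (phi : R -> R) y : continuous phi y -> continuous (fun y => exp (- phi y)) y.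
Proof.
  intros H. apply (continuous_comp (fun y => - phi y) exp); [|apply continuous_exp].
  now apply (continuous_opp phi).
Qed.

Lemma continuous_J_integrand (phi f : R -> R) : (forall y : R, continuous phi y) -> (forall y : R, continuous f y) ->
  forall y : R, continuous (fun y => exp (- phi y) * f y) y.
Proof. intros H1 H2 y. apply (continuous_mult (fun y => exp (- phi y)) f); auto using continuous_exp_opp. Qed.

Lemma J_ext Q phi f g x : (forall y : R, f y = g y) -> J Q phi f x = J Q phi g x.
Proof. intros H. unfold J. f_equal. apply RInt_ext_all. intros y. now rewrite H. Qed.

(** A constant added to the phase cancels between [exp (phi x)] and [exp (- phi y)]. This lets the
    displacement measured from the label 0 be replaced by the flow map [psi]. *)
Lemma J_phase_shift Q phi psi f c x : (forall y : R, psi y = phi y + c) -> (forall y : R, continuous phi y) ->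
  (forall y : R, continuous f y) -> J Q psi f x = J Q phi f x.
Proof.
  intros H Cp Cf. unfold J. rewrite H.
  rewrite (RInt_ext_all _ (fun y => exp (- c) * (exp (- phi y) * f y))).
  - rewrite RInt_scal_cont by now apply continuous_J_integrand. rewrite exp_plus, exp_Ropp. unfold Rdiv.
    generalize (/ (exp Q - 1)). intros d. field. apply Rgt_not_eq, exp_pos.
  - intros y. rewrite H. rewrite Ropp_plus_distr, exp_plus. ring.
Qed.

Lemma J_deriv Q (phi f p : R -> R) x : exp Q <> 1 ->
  (forall y : R, is_derive phi y (p y)) -> (forall y : R, phi (y - 2 * PI) = phi y - Q) ->
  (forall y : R, continuous f y) -> periodic f ->
  is_derive (J Q phi f) x (p x * J Q phi f x - f x).
Proof.
  intros HQ Hphi Hper Hf Hfp. unfold J.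
  assert (Cphi : forall y : R, continuous phi y) by (intros; eapply continuous_of_derive, Hphi).
  assert (HC := continuous_J_integrand phi f Cphi Hf).
  set (F := fun y => exp (- phi y) * f y) in *.
  assert (D : is_derive (fun z => RInt F (z - 2 * PI) z) x (F x - F (x - 2 * PI))).
  { apply (is_derive_ext (fun z => RInt F 0 z - RInt F 0 (z - 2 * PI))).
    - intros z. rewrite <- (RInt_Chasles_cont F 0 (z - 2 * PI) z) by auto. simpl. ring.
    - apply (is_derive_minus (fun z => RInt F 0 z) (fun z => RInt F 0 (z - 2 * PI))).
      + now apply is_derive_RInt_cont.
      + rewrite <- (Rmult_1_l (F (x - 2 * PI))).
        apply (is_derive_comp (fun z => RInt F 0 z) (fun z => z - 2 * PI)).
        * now apply is_derive_RInt_cont.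
        * auto_derive; auto. }
  assert (E : is_derive (fun z => exp (phi z) / (exp Q - 1)) x (p x * exp (phi x) / (exp Q - 1))).
  { unfold Rdiv. apply (is_derive_ext (fun z => / (exp Q - 1) * exp (phi z))); [intros; simpl; ring|].
    replace (p x * exp (phi x) * / (exp Q - 1)) with (/ (exp Q - 1) * (p x * exp (phi x))) by ring.
    apply is_derive_scal. apply (is_derive_comp exp phi); auto. apply is_derive_exp. }
  assert (M := is_derive_mult _ _ x _ _ E D Rmult_comm).
  unfold mult, plus in M; simpl in M.
  match type of M with is_derive _ _ ?l => replace (p x * (exp (phi x) / (exp Q - 1) * RInt F (x - 2 * PI) x) - f x) with l end.
  exact M.
  assert (Ef : f (x - 2 * PI) = f x). { rewrite <- (Hfp (x - 2 * PI)). f_equal; ring. }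
  unfold F at 2 3. rewrite Ef, Hper.
  replace (- (phi x - Q)) with (- phi x + Q) by ring. rewrite exp_plus, exp_Ropp.
  field. split; [lra|]. apply Rgt_not_eq, exp_pos.
Qed.

(** The function [exp (- phi) * s] has derivative [- exp (- phi) * f]; integrating over one period
    and using the jump [Q] determines [s]. Identities between values of [J] thereby reduce to
    checking a first-order equation for a periodic candidate. *)
Lemma J_unique Q (phi f p s : R -> R) : exp Q <> 1 ->
  (forall y : R, is_derive phi y (p y)) -> (forall y : R, phi (y - 2 * PI) = phi y - Q) ->
  (forall y : R, continuous f y) -> periodic s -> (forall y : R, is_derive s y (p y * s y - f y)) ->
  forall x, s x = J Q phi f x.
Proof.
  intros HQ Hphi Hper Hf Hsp Hs x. unfold J.
  assert (Cphi : forall y : R, continuous phi y) by (intros; eapply continuous_of_derive, Hphi).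
  assert (HC := continuous_J_integrand phi f Cphi Hf).
  assert (E : RInt (fun y => exp (- phi y) * f y) (x - 2 * PI) x
     = - (exp (- phi x) * s x) - - (exp (- phi (x - 2 * PI)) * s (x - 2 * PI))).
  { apply (RInt_derive (fun y => - (exp (- phi y) * s y))); [|exact HC].
    intros y. auto_derive.
    - repeat split; eexists; auto.
    - rewrite (is_derive_unique (fun z : R => phi z) y _ (Hphi y)), (is_derive_unique (fun z : R => s z) y _ (Hs y)). ring. }
  rewrite E, Hper.
  assert (Es : s (x - 2 * PI) = s x). { rewrite <- (Hsp (x - 2 * PI)). f_equal; ring. }
  rewrite Es. replace (- (phi x - Q)) with (- phi x + Q) by ring. rewrite exp_plus, exp_Ropp.
  field. split; [apply Rgt_not_eq, exp_pos|lra].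
Qed.

(** A maximum principle: the kernel has a constant sign, and the constant [K] is itself [J] of the
    source [K * p]. The number [sg] is the common sign of [p] and of [exp Q - 1], so that both
    resolvents are covered. *)
Lemma J_bound Q (phi f p : R -> R) sg K x : 0 < sg * (exp Q - 1) -> sg ^ 2 = 1 ->
  (forall y : R, is_derive phi y (p y)) -> (forall y : R, phi (y - 2 * PI) = phi y - Q) ->
  (forall y : R, continuous p y) -> periodic p ->
  (forall y : R, continuous f y) -> (forall y : R, Rabs (f y) <= K * (sg * p y)) ->
  Rabs (J Q phi f x) <= K.
Proof.
  intros HQ Hsg Hphi Hper Cp Pp Hf Hb.
  assert (HQ' : exp Q <> 1) by (intros E; rewrite E in HQ; nra).
  assert (Cphi : forall y : R, continuous phi y) by (intros; eapply continuous_of_derive, Hphi).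
  assert (HC := continuous_J_integrand phi f Cphi Hf).
  assert (CK : forall y : R, continuous (fun y => K * p y) y) by (intros; now apply (continuous_scal_r K p)).
  assert (HCp := continuous_J_integrand phi _ Cphi CK).
  assert (EK : K = J Q phi (fun y => K * p y) x).
  { apply (J_unique Q phi _ p (fun _ => K)); auto.
    - intros y; reflexivity.
    - intros y. replace (p y * K - K * p y) with 0 by ring. apply @is_derive_const. }
  rewrite EK. unfold J. rewrite Rabs_mult.
  assert (PIpos := PI_RGT_0).
  assert (E1 : Rabs (exp (phi x) / (exp Q - 1)) = sg * (exp (phi x) / (exp Q - 1))).
  { assert (0 < sg * (exp (phi x) / (exp Q - 1))).
    { replace (sg * (exp (phi x) / (exp Q - 1))) with (exp (phi x) * (sg * (exp Q - 1)) / (exp Q - 1) ^ 2)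
        by (field; lra).
      apply Rdiv_lt_0_compat. apply Rmult_lt_0_compat; auto using exp_pos. apply pow2_gt_0. lra. }
    assert (sg = 1 \/ sg = -1) as [->| ->].
    { assert ((sg - 1) * (sg + 1) = 0) by nra. apply Rmult_integral in H0. lra. }
    rewrite Rabs_pos_eq; lra. rewrite Rabs_left; lra. }
  rewrite E1.
  assert (E2 : Rabs (RInt (fun y => exp (- phi y) * f y) (x - 2 * PI) x)
     <= sg * RInt (fun y => exp (- phi y) * (K * p y)) (x - 2 * PI) x).
  { rewrite <- RInt_scal_cont by auto.
    eapply Rle_trans. apply abs_RInt_le; [lra|now apply ex_RInt_cont].
    apply RInt_le; [lra| | |].
    - apply ex_RInt_cont. intros y. apply (continuous_comp _ Rabs); auto. apply continuous_Rabs.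
    - apply ex_RInt_cont. intros y. now apply (continuous_scal_r sg (fun y => exp (- phi y) * (K * p y))).
    - intros y _. rewrite Rabs_mult, Rabs_pos_eq by (left; apply exp_pos).
      specialize (Hb y). assert (0 < exp (- phi y)) by apply exp_pos. nra. }
  assert (0 <= sg * (exp (phi x) / (exp Q - 1))) by (rewrite <- E1; apply Rabs_pos).
  eapply Rle_trans. apply Rmult_le_compat_l; [assumption|exact E2].
  set (I := RInt _ _ _). replace (sg * (exp (phi x) / (exp Q - 1)) * (sg * I)) with (sg ^ 2 * (exp (phi x) / (exp Q - 1) * I)) by ring.
  rewrite Hsg. lra.
Qed.

Lemma J_periodic Q (phi f : R -> R) : (forall y : R, continuous phi y) -> (forall y : R, continuous f y) ->
  (forall y : R, phi (y + 2 * PI) = phi y + Q) -> periodic f -> periodic (J Q phi f).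
Proof.
  intros Cphi Hf Hper Hfp x. unfold J.
  assert (HC := continuous_J_integrand phi f Cphi Hf).
  replace (x + 2 * PI - 2 * PI) with ((x - 2 * PI) + 2 * PI) by ring.
  rewrite <- (RInt_shift (fun y => exp (- phi y) * f y)) by auto.
  rewrite (RInt_ext_all _ (fun y => exp (- Q) * (exp (- phi y) * f y))).
  - rewrite RInt_scal_cont by auto. rewrite Hper, exp_plus, exp_Ropp. unfold Rdiv.
    set (I := RInt _ _ _). set (c := / _). assert (exp Q <> 0) by apply Rgt_not_eq, exp_pos.
    replace (x - 2 * PI) with (x - 2 * PI) by ring. unfold c. set (d := exp Q - 1).
    generalize (/ d). intros d'. field. exact H.
  - intros y. rewrite Hper, Hfp. rewrite Ropp_plus_distr, exp_plus. ring.
Qed.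

Lemma cont2_J (Q : R -> R) (phi f : R -> R -> R) : (forall t : R, continuous Q t) -> (forall t, exp (Q t) <> 1) ->
  cont2 phi -> cont2 f -> cont2 (fun t x => J (Q t) (phi t) (f t) x).
Proof.
  intros CQ HQ Hphi Hf. unfold J, Rdiv. repeat apply cont2_mult.
  - apply cont2_comp1; auto using continuous_exp.
  - apply (cont2_inv (fun t _ => exp (Q t) - 1)); [|intros t _; specialize (HQ t); lra].
    apply (cont2_of_1d_fst (fun t => exp (Q t) - 1)). intros t.
    apply (continuous_minus (fun t => exp (Q t)) (fun _ => 1)); [|apply continuous_const].
    apply (continuous_comp Q exp); auto using continuous_exp.
  - apply (cont2_RInt_bounds (fun t y => exp (- phi t y) * f t y) (fun _ x => x - 2 * PI) (fun _ x => x)).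
    + apply cont2_mult; [|exact Hf]. apply (cont2_comp1 exp); [apply continuous_exp|now apply cont2_opp].
    + apply cont2_minus; auto using cont2_snd, cont2_const.
    + apply cont2_snd.
Qed.

Lemma exp_abs_diff a b B : Rabs a <= B -> Rabs b <= B -> Rabs (exp a - exp b) <= exp B * Rabs (a - b).
Proof.
  intros Ha Hb.
  destruct (MVT_gen exp b a exp) as [c [Hc E]].
  - intros; apply is_derive_exp.
  - intros. apply continuity_pt_of_continuous, continuous_exp.
  - rewrite E, Rabs_mult. apply Rmult_le_compat_r; [apply Rabs_pos|].
    rewrite Rabs_pos_eq by (left; apply exp_pos).
    assert (c <= B).
    { apply Rabs_le_between in Ha. apply Rabs_le_between in Hb.
      eapply Rle_trans; [apply Hc|]. apply Rmax_lub; lra. }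
    destruct H as [H| ->]; [left; now apply exp_increasing|lra].
Qed.

Lemma mult_diff_bound a b a' b' A B da db : Rabs a <= A -> Rabs b' <= B -> Rabs (a - a') <= da -> Rabs (b - b') <= db ->
  Rabs (a * b - a' * b') <= A * db + B * da.
Proof.
  intros. replace (a * b - a' * b') with (a * (b - b') + b' * (a - a')) by ring.
  eapply Rle_trans; [apply Rabs_triang|]. rewrite !Rabs_mult.
  assert (0 <= Rabs a) by apply Rabs_pos. assert (0 <= Rabs b') by apply Rabs_pos.
  assert (0 <= Rabs (a-a')) by apply Rabs_pos. assert (0 <= Rabs (b - b')) by apply Rabs_pos. nra.
Qed.

Lemma exp_le x y : x <= y -> exp x <= exp y.
Proof. intros [H| ->]; [left; now apply exp_increasing|lra]. Qed.

(** Dependence on the jump, the phase and the source is estimated at once. Only the differences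
    [phi x - phi y] over one period are bounded, since the kernel sees nothing else, and
    [/ 2 <= Rabs (exp Q - 1)] keeps the normalizing factor below 2. *)
Lemma J_lipschitz B F : 0 < B -> 0 < F -> exists L, 0 < L /\
  forall Q1 Q2 (phi1 phi2 f1 f2 : R -> R) d x,
  (forall y : R, continuous phi1 y) -> (forall y : R, continuous phi2 y) ->
  (forall y : R, continuous f1 y) -> (forall y : R, continuous f2 y) ->
  Rabs Q1 <= B -> Rabs Q2 <= B -> / 2 <= Rabs (exp Q1 - 1) -> / 2 <= Rabs (exp Q2 - 1) ->
  Rabs (Q1 - Q2) <= B * d ->
  (forall y : R, x - 2 * PI <= y <= x -> Rabs (phi1 x - phi1 y) <= B /\ Rabs (phi2 x - phi2 y) <= B /\
     Rabs ((phi1 x - phi1 y) - (phi2 x - phi2 y)) <= B * d /\ Rabs (f1 y) <= F /\ Rabs (f2 y) <= F /\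
     Rabs (f1 y - f2 y) <= F * B * d) ->
  Rabs (J Q1 phi1 f1 x - J Q2 phi2 f2 x) <= L * d /\ Rabs (J Q1 phi1 f1 x) <= L.
Proof.
  intros HB HF. assert (PIpos := PI_RGT_0). set (E := exp B). assert (HE : 0 < E) by apply exp_pos.
  set (L1 := 2 * PI * (2 * (E * (F * B) + F * (E * B)) + E * F * (4 * E * B))).
  set (L2 := 2 * PI * (2 * (E * F))).
  assert (HL1 : 0 < L1).
  { unfold L1. pos. }
  assert (HL2 : 0 < L2) by (unfold L2; pos).
  exists (L1 + L2). split; [lra|].
  intros Q1 Q2 phi1 phi2 f1 f2 d x C1 C2 Cf1 Cf2 HQ1 HQ2 HE1 HE2 HQ H.
  assert (Eq : forall Q phi f, (forall y : R, continuous phi y) -> (forall y : R, continuous f y) ->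
    J Q phi f x = RInt (fun y => / (exp Q - 1) * (exp (phi x - phi y) * f y)) (x - 2 * PI) x).
  { intros Q phi f Cp Cf. unfold J. rewrite <- RInt_scal_cont by now apply continuous_J_integrand.
    apply RInt_ext_all. intros y. unfold Rminus. rewrite exp_plus. unfold Rdiv. ring. }
  assert (CI : forall Q phi f, (forall y : R, continuous phi y) -> (forall y : R, continuous f y) ->
    forall y : R, continuous (fun y => / (exp Q - 1) * (exp (phi x - phi y) * f y)) y).
  { intros Q phi f Cp Cf y. apply (continuous_scal_r (/ (exp Q - 1)) (fun y => exp (phi x - phi y) * f y)).
    apply (continuous_mult (fun y => exp (phi x - phi y)) f); auto.
    apply (continuous_comp (fun y => phi x - phi y) exp); [|apply continuous_exp].
    apply (continuous_minus (fun _ => phi x) phi); auto. apply continuous_const. }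
  assert (Hd : 0 <= d).
  { assert (0 <= Rabs (Q1 - Q2)) by apply Rabs_pos. nra. }
  assert (I1 : forall Q, / 2 <= Rabs (exp Q - 1) -> exp Q - 1 <> 0 /\ Rabs (/ (exp Q - 1)) <= 2).
  { intros Q HQ'. assert (exp Q - 1 <> 0). { intros E0. rewrite E0, Rabs_R0 in HQ'. lra. }
    split; [assumption|]. rewrite Rabs_inv. rewrite <- (Rinv_inv 2). apply Rinv_le_contravar; lra. }
  destruct (I1 Q1 HE1) as [N1 B1]. destruct (I1 Q2 HE2) as [N2 B2].
  assert (ID : Rabs (/ (exp Q1 - 1) - / (exp Q2 - 1)) <= 4 * E * B * d).
  { replace (/ (exp Q1 - 1) - / (exp Q2 - 1)) with (/ (exp Q1 - 1) * / (exp Q2 - 1) * - (exp Q1 - exp Q2)) by (field; split; lra).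
    rewrite !Rabs_mult, Rabs_Ropp.
    assert (G := exp_abs_diff Q1 Q2 B HQ1 HQ2). fold E in G.
    assert (0 <= Rabs (/ (exp Q1 - 1))) by apply Rabs_pos. assert (0 <= Rabs (/ (exp Q2 - 1))) by apply Rabs_pos.
    assert (Rabs (exp Q1 - exp Q2) <= E * (B * d)). { eapply Rle_trans; [exact G|]. apply Rmult_le_compat_l; lra. }
    assert (0 <= Rabs (exp Q1 - exp Q2)) by apply Rabs_pos.
    replace (4 * E * B * d) with (2 * 2 * (E * (B * d))) by ring.
    apply Rmult_le_compat; auto. apply Rmult_le_pos; auto. apply Rmult_le_compat; auto. }
  rewrite !Eq by auto.
  assert (K : forall (phi f : R -> R) y, Rabs (phi x - phi y) <= B -> Rabs (f y) <= F -> Rabs (exp (phi x - phi y)) <= E /\ Rabs (exp (phi x - phi y) * f y) <= E * F).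
  { intros phi f y G1 G2. assert (Rabs (exp (phi x - phi y)) <= E).
    { rewrite Rabs_pos_eq by (left; apply exp_pos). apply exp_le. apply Rabs_le_between in G1. lra. }
    split; [assumption|]. rewrite Rabs_mult. apply Rmult_le_compat; auto using Rabs_pos. }
  assert (Len : Rabs (x - (x - 2 * PI)) = 2 * PI) by (rewrite Rabs_pos_eq; lra).
  split.
  - rewrite <- RInt_minus_cont by auto.
    eapply Rle_trans. apply RInt_abs_le with (K := (2 * (E * (F * B) + F * (E * B)) + E * F * (4 * E * B)) * d).
    + intros y. apply (continuous_minus (fun y => / (exp Q1 - 1) * (exp (phi1 x - phi1 y) * f1 y))
         (fun y => / (exp Q2 - 1) * (exp (phi2 x - phi2 y) * f2 y))); auto.
    + intros y Hy. rewrite Rmin_left, Rmax_right in Hy by lra.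
      destruct (H y Hy) as [G1 [G2 [G3 [G4 [G5 G6]]]]].
      destruct (K phi1 f1 y G1 G4) as [K1 K2]. destruct (K phi2 f2 y G2 G5) as [K3 K4].
      assert (G := exp_abs_diff _ _ B G1 G2). fold E in G.
      assert (G' : Rabs (exp (phi1 x - phi1 y) - exp (phi2 x - phi2 y)) <= E * (B * d)).
      { eapply Rle_trans; [exact G|]. apply Rmult_le_compat_l; lra. }
      assert (P := mult_diff_bound _ _ _ _ _ _ _ _ K1 G5 G' G6).
      assert (P2 := mult_diff_bound _ _ _ _ _ _ _ _ B1 K4 ID P).
      eapply Rle_trans; [exact P2|]. right. ring.
    + rewrite Len. unfold L1. assert (0 <= L2 * d) by nra.
      match goal with |- ?a <= _ => replace a with (L1 * d) by (unfold L1; ring) end. unfold L1 in *; lra.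
  - eapply Rle_trans. apply RInt_abs_le with (K := 2 * (E * F)).
    + auto.
    + intros y Hy. rewrite Rmin_left, Rmax_right in Hy by lra.
      destruct (H y Hy) as [G1 [G2 [G3 [G4 [G5 G6]]]]].
      destruct (K phi1 f1 y G1 G4) as [K1 K2]. rewrite Rabs_mult.
      apply Rmult_le_compat; auto using Rabs_pos.
    + rewrite Len. unfold L2 in *. lra.
Qed.

(** * Existence of the Lagrangian flow *)

(** Serves twice: clamping the unknown to [[-1, 1]] makes its vector field bounded and Lipschitz,
    and clamping time to [[0, T]] makes every function of time total. *)
Definition clamp (a b x : R) : R := Rmax a (Rmin b x).

Lemma clamp_between a b x : a <= b -> a <= clamp a b x <= b.
Proof.
  intros H. unfold clamp. split; [apply Rmax_l|]. apply Rmax_lub; [exact H|apply Rmin_l].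
Qed.

Lemma clamp_id a b x : a <= x <= b -> clamp a b x = x.
Proof. intros H. unfold clamp. rewrite Rmin_right, Rmax_right; lra. Qed.

Lemma clamp_lipschitz a b x y : a <= b -> Rabs (clamp a b x - clamp a b y) <= Rabs (x - y).
Proof.
  intros H. unfold clamp, Rmax, Rmin.
  repeat destruct Rle_dec; unfold Rabs; repeat destruct Rcase_abs; lra.
Qed.

Lemma continuous_of_lipschitz (f : R -> R) L : 0 < L -> (forall x y, Rabs (f x - f y) <= L * Rabs (x - y)) ->
  forall x, continuous f x.
Proof.
  intros HL H x. apply continuity_pt_filterlim. apply continuity_pt_locally. intros eps.
  assert (Hp : 0 < eps / L) by (apply Rdiv_lt_0_compat; [apply cond_pos|lra]).
  exists (mkposreal _ Hp). intros y Hy. eapply Rle_lt_trans; [apply H|].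
  replace (pos eps) with (L * (eps / L)) by (field; lra). apply Rmult_lt_compat_l; auto.
Qed.

Lemma continuous_clamp a b x : a <= b -> continuous (clamp a b) x.
Proof.
  intros H. apply (continuous_of_lipschitz _ 1); [lra|]. intros y z. rewrite Rmult_1_l. now apply clamp_lipschitz.
Qed.

Section AbstractPicard.
Variable G : (R -> R) -> R -> R.
Variables T L : R.
Hypothesis T_pos : 0 < T.
Hypothesis L_pos : 0 < L.
Hypothesis G_lip : forall (f1 f2 : R -> R) d x, (forall y : R, continuous f1 y) -> (forall y : R, continuous f2 y) ->
  (forall y, Rabs (f1 y - f2 y) <= d) -> Rabs (G f1 x - G f2 x) <= L * d.
Hypothesis G_bound : forall (f : R -> R) x, (forall y : R, continuous f y) -> Rabs (G f x) <= L.
Hypothesis G_cont2 : forall r, cont2 r -> cont2 (fun t x => G (r t) x).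
Hypothesis G_periodic : forall f : R -> R, (forall y : R, continuous f y) -> periodic f -> periodic (G f).

Let tau := clamp 0 T.

(** The upper limit [tau t] freezes the iterates outside [[0, T]], so they are defined for all times
    and the weight in the contraction estimate stays bounded. *)
Fixpoint picard_iter (n : nat) : R -> R -> R :=
  match n with
  | O => fun _ _ => 0
  | S n => fun t x => RInt (fun s => G (picard_iter n s) x) 0 (tau t)
  end.

Lemma tau_cont t : continuous tau t.
Proof. apply continuous_clamp. lra. Qed.

Lemma picard_iter_cont2 n : cont2 (picard_iter n).
Proof.
  induction n as [|n IH]; simpl; [apply cont2_const|].
  apply (cont2_RInt_time (fun s x => G (picard_iter n s) x)); auto using tau_cont.
Qed.

Lemma picard_iter_periodic n t : periodic (picard_iter n t).
Proof.
  revert t. induction n as [|n IH]; intros t x; simpl; [reflexivity|].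
  apply RInt_ext_all. intros s. apply G_periodic; auto. intros y. apply cont2_slice, picard_iter_cont2.
Qed.

Lemma G_integrand_cont r x s : cont2 r -> continuous (fun s => G (r s) x) s.
Proof. intros H. apply (cont2_slice1 (fun t x => G (r t) x)). auto. Qed.

(** Contraction by 1/2 in the norm weighted by [exp (2 L t)]. *)
Lemma picard_iter_step n t x :
  Rabs (picard_iter (S n) t x - picard_iter n t x) <= L * T * (/ 2) ^ n * exp (2 * L * tau t).
Proof.
  revert t x. induction n as [|n IH]; intros t x.
  - simpl. rewrite Rminus_0_r. assert (Ht := clamp_between 0 T t ltac:(lra)). fold tau in Ht.
    eapply Rle_trans. apply RInt_abs_le with (K := L).
    + intros s. apply (G_integrand_cont (fun _ _ => 0)). apply cont2_const.
    + intros s _. apply G_bound. intros y. apply continuous_const.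
    + rewrite Rminus_0_r, Rabs_pos_eq by lra. rewrite Rmult_1_r.
      assert (1 <= exp (2 * L * tau t)). { rewrite <- exp_0. apply exp_le. nra. }
      assert (L * tau t <= L * T) by nra. assert (0 < L * T) by nra. nra.
  - assert (Ht := clamp_between 0 T t ltac:(lra)). fold tau in Ht.
    set (C := L * T * (/ 2) ^ n). assert (HC : 0 < C) by (unfold C; pos).
    change (picard_iter (S (S n)) t x) with (RInt (fun s => G (picard_iter (S n) s) x) 0 (tau t)).
    change (picard_iter (S n) t x) with (RInt (fun s => G (picard_iter n s) x) 0 (tau t)) at 1.
    assert (C1 := fun s => G_integrand_cont _ x s (picard_iter_cont2 (S n))).
    assert (C0 := fun s => G_integrand_cont _ x s (picard_iter_cont2 n)).
    rewrite <- RInt_minus_cont by auto.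
    assert (CC : forall s, continuous (fun s => G (picard_iter (S n) s) x - G (picard_iter n s) x) s).
    { intros s. now apply (continuous_minus (fun s => G (picard_iter (S n) s) x) (fun s => G (picard_iter n s) x)). }
    assert (CE : forall s, continuous (fun s => L * (C * exp (2 * L * s))) s).
    { intros s. apply (continuous_of_derive _ _ (L * (C * (2 * L * exp (2 * L * s))))). auto_derive; auto. ring. }
    eapply Rle_trans. apply abs_RInt_le; [lra|now apply ex_RInt_cont].
    eapply Rle_trans. apply RInt_le with (g := fun s => L * (C * exp (2 * L * s))); [lra| | |].
    + apply ex_RInt_cont. intros s. apply (continuous_comp _ Rabs); auto. apply continuous_Rabs.
    + now apply ex_RInt_cont.
    + intros s Hs. apply G_lip.
      * intros y. apply cont2_slice, picard_iter_cont2.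
      * intros y. apply cont2_slice, picard_iter_cont2.
      * intros y. replace s with (tau s) at 3 by (apply clamp_id; lra). apply IH.
    + rewrite (RInt_derive (fun s => C / 2 * exp (2 * L * s))); auto.
      * rewrite Rmult_0_r, exp_0. simpl. unfold C in *. lra.
      * intros s. auto_derive; auto. field.
Qed.

(** The geometric series is summed with its exact remainder [(/ 2) ^ n - (/ 2) ^ (n + k)], a form
    that an induction on [k] preserves. *)
Lemma picard_iter_cauchy n k t x :
  Rabs (picard_iter (n + k) t x - picard_iter n t x) <= 2 * (L * T * exp (2 * L * T)) * (/ 2) ^ n.
Proof.
  set (C := L * T * exp (2 * L * T)). assert (HC : 0 < C) by (unfold C; pos).
  assert (H : Rabs (picard_iter (n + k) t x - picard_iter n t x) <= 2 * C * ((/ 2) ^ n - (/ 2) ^ (n + k))).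
  { induction k as [|k IH].
    - rewrite Nat.add_0_r, !Rminus_diag, Rabs_R0. lra.
    - rewrite Nat.add_succ_r.
      replace (picard_iter (S (n + k)) t x - picard_iter n t x)
        with ((picard_iter (S (n + k)) t x - picard_iter (n + k) t x) + (picard_iter (n + k) t x - picard_iter n t x)) by ring.
      eapply Rle_trans; [apply Rabs_triang|].
      assert (S1 := picard_iter_step (n + k) t x).
      assert (E : exp (2 * L * tau t) <= exp (2 * L * T)).
      { apply exp_le. assert (Ht := clamp_between 0 T t ltac:(lra)). fold tau in Ht. nra. }
      assert (0 < (/ 2) ^ (n + k)) by pos.
      assert (L * T * (/ 2) ^ (n + k) * exp (2 * L * tau t) <= C * (/ 2) ^ (n + k)).
      { unfold C. replace (L * T * exp (2 * L * T) * (/ 2) ^ (n + k)) with (L * T * (/ 2) ^ (n + k) * exp (2 * L * T)) by ring.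
        apply Rmult_le_compat_l; [|exact E]. pos. }
      simpl ((/ 2) ^ S (n + k)). lra. }
  eapply Rle_trans; [exact H|]. assert (0 < (/ 2) ^ (n + k)) by pos. nra.
Qed.

Lemma half_pow_small C eps : 0 < eps -> exists N, forall n, (N <= n)%nat -> C * (/ 2) ^ n < eps.
Proof.
  intros He.
  destruct (pow_lt_1_zero (/ 2) ltac:(rewrite Rabs_pos_eq; lra) (eps / (Rabs C + 1))) as [N HN].
  { apply Rdiv_lt_0_compat; [lra|]. assert (0 <= Rabs C) by apply Rabs_pos. lra. }
  exists N. intros n Hn. specialize (HN n Hn). rewrite Rabs_pos_eq in HN by pos.
  assert (0 <= Rabs C) by apply Rabs_pos. assert (C <= Rabs C) by apply Rle_abs. assert (0 < (/ 2) ^ n) by pos.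
  apply Rmult_lt_compat_l with (r := Rabs C + 1) in HN; [|lra].
  replace ((Rabs C + 1) * (eps / (Rabs C + 1))) with eps in HN by (field; lra). nra.
Qed.

Lemma picard_limit : exists r, cont2 r /\
  forall n t x, Rabs (r t x - picard_iter n t x) <= 2 * (L * T * exp (2 * L * T)) * (/ 2) ^ n.
Proof.
  set (C := 2 * (L * T * exp (2 * L * T))).
  assert (Hlim : forall t x, ex_finite_lim_seq (fun n => picard_iter n t x)).
  { intros t x. apply ex_lim_seq_cauchy_corr. intros eps.
    destruct (half_pow_small (2 * C) eps (cond_pos eps)) as [N HN]. exists N. intros n m Hn Hm.
    assert (B : forall n, (N <= n)%nat -> Rabs (picard_iter n t x - picard_iter N t x) <= C * (/ 2) ^ N).
    { intros k Hk. replace k with (N + (k - N))%nat by lia. apply picard_iter_cauchy. }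
    specialize (HN N (le_n _)).
    replace (picard_iter n t x - picard_iter m t x) with
      ((picard_iter n t x - picard_iter N t x) - (picard_iter m t x - picard_iter N t x)) by ring.
    eapply Rle_lt_trans; [apply Rabs_triang|]. rewrite Rabs_Ropp.
    assert (B1 := B n Hn). assert (B2 := B m Hm). lra. }
  exists (fun t x => real (Lim_seq (fun n => picard_iter n t x))).
  assert (Hb : forall n t x, Rabs (real (Lim_seq (fun n => picard_iter n t x)) - picard_iter n t x) <= C * (/ 2) ^ n).
  { intros n t x. destruct (Hlim t x) as [l Hl]. rewrite (is_lim_seq_unique _ _ Hl). simpl.
    apply (is_lim_seq_le (fun k => Rabs (picard_iter (n + k) t x - picard_iter n t x)) (fun _ => C * (/ 2) ^ n)
      (Finite (Rabs (l - picard_iter n t x))) (Finite (C * (/ 2) ^ n))).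
    - intros k. apply picard_iter_cauchy.
    - apply (is_lim_seq_abs _ (Finite (l - picard_iter n t x))).
      apply (is_lim_seq_minus' (fun k => picard_iter (n + k) t x) (fun _ => picard_iter n t x)).
      + apply (is_lim_seq_ext (fun k => picard_iter (k + n) t x)). intros k. now rewrite Nat.add_comm.
        now apply (is_lim_seq_incr_n (fun k => picard_iter k t x)).
      + apply is_lim_seq_const.
    - apply is_lim_seq_const. }
  split; [|exact Hb].
  intros t x eps.
  assert (He : 0 < eps / 3) by (assert (0 < eps) by apply cond_pos; lra).
  destruct (half_pow_small C (eps / 3) He) as [N HN]. specialize (HN N (le_n _)).
  destruct (picard_iter_cont2 N t x (mkposreal _ He)) as [d Hd]. exists d. intros u v Hu Hv.
  specialize (Hd u v Hu Hv). simpl in Hd.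
  assert (B1 := Hb N u v). assert (B2 := Hb N t x).
  match goal with |- Rabs (?a - ?b) < _ => replace (a - b) with ((a - picard_iter N u v) + (picard_iter N u v - picard_iter N t x) + - (b - picard_iter N t x)) by ring end.
  eapply Rle_lt_trans; [apply Rabs_triang|].
  eapply Rle_lt_trans; [apply Rplus_le_compat_r, Rabs_triang|]. rewrite Rabs_Ropp. lra.
Qed.

Lemma Rabs_small_eq a : (forall eps, 0 < eps -> Rabs a <= eps) -> a = 0.
Proof.
  intros H. destruct (Req_dec a 0) as [E|E]; [exact E|exfalso].
  assert (0 < Rabs a) by now apply Rabs_pos_lt. specialize (H (Rabs a / 2) ltac:(lra)). lra.
Qed.

(** Periodicity and the integral equation hold for the iterates up to an error of order [(/ 2) ^ N],
    uniformly in [t] and [x], and so pass to the limit. *)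
Theorem picard_fixed_point : exists r, cont2 r /\ (forall t, periodic (r t)) /\
  forall t x, r t x = RInt (fun s => G (r s) x) 0 (clamp 0 T t).
Proof.
  destruct picard_limit as [r [Cr Hr]]. set (C := 2 * (L * T * exp (2 * L * T))) in Hr.
  assert (HC : 0 < C) by (unfold C; pos).
  exists r. split; [exact Cr|]. split.
  - intros t x. apply Rminus_diag_uniq. apply Rabs_small_eq. intros eps He.
    destruct (half_pow_small (2 * C) eps He) as [N HN]. specialize (HN N (le_n _)).
    assert (B1 := Hr N t x). assert (B2 := Hr N t (x + 2 * PI)). rewrite picard_iter_periodic in B2.
    replace (r t (x + 2 * PI) - r t x) with ((r t (x + 2 * PI) - picard_iter N t x) + - (r t x - picard_iter N t x)) by ring.
    eapply Rle_trans; [apply Rabs_triang|]. rewrite Rabs_Ropp. lra.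
  - intros t x. apply Rminus_diag_uniq. apply Rabs_small_eq. intros eps He. fold tau.
    destruct (half_pow_small (C + L * C * T) eps He) as [N HN]. specialize (HN N (le_n _)).
    assert (Ht := clamp_between 0 T t ltac:(lra)). fold tau in Ht.
    assert (B1 := Hr (S N) t x).
    assert (B2 : Rabs (picard_iter (S N) t x - RInt (fun s => G (r s) x) 0 (tau t)) <= L * C * T * (/ 2) ^ N).
    { simpl. assert (C0 := fun s => G_integrand_cont _ x s (picard_iter_cont2 N)).
      assert (C1 := fun s => G_integrand_cont _ x s Cr).
      rewrite <- RInt_minus_cont by auto.
      eapply Rle_trans. apply RInt_abs_le with (K := L * (C * (/ 2) ^ N)).
      - intros s. now apply (continuous_minus (fun s => G (picard_iter N s) x) (fun s => G (r s) x)).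
      - intros s _. apply G_lip.
        + intros y. apply cont2_slice, picard_iter_cont2.
        + intros y. now apply cont2_slice.
        + intros y. rewrite Rabs_minus_sym. apply Hr.
      - rewrite Rminus_0_r, Rabs_pos_eq by lra.
        replace (L * C * T * (/ 2) ^ N) with (L * (C * (/ 2) ^ N) * T) by ring.
        apply Rmult_le_compat_l; [|lra]. pos. }
    match goal with |- Rabs (?a - ?b) <= _ => replace (a - b) with ((a - picard_iter (S N) t x) + (picard_iter (S N) t x - b)) by ring end.
    eapply Rle_trans; [apply Rabs_triang|].
    assert (C * (/ 2) ^ S N <= C * (/ 2) ^ N). { assert (0 < (/ 2) ^ N) by pos. simpl. nra. }
    lra.
Qed.

End AbstractPicard.

(** [diag_a] and [diag_b] are [u + u_x] and [u - u_x] in Lagrangian coordinates, where [rho] is the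
    logarithm of the Jacobian [q] of the flow and [m0 exp(-rho)] is [m q] for the momentum [m = u - u_xx]. *)
Definition disp (rho : R -> R) (x : R) : R := RInt (fun y => exp (rho y)) 0 x.
Definition lmom (m0 rho : R -> R) (x : R) : R := m0 x * exp (- rho x).
Definition diag_a (m0 rho : R -> R) (x : R) : R :=
  J (disp rho (2 * PI)) (disp rho) (lmom m0 rho) x.
Definition diag_b (m0 rho : R -> R) (x : R) : R :=
  - J (- disp rho (2 * PI)) (fun y => - disp rho y) (lmom m0 rho) x.
(** One unknown suffices: the momentum satisfies [m q ^ 2 = m0] along the flow, so [rho = log q]
    determines [m q], then [u + u_x] and [u - u_x], hence the gradient, which is the time derivative
    of [rho]. No derivative of [rho] enters, so this is an ordinary differential equation in the sup
    norm. *)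
Definition slope (m0 rho : R -> R) (x : R) : R := (diag_a m0 rho x - diag_b m0 rho x) / 2.

Lemma continuous_exp_comp (f : R -> R) x : continuous f x -> continuous (fun y => exp (f y)) x.
Proof. intros H. apply (continuous_comp f exp); auto using continuous_exp. Qed.

Section Disp.
Variable rho : R -> R.
Hypothesis Crho : forall y : R, continuous rho y.

Lemma disp_deriv x : is_derive (disp rho) x (exp (rho x)).
Proof. apply (is_derive_RInt_cont (fun y => exp (rho y))). intros; now apply continuous_exp_comp. Qed.

Lemma disp_cont x : continuous (disp rho) x.
Proof. eapply continuous_of_derive, disp_deriv. Qed.

Lemma disp_diff x y : disp rho x - disp rho y = RInt (fun z => exp (rho z)) y x.
Proof.
  unfold disp. rewrite <- (RInt_Chasles_cont (fun z => exp (rho z)) 0 y x). ring.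
  intros; now apply continuous_exp_comp.
Qed.

Lemma disp_shift x : periodic rho -> disp rho (x + 2 * PI) = disp rho x + disp rho (2 * PI).
Proof.
  intros Hp. assert (E := disp_diff (x + 2 * PI) x).
  rewrite RInt_periodic_shift in E.
  - change (RInt (fun z => exp (rho z)) 0 (2 * PI)) with (disp rho (2 * PI)) in E. lra.
  - intros; now apply continuous_exp_comp.
  - intros z. now rewrite Hp.
Qed.

Lemma disp_shift_neg x : periodic rho -> disp rho (x - 2 * PI) = disp rho x - disp rho (2 * PI).
Proof. intros Hp. assert (E := disp_shift (x - 2 * PI) Hp). replace (x - 2 * PI + 2 * PI) with x in E by ring. lra. Qed.

Lemma disp_pos : 0 < disp rho (2 * PI).
Proof.
  assert (PIpos := PI_RGT_0). apply RInt_gt_0; [lra| |].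
  - intros; apply exp_pos.
  - intros; now apply continuous_exp_comp.
Qed.

Lemma lmom_cont m0 x : (forall y : R, continuous m0 y) -> continuous (lmom m0 rho) x.
Proof.
  intros Hm. apply (continuous_mult m0 (fun y => exp (- rho y))); auto. now apply continuous_exp_opp.
Qed.

Lemma lmom_periodic m0 : periodic m0 -> periodic rho -> periodic (lmom m0 rho).
Proof. intros H1 H2 x. unfold lmom. now rewrite H1, H2. Qed.

End Disp.

Lemma exp_neq_1 Q : Q <> 0 -> exp Q <> 1.
Proof. intros H E. rewrite <- exp_0 in E. apply exp_inv in E. contradiction. Qed.

Lemma cont2_disp r : cont2 r -> cont2 (fun t x => disp (r t) x).
Proof. intros H. apply (cont2_RInt (fun t y => exp (r t y))). apply cont2_comp1; auto using continuous_exp. Qed.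

Lemma cont2_lmom m0 r : (forall y : R, continuous m0 y) -> cont2 r -> cont2 (fun t x => lmom m0 (r t) x).
Proof.
  intros Hm H. apply (cont2_mult (fun _ x => m0 x)). now apply cont2_of_1d.
  apply (cont2_comp1 exp); auto using continuous_exp. now apply cont2_opp.
Qed.

Lemma cont2_diag_a m0 r : (forall y : R, continuous m0 y) -> cont2 r -> cont2 (fun t x => diag_a m0 (r t) x).
Proof.
  intros Hm H. apply (cont2_J (fun t => disp (r t) (2 * PI)) (fun t x => disp (r t) x) (fun t x => lmom m0 (r t) x)).
  - intros t. apply (cont2_slice1 (fun t x => disp (r t) x)). now apply cont2_disp.
  - intros t. apply exp_neq_1. apply Rgt_not_eq, disp_pos. intros y. now apply cont2_slice.
  - now apply cont2_disp.
  - now apply cont2_lmom.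
Qed.

Lemma cont2_diag_b m0 r : (forall y : R, continuous m0 y) -> cont2 r -> cont2 (fun t x => diag_b m0 (r t) x).
Proof.
  intros Hm H. unfold diag_b. apply cont2_opp.
  apply (cont2_J (fun t => - disp (r t) (2 * PI)) (fun t x => - disp (r t) x) (fun t x => lmom m0 (r t) x)).
  - intros t. apply (continuous_opp (fun t => disp (r t) (2 * PI))).
    apply (cont2_slice1 (fun t x => disp (r t) x)). now apply cont2_disp.
  - intros t. apply exp_neq_1. assert (P := disp_pos (r t) (fun y => cont2_slice r t y H)). lra.
  - apply cont2_opp. now apply cont2_disp.
  - now apply cont2_lmom.
Qed.

Lemma cont2_slope m0 r : (forall y : R, continuous m0 y) -> cont2 r -> cont2 (fun t x => slope m0 (r t) x).
Proof.
  intros Hm H. unfold slope, Rdiv. apply cont2_mult; [|apply cont2_const].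
  apply cont2_minus; auto using cont2_diag_a, cont2_diag_b.
Qed.

Section DiagX.
Variables m0 rho : R -> R.
Hypothesis Cm : forall y : R, continuous m0 y.
Hypothesis Pm : periodic m0.
Hypothesis Crho : forall y : R, continuous rho y.
Hypothesis Prho : periodic rho.

Lemma diag_a_periodic : periodic (diag_a m0 rho).
Proof.
  apply J_periodic; auto using disp_cont, lmom_cont, lmom_periodic.
  intros y. now apply disp_shift.
Qed.

Lemma diag_b_periodic : periodic (diag_b m0 rho).
Proof.
  intros x. unfold diag_b. f_equal. revert x. apply J_periodic; auto using lmom_cont, lmom_periodic.
  - intros y. apply (continuous_opp (disp rho)). now apply disp_cont.
  - intros y. rewrite disp_shift; auto. ring.
Qed.

Lemma slope_periodic : periodic (slope m0 rho).
Proof. intros x. unfold slope. now rewrite diag_a_periodic, diag_b_periodic. Qed.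

Lemma diag_a_deriv x : is_derive (diag_a m0 rho) x (exp (rho x) * diag_a m0 rho x - lmom m0 rho x).
Proof.
  apply (J_deriv _ (disp rho) (lmom m0 rho) (fun y => exp (rho y))); auto using lmom_cont, lmom_periodic, disp_deriv.
  - apply exp_neq_1, Rgt_not_eq. now apply disp_pos.
  - intros y. now apply disp_shift_neg.
Qed.

Lemma diag_b_deriv x : is_derive (diag_b m0 rho) x (- exp (rho x) * diag_b m0 rho x + lmom m0 rho x).
Proof.
  unfold diag_b.
  replace (- exp (rho x) * - J (- disp rho (2 * PI)) (fun y => - disp rho y) (lmom m0 rho) x + lmom m0 rho x)
    with (- (- exp (rho x) * J (- disp rho (2 * PI)) (fun y => - disp rho y) (lmom m0 rho) x - lmom m0 rho x)) by ring.
  apply @is_derive_opp.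
  apply (J_deriv _ (fun y => - disp rho y) (lmom m0 rho) (fun y => - exp (rho y))); auto using lmom_cont, lmom_periodic.
  - apply exp_neq_1. assert (P := disp_pos rho Crho). lra.
  - intros y. apply (is_derive_opp (disp rho)). now apply disp_deriv.
  - intros y. rewrite disp_shift_neg; auto. ring.
Qed.

End DiagX.

(** For [rho] in [[-1, 1]] the Jacobian stays between [/ e] and [e], so [J_lipschitz] applies to
    both resolvents with constants depending only on the bound [Mm]. *)
Lemma slope_lipschitz m0 Mm : (forall y : R, continuous m0 y) -> (forall y, Rabs (m0 y) <= Mm) ->
  exists L, 0 < L /\ forall (f1 f2 : R -> R) d x, (forall y : R, continuous f1 y) -> (forall y : R, continuous f2 y) ->
  (forall y, Rabs (f1 y) <= 1) -> (forall y, Rabs (f2 y) <= 1) -> (forall y, Rabs (f1 y - f2 y) <= d) ->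
  Rabs (slope m0 f1 x - slope m0 f2 x) <= L * d /\ Rabs (slope m0 f1 x) <= L.
Proof.
  intros Cm Bm. assert (PIpos := PI_RGT_0). assert (PI3 : 3 < 2 * PI) by (assert (H := PI2_3_2); lra).
  assert (HMm : 0 <= Mm) by (eapply Rle_trans; [apply Rabs_pos|apply (Bm 0)]).
  set (e := exp 1). assert (He : 0 < e) by apply exp_pos. assert (He3 : e <= 3) by apply exp_le_3.
  assert (He2 : 2 <= e) by (assert (H := exp_ineq1_le 1); unfold e; lra).
  (* [B] bounds the displacement over one period when [rho <= 1]. *)
  set (B := 2 * PI * e). assert (HB : 1 <= B) by (unfold B; nra).
  (* Taking [Mm + 1] keeps the bound on the source positive when [m0] vanishes. *)
  destruct (J_lipschitz B ((Mm + 1) * e)) as [L [HL H]]; [lra|nra|].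
  exists L. split; [lra|]. intros f1 f2 d x C1 C2 B1 B2 Hd.
  assert (Hd0 : 0 <= d) by (eapply Rle_trans; [apply Rabs_pos|apply (Hd 0)]).
  assert (EB : forall z, Rabs z <= 1 -> / e <= exp z <= e).
  { intros z Hz. apply Rabs_le_between in Hz. unfold e. rewrite <- exp_Ropp. split; apply exp_le; lra. }
  assert (DB : forall (f : R -> R), (forall y : R, continuous f y) -> (forall y, Rabs (f y) <= 1) -> forall y z, Rabs (z - y) <= 2 * PI -> Rabs (disp f z - disp f y) <= B).
  { intros f Cf Bf y z Hy. rewrite disp_diff by auto.
    eapply Rle_trans. apply RInt_abs_le with (K := e).
    - intros; now apply continuous_exp_comp.
    - intros w _. rewrite Rabs_pos_eq by (left; apply exp_pos). now apply EB.
    - unfold B. nra. }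
  assert (DD : forall y z, Rabs (z - y) <= 2 * PI -> Rabs ((disp f1 z - disp f1 y) - (disp f2 z - disp f2 y)) <= B * d).
  { intros y z Hy. rewrite !disp_diff by auto. rewrite <- RInt_minus_cont by (intros; now apply continuous_exp_comp).
    eapply Rle_trans. apply RInt_abs_le with (K := e * d).
    - intros w. apply (continuous_minus (fun w => exp (f1 w)) (fun w => exp (f2 w))); now apply continuous_exp_comp.
    - intros w _. eapply Rle_trans. apply (exp_abs_diff _ _ 1); auto. apply Rmult_le_compat_l; [lra|apply Hd].
    - unfold B. assert (0 <= e * d) by nra. nra. }
  (* The lower bound [2 * PI / e >= 1] keeps both [exp Q] and [exp (- Q)] at distance at least 1/2
     from 1. *)
  assert (QL : forall (f : R -> R), (forall y : R, continuous f y) -> (forall y, Rabs (f y) <= 1) -> 1 <= disp f (2 * PI) <= B).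
  { intros f Cf Bf. split.
    - apply Rle_trans with (2 * PI * / e).
      + apply Rmult_le_reg_r with e; [lra|]. rewrite Rmult_assoc, Rinv_l; lra.
      + replace (2 * PI * / e) with (RInt (fun _ => / e) 0 (2 * PI)).
        * apply RInt_le; [lra| | |]. apply ex_RInt_const. apply ex_RInt_cont. intros; now apply continuous_exp_comp.
          intros w _. now apply EB.
        * rewrite RInt_const_R. toR; ring.
    - assert (G := DB f Cf Bf 0 (2 * PI)). rewrite Rminus_0_r, (Rabs_pos_eq (2 * PI)) in G by lra.
      specialize (G ltac:(lra)). unfold disp at 2 in G. rewrite RInt_point in G. unfold zero in G; simpl in G.
      apply Rabs_le_between in G. lra. }
  destruct (QL f1 C1 B1) as [Q1a Q1b]. destruct (QL f2 C2 B2) as [Q2a Q2b].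
  assert (EQ : forall Q, 1 <= Q -> / 2 <= Rabs (exp Q - 1) /\ / 2 <= Rabs (exp (- Q) - 1)).
  { intros Q HQ. assert (2 <= exp Q). { apply Rle_trans with e; [lra|]. now apply exp_le. }
    split. rewrite Rabs_pos_eq; lra.
    assert (exp (- Q) <= / 2). { rewrite exp_Ropp. apply Rinv_le_contravar; lra. }
    rewrite Rabs_left; lra. }
  destruct (EQ _ Q1a) as [E1 E1']. destruct (EQ _ Q2a) as [E2 E2'].
  assert (D0 : forall (f : R -> R), disp f 0 = 0). { intros f. unfold disp. rewrite RInt_point. reflexivity. }
  assert (DQ : Rabs (disp f1 (2 * PI) - disp f2 (2 * PI)) <= B * d).
  { assert (G := DD 0 (2 * PI)). rewrite !D0, !Rminus_0_r, (Rabs_pos_eq (2 * PI)) in G by lra. apply G. lra. }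
  assert (MB : forall (f : R -> R) y, Rabs (f y) <= 1 -> Rabs (lmom m0 f y) <= (Mm + 1) * e).
  { intros f y Hf. unfold lmom. rewrite Rabs_mult. apply Rmult_le_compat; try apply Rabs_pos.
    specialize (Bm y); lra. rewrite Rabs_pos_eq by (left; apply exp_pos). apply EB. now rewrite Rabs_Ropp. }
  assert (MD : forall y, Rabs (lmom m0 f1 y - lmom m0 f2 y) <= (Mm + 1) * e * B * d).
  { intros y. unfold lmom. rewrite <- Rmult_minus_distr_l, Rabs_mult.
    assert (G := exp_abs_diff (- f1 y) (- f2 y) 1). rewrite !Rabs_Ropp in G. specialize (G (B1 y) (B2 y)).
    replace (- f1 y - - f2 y) with (- (f1 y - f2 y)) in G by ring. rewrite Rabs_Ropp in G. fold e in G.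
    assert (G2 : Rabs (exp (- f1 y) - exp (- f2 y)) <= e * d).
    { eapply Rle_trans; [exact G|]. apply Rmult_le_compat_l; [lra|apply Hd]. }
    apply Rle_trans with ((Mm + 1) * (e * d)).
    - apply Rmult_le_compat; try apply Rabs_pos; auto. specialize (Bm y); lra.
    - assert (0 <= (Mm + 1) * (e * d)) by (pos). replace ((Mm + 1) * e * B * d) with ((Mm + 1) * (e * d) * B) by ring. nra. }
  assert (Len : forall y, x - 2 * PI <= y <= x -> Rabs (x - y) <= 2 * PI).
  { intros y Hy. rewrite Rabs_pos_eq; lra. }
  destruct (H (disp f1 (2 * PI)) (disp f2 (2 * PI)) (disp f1) (disp f2) (lmom m0 f1) (lmom m0 f2) d x) as [Ha Ha'];
    auto using disp_cont, lmom_cont; try (rewrite Rabs_pos_eq; lra).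
  { intros y Hy. specialize (Len y Hy). repeat split; auto. }
  destruct (H (- disp f1 (2 * PI)) (- disp f2 (2 * PI)) (fun y => - disp f1 y) (fun y => - disp f2 y) (lmom m0 f1) (lmom m0 f2) d x) as [Hb Hb'];
    auto using lmom_cont; try (rewrite Rabs_Ropp, Rabs_pos_eq; lra).
  { intros y; apply (continuous_opp (disp f1)); now apply disp_cont. }
  { intros y; apply (continuous_opp (disp f2)); now apply disp_cont. }
  { match goal with |- Rabs ?z <= _ => replace z with (- (disp f1 (2 * PI) - disp f2 (2 * PI))) by ring end. now rewrite Rabs_Ropp. }
  { intros y Hy. specialize (Len y Hy).
    replace (- disp f1 x - - disp f1 y) with (- (disp f1 x - disp f1 y)) by ring.
    replace (- disp f2 x - - disp f2 y) with (- (disp f2 x - disp f2 y)) by ring.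
    replace (- (disp f1 x - disp f1 y) - - (disp f2 x - disp f2 y)) with (- (disp f1 x - disp f1 y - (disp f2 x - disp f2 y))) by ring.
    rewrite !Rabs_Ropp. repeat split; auto. }
  unfold slope, diag_a, diag_b. split.
  - match goal with |- Rabs ?z <= _ => match z with (?a - - ?b) / 2 - (?c - - ?e) / 2 => replace z with ((a - c) / 2 + (b - e) / 2) by lra end end.
    eapply Rle_trans; [apply Rabs_triang|]. unfold Rdiv. rewrite !Rabs_mult, (Rabs_pos_eq (/ 2)) by lra. lra.
  - match goal with |- Rabs ?z <= _ => match z with (?a - - ?b) / 2 => replace z with (a / 2 + b / 2) by lra end end.
    eapply Rle_trans; [apply Rabs_triang|]. unfold Rdiv. rewrite !Rabs_mult, (Rabs_pos_eq (/ 2)) by lra. lra.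
Qed.

(** The clamp on the values makes Picard iteration applicable on all of [[0, T]]; it is removed once
    the solution is known to stay in [[-1, 1]]. The last clause is the speed bound used for that
    purpose. *)
Lemma truncated_flow m0 Mm T : 0 < T -> (forall y : R, continuous m0 y) -> periodic m0 -> (forall y, Rabs (m0 y) <= Mm) ->
  exists L, 0 < L /\ exists r, cont2 r /\ (forall t, periodic (r t)) /\
  (forall t x, r t x = RInt (fun s => slope m0 (fun y => clamp (-1) 1 (r s y)) x) 0 (clamp 0 T t)) /\
  (forall t x, Rabs (slope m0 (fun y => clamp (-1) 1 (r t y)) x) <= L).
Proof.
  intros HT Cm Pm Bm. destruct (slope_lipschitz m0 Mm Cm Bm) as [L [HL H]]. exists L. split; [exact HL|].
  assert (Cc : forall (f : R -> R), (forall y : R, continuous f y) -> forall y : R, continuous (fun y => clamp (-1) 1 (f y)) y).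
  { intros f Hf y. apply (continuous_comp f (clamp (-1) 1)); auto. apply continuous_clamp. lra. }
  assert (Bc : forall z, Rabs (clamp (-1) 1 z) <= 1).
  { intros z. apply Rabs_le. apply (clamp_between (-1) 1). lra. }
  assert (GB : forall (f : R -> R) x, (forall y : R, continuous f y) -> Rabs (slope m0 (fun y => clamp (-1) 1 (f y)) x) <= L).
  { intros f x Cf. apply (H (fun y => clamp (-1) 1 (f y)) (fun y => clamp (-1) 1 (f y)) 0 x); auto.
    intros y. rewrite Rminus_diag, Rabs_R0. lra. }
  destruct (picard_fixed_point (fun f x => slope m0 (fun y => clamp (-1) 1 (f y)) x) T L) as [r [Cr [Pr Er]]]; auto.
  - intros f1 f2 d x C1 C2 Hd. apply H; auto.
    intros y. eapply Rle_trans; [apply clamp_lipschitz; lra|]. apply Hd.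
  - intros r Cr. apply (cont2_slope m0 (fun t y => clamp (-1) 1 (r t y))); auto.
    apply cont2_comp1; auto. intros z. apply continuous_clamp. lra.
  - intros f Cf Pf. apply slope_periodic; auto. intros y. now rewrite Pf.
  - exists r. repeat split; auto. intros t x. apply GB. intros y. now apply cont2_slice.
Qed.

(** * Evolution along the flow *)

Section Flow.
Variable T : R.
Variable m0 : R -> R.
Variable r : R -> R -> R.

Definition la (t x : R) : R := diag_a m0 (r t) x.
Definition lb (t x : R) : R := diag_b m0 (r t) x.
Definition lV (t x : R) : R := slope m0 (r t) x.
Definition lU (t x : R) : R := (la t x + lb t x) / 2.
Definition lq (t x : R) : R := exp (r t x).
Definition lM (t x : R) : R := lmom m0 (r t) x.
Definition psi (t x : R) : R := x + RInt (fun s => lU s x) 0 (clamp 0 T t).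
(** [lA] and [lB] are [(1 - d_x)^{-1} (u + u_x)^2] and [(1 + d_x)^{-1} (u - u_x)^2] in Lagrangian coordinates. *)
Definition lA (t x : R) : R := J (2 * PI) (psi t) (fun y => lq t y * la t y ^ 2) x.
Definition lB (t x : R) : R := - J (- (2 * PI)) (fun y => - psi t y) (fun y => lq t y * lb t y ^ 2) x.

Definition lagrangian_flow : Prop :=
  0 < T /\ (forall y : R, continuous m0 y) /\ periodic m0 /\ cont2 r /\ (forall t, periodic (r t)) /\
  forall t x, r t x = RInt (fun s => lV s x) 0 (clamp 0 T t).

Hypothesis HF : lagrangian_flow.

Lemma flow_T_pos : 0 < T. Proof. apply HF. Qed.
Lemma m0_cont y : continuous m0 y. Proof. apply HF. Qed.
Lemma m0_periodic : periodic m0. Proof. apply HF. Qed.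
Lemma r_cont2 : cont2 r. Proof. apply HF. Qed.
Lemma r_periodic t : periodic (r t). Proof. apply HF. Qed.
Lemma r_eq t x : r t x = RInt (fun s => lV s x) 0 (clamp 0 T t). Proof. apply HF. Qed.
Lemma r_cont t x : continuous (r t) x. Proof. apply cont2_slice, r_cont2. Qed.

Lemma la_cont2 : cont2 la. Proof. apply cont2_diag_a; auto using m0_cont, r_cont2. Qed.
Lemma lb_cont2 : cont2 lb. Proof. apply cont2_diag_b; auto using m0_cont, r_cont2. Qed.
Lemma lV_cont2 : cont2 lV. Proof. apply cont2_slope; auto using m0_cont, r_cont2. Qed.
Lemma lU_cont2 : cont2 lU.
Proof. unfold lU, Rdiv. apply cont2_mult; auto using cont2_const, cont2_plus, la_cont2, lb_cont2. Qed.
Lemma lq_cont2 : cont2 lq. Proof. apply cont2_comp1; auto using continuous_exp, r_cont2. Qed.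
Lemma lM_cont2 : cont2 lM. Proof. apply cont2_lmom; auto using m0_cont, r_cont2. Qed.
Lemma clampT_cont t : continuous (clamp 0 T) t.
Proof. apply continuous_clamp. left. apply flow_T_pos. Qed.
Lemma psi_cont2 : cont2 psi.
Proof. apply cont2_plus; [apply cont2_snd|]. apply cont2_RInt_time; auto using lU_cont2, clampT_cont. Qed.

Lemma lq_pos t x : 0 < lq t x. Proof. apply exp_pos. Qed.

Lemma la_periodic t : periodic (la t).
Proof. apply diag_a_periodic; auto using m0_cont, m0_periodic, r_cont, r_periodic. Qed.
Lemma lb_periodic t : periodic (lb t).
Proof. apply diag_b_periodic; auto using m0_cont, m0_periodic, r_cont, r_periodic. Qed.
Lemma lU_periodic t : periodic (lU t).
Proof. intros x. unfold lU. now rewrite la_periodic, lb_periodic. Qed.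
Lemma lV_periodic t : periodic (lV t).
Proof. apply slope_periodic; auto using m0_cont, m0_periodic, r_cont, r_periodic. Qed.
Lemma lq_periodic t : periodic (lq t).
Proof. intros x. unfold lq. now rewrite r_periodic. Qed.
Lemma lV_eq t x : lV t x = (la t x - lb t x) / 2. Proof. reflexivity. Qed.

Lemma la_dx t x : is_derive (la t) x (lq t x * la t x - lM t x).
Proof. apply diag_a_deriv; auto using m0_cont, m0_periodic, r_cont, r_periodic. Qed.
Lemma lb_dx t x : is_derive (lb t) x (- lq t x * lb t x + lM t x).
Proof. apply diag_b_deriv; auto using m0_cont, m0_periodic, r_cont, r_periodic. Qed.

Lemma lU_dx t x : is_derive (lU t) x (lq t x * lV t x).
Proof.
  unfold lU. apply (is_derive_ext (fun x => / 2 * (la t x + lb t x))); [intros; simpl; field|].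
  replace (lq t x * lV t x) with (/ 2 * ((lq t x * la t x - lM t x) + (- lq t x * lb t x + lM t x))) by (rewrite lV_eq; field).
  apply is_derive_scal. apply (is_derive_plus (la t) (lb t)); [apply la_dx|apply lb_dx].
Qed.

Lemma clampT_between t : 0 <= clamp 0 T t <= T.
Proof. apply clamp_between. left; apply flow_T_pos. Qed.

Lemma lq_eq t x : lq t x = 1 + RInt (fun s => lq s x * lV s x) 0 (clamp 0 T t).
Proof.
  set (Rr := fun s => RInt (fun s => lV s x) 0 s).
  assert (CV : forall s : R, continuous (fun s => lV s x) s) by (intros s; apply (cont2_slice1 lV), lV_cont2).
  assert (DR : forall s : R, is_derive Rr s (lV s x)).
  { intros s. now apply (is_derive_RInt_cont (fun s => lV s x)). }
  assert (E : RInt (fun s => lq s x * lV s x) 0 (clamp 0 T t) = RInt (fun s => lV s x * exp (Rr s)) 0 (clamp 0 T t)).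
  { apply RInt_ext. intros s Hs. assert (Hc := clampT_between t). rewrite Rmin_left, Rmax_right in Hs by lra.
    unfold lq, Rr. rewrite r_eq, clamp_id by lra. apply Rmult_comm. }
  rewrite E. rewrite (RInt_derive (fun s => exp (Rr s))).
  - unfold lq. rewrite r_eq. unfold Rr at 2. rewrite RInt_point. unfold zero; simpl. rewrite exp_0. unfold Rr. ring.
  - intros s. apply (is_derive_comp exp Rr); auto. apply is_derive_exp.
  - intros s. apply (continuous_mult (fun s => lV s x) (fun s => exp (Rr s))); auto.
    apply continuous_exp_comp. eapply continuous_of_derive, DR.
Qed.

(** [psi] integrates the velocity while [lq] exponentiates [r]. They match because [lU] has
    [x]-derivative [lq * lV], and by [lq_eq] the Jacobian [lq] is 1 plus the time integral of that
    same product. *)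
Lemma psi_dx t x : is_derive (psi t) x (lq t x).
Proof.
  rewrite lq_eq. apply (is_derive_plus (fun x => x) (fun x => RInt (fun s => lU s x) 0 (clamp 0 T t))).
  - apply @is_derive_id.
  - apply (is_derive_RInt_param_all (fun x s => lU s x) (fun x s => lq s x * lV s x)).
    + intros y s. apply lU_dx.
    + apply (cont2_swap (fun s x => lq s x * lV s x)). apply cont2_mult; auto using lq_cont2, lV_cont2.
    + intros y s. apply (cont2_slice1 lU), lU_cont2.
Qed.

Lemma psi_shift t x : psi t (x + 2 * PI) = psi t x + 2 * PI.
Proof.
  unfold psi. rewrite (RInt_ext_all _ (fun s => lU s x)) by (intros; apply lU_periodic). ring.
Qed.

Lemma psi_shift_neg t x : psi t (x - 2 * PI) = psi t x - 2 * PI.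
Proof. assert (E := psi_shift t (x - 2 * PI)). replace (x - 2 * PI + 2 * PI) with x in E by ring. lra. Qed.

Lemma disp_psi t x : disp (r t) x = psi t x - psi t 0.
Proof.
  unfold disp. apply (RInt_derive (psi t)); [apply psi_dx|]. intros y. apply (cont2_slice lq), lq_cont2.
Qed.

(** A true flow commutes with the translation by a period, so its jump is exactly [2 * PI]. Picard
    iterates need not have this property, which is why [diag_a] and [diag_b] carry the jump
    [disp rho (2 * PI)]. *)
Lemma disp_2PI t : disp (r t) (2 * PI) = 2 * PI.
Proof. rewrite disp_psi. assert (E := psi_shift t 0). rewrite Rplus_0_l in E. lra. Qed.

Lemma psi_cont t x : continuous (psi t) x. Proof. apply cont2_slice, psi_cont2. Qed.
Lemma npsi_cont t x : continuous (fun y => - psi t y) x.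
Proof. apply (continuous_opp (psi t)), psi_cont. Qed.
Lemma lM_cont t x : continuous (lM t) x. Proof. apply cont2_slice, lM_cont2. Qed.

Lemma la_J t x : la t x = J (2 * PI) (psi t) (lM t) x.
Proof.
  unfold la, diag_a. rewrite disp_2PI. symmetry. apply J_phase_shift with (c := psi t 0).
  - intros y. rewrite disp_psi. ring.
  - intros y. apply disp_cont. apply r_cont.
  - apply lM_cont.
Qed.

Lemma lb_J t x : lb t x = - J (- (2 * PI)) (fun y => - psi t y) (lM t) x.
Proof.
  unfold lb, diag_b. rewrite disp_2PI. f_equal. symmetry. apply J_phase_shift with (c := - psi t 0).
  - intros y. rewrite disp_psi. ring.
  - intros y. apply (continuous_opp (disp (r t))). apply disp_cont. apply r_cont.
  - apply lM_cont.
Qed.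

Lemma exp_2PI_neq : exp (2 * PI) <> 1.
Proof. apply exp_neq_1. assert (H := PI_RGT_0). lra. Qed.
Lemma exp_n2PI_neq : exp (- (2 * PI)) <> 1.
Proof. apply exp_neq_1. assert (H := PI_RGT_0). lra. Qed.

Lemma npsi_dx t x : is_derive (fun y => - psi t y) x (- lq t x).
Proof. apply (is_derive_opp (psi t)), psi_dx. Qed.
Lemma npsi_shift_neg t x : - psi t (x - 2 * PI) = - psi t x - - (2 * PI).
Proof. rewrite psi_shift_neg. ring. Qed.

Lemma qa2_cont2 : cont2 (fun t y => lq t y * la t y ^ 2).
Proof.
  apply cont2_ext with (fun t y => lq t y * (la t y * la t y)); [intros; ring|].
  apply cont2_mult; [apply lq_cont2|]. apply cont2_mult; apply la_cont2.
Qed.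
Lemma qb2_cont2 : cont2 (fun t y => lq t y * lb t y ^ 2).
Proof.
  apply cont2_ext with (fun t y => lq t y * (lb t y * lb t y)); [intros; ring|].
  apply cont2_mult; [apply lq_cont2|]. apply cont2_mult; apply lb_cont2.
Qed.

Lemma qa2_periodic t : periodic (fun y => lq t y * la t y ^ 2).
Proof. intros x. now rewrite lq_periodic, la_periodic. Qed.
Lemma qb2_periodic t : periodic (fun y => lq t y * lb t y ^ 2).
Proof. intros x. now rewrite lq_periodic, lb_periodic. Qed.

Lemma lA_cont2 : cont2 lA.
Proof.
  apply (cont2_J (fun _ => 2 * PI) psi (fun t y => lq t y * la t y ^ 2)); auto using psi_cont2, qa2_cont2, exp_2PI_neq.
  intros; apply continuous_const.
Qed.
Lemma lB_cont2 : cont2 lB.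
Proof.
  apply cont2_opp. apply (cont2_J (fun _ => - (2 * PI)) (fun t y => - psi t y) (fun t y => lq t y * lb t y ^ 2));
    auto using cont2_opp, psi_cont2, qb2_cont2, exp_n2PI_neq.
  intros; apply continuous_const.
Qed.

Lemma lA_dx t x : is_derive (lA t) x (lq t x * lA t x - lq t x * la t x ^ 2).
Proof.
  apply (J_deriv _ (psi t) (fun y => lq t y * la t y ^ 2) (lq t)); auto using exp_2PI_neq, psi_dx, psi_shift_neg, qa2_periodic.
  intros y. apply (cont2_slice (fun t y => lq t y * la t y ^ 2)), qa2_cont2.
Qed.
Lemma lB_dx t x : is_derive (lB t) x (- lq t x * lB t x + lq t x * lb t x ^ 2).
Proof.
  unfold lB.
  replace (- lq t x * - J (- (2 * PI)) (fun y => - psi t y) (fun y => lq t y * lb t y ^ 2) x + lq t x * lb t x ^ 2)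
    with (- (- lq t x * J (- (2 * PI)) (fun y => - psi t y) (fun y => lq t y * lb t y ^ 2) x - lq t x * lb t x ^ 2)) by ring.
  apply @is_derive_opp.
  apply (J_deriv _ (fun y => - psi t y) (fun y => lq t y * lb t y ^ 2) (fun y => - lq t y));
    auto using exp_n2PI_neq, npsi_dx, npsi_shift_neg, qb2_periodic.
  intros y. apply (cont2_slice (fun t y => lq t y * lb t y ^ 2)), qb2_cont2.
Qed.

Lemma lA_periodic t : periodic (lA t).
Proof.
  apply J_periodic; auto using psi_cont, psi_shift, qa2_periodic.
  intros y. apply (cont2_slice (fun t y => lq t y * la t y ^ 2)), qa2_cont2.
Qed.
Lemma lB_periodic t : periodic (lB t).
Proof.
  intros x. unfold lB. f_equal. revert x. apply J_periodic; auto using npsi_cont, qb2_periodic.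
  - intros y. apply (cont2_slice (fun t y => lq t y * lb t y ^ 2)), qb2_cont2.
  - intros y. rewrite psi_shift. ring.
Qed.

Lemma exp_2PI_gt : 1 < exp (2 * PI).
Proof. rewrite <- exp_0. apply exp_increasing. assert (H := PI_RGT_0). lra. Qed.
Lemma exp_n2PI_lt : exp (- (2 * PI)) < 1.
Proof. rewrite <- exp_0. apply exp_increasing. assert (H := PI_RGT_0). lra. Qed.

Lemma lA_bound t K : (forall y, Rabs (la t y) <= K) -> forall x, Rabs (lA t x) <= K ^ 2.
Proof.
  intros HK x. apply (J_bound _ (psi t) _ (lq t) 1); auto using psi_dx, psi_shift_neg, lq_periodic; try lra.
  - assert (H := exp_2PI_gt). lra.
  - intros y. apply cont2_slice, lq_cont2.
  - intros y. apply (cont2_slice (fun t y => lq t y * la t y ^ 2)), qa2_cont2.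
  - intros y. rewrite Rabs_mult, (Rabs_pos_eq (lq t y)) by (left; apply lq_pos).
    rewrite <- RPow_abs. assert (G := pow_incr _ _ 2 (conj (Rabs_pos _) (HK y))). assert (P := lq_pos t y). nra.
Qed.
Lemma lB_bound t K : (forall y, Rabs (lb t y) <= K) -> forall x, Rabs (lB t x) <= K ^ 2.
Proof.
  intros HK x. unfold lB. rewrite Rabs_Ropp.
  apply (J_bound _ (fun y => - psi t y) _ (fun y => - lq t y) (-1)); auto using npsi_dx, npsi_shift_neg; try lra.
  - assert (H := exp_n2PI_lt). lra.
  - intros y. apply (continuous_opp (lq t)). apply cont2_slice, lq_cont2.
  - intros y. now rewrite lq_periodic.
  - intros y. apply (cont2_slice (fun t y => lq t y * lb t y ^ 2)), qb2_cont2.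
  - intros y. rewrite Rabs_mult, (Rabs_pos_eq (lq t y)) by (left; apply lq_pos).
    rewrite <- RPow_abs. assert (G := pow_incr _ _ 2 (conj (Rabs_pos _) (HK y))). assert (P := lq_pos t y). nra.
Qed.

(** In Eulerian terms, with [a = u + u_x] one has [m = a - a_x], so [a m = a ^ 2 - (a ^ 2)_x / 2],
    and applying [(1 - d_x)^{-1}] gives half of [a ^ 2] plus half of [(1 - d_x)^{-1} a ^ 2]. The
    momentum disappears from the evolution equations, which then close in the sup norm with
    constants independent of [m0]. *)
Lemma J_aM t x : J (2 * PI) (psi t) (fun y => la t y * lM t y) x = / 2 * la t x ^ 2 + / 2 * lA t x.
Proof.
  symmetry. apply (J_unique (2 * PI) (psi t) (fun y => la t y * lM t y) (lq t) (fun x => / 2 * la t x ^ 2 + / 2 * lA t x));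
    auto using exp_2PI_neq, psi_dx, psi_shift_neg.
  - intros y. apply (continuous_mult (la t) (lM t)); apply cont2_slice; auto using la_cont2, lM_cont2.
  - intros y. now rewrite la_periodic, lA_periodic.
  - intros y.
    apply (is_derive_ext (fun x => / 2 * (la t x * la t x) + / 2 * lA t x)); [intros; simpl; ring|].
    replace (lq t y * (/ 2 * la t y ^ 2 + / 2 * lA t y) - la t y * lM t y) with
      (/ 2 * ((lq t y * la t y - lM t y) * la t y + la t y * (lq t y * la t y - lM t y)) + / 2 * (lq t y * lA t y - lq t y * la t y ^ 2)) by field.
    apply @is_derive_plus; apply is_derive_scal; [|apply lA_dx].
    apply (is_derive_mult (la t) (la t)); try apply la_dx. apply Rmult_comm.
Qed.

Lemma J_bM t x : J (- (2 * PI)) (fun y => - psi t y) (fun y => lb t y * lM t y) x = - (/ 2 * lb t x ^ 2) - / 2 * lB t x.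
Proof.
  symmetry. apply (J_unique (- (2 * PI)) (fun y => - psi t y) (fun y => lb t y * lM t y) (fun y => - lq t y) (fun x => - (/ 2 * lb t x ^ 2) - / 2 * lB t x));
    auto using exp_n2PI_neq, npsi_dx, npsi_shift_neg.
  - intros y. apply (continuous_mult (lb t) (lM t)); apply cont2_slice; auto using lb_cont2, lM_cont2.
  - intros y. now rewrite lb_periodic, lB_periodic.
  - intros y.
    apply (is_derive_ext (fun x => (- / 2) * (lb t x * lb t x) + (- / 2) * lB t x)); [intros; simpl; ring|].
    replace (- lq t y * (- (/ 2 * lb t y ^ 2) - / 2 * lB t y) - lb t y * lM t y) with
      ((- / 2) * ((- lq t y * lb t y + lM t y) * lb t y + lb t y * (- lq t y * lb t y + lM t y)) + (- / 2) * (- lq t y * lB t y + lq t y * lb t y ^ 2)) by field.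
    apply @is_derive_plus; apply is_derive_scal; [|apply lB_dx].
    apply (is_derive_mult (lb t) (lb t)); try apply lb_dx. apply Rmult_comm.
Qed.

Lemma locally_interior t : 0 < t < T -> locally t (fun s => 0 < s < T).
Proof.
  intros Ht. assert (Hp : 0 < Rmin t (T - t)) by (apply Rmin_glb_lt; lra).
  exists (mkposreal _ Hp). intros s Hs. apply Rabs_lt_between' in Hs. simpl in Hs.
  assert (Rmin t (T - t) <= t) by apply Rmin_l. assert (Rmin t (T - t) <= T - t) by apply Rmin_r. lra.
Qed.

Lemma RInt_clamp_dt (f : R -> R) t : (forall s : R, continuous f s) -> 0 < t < T ->
  is_derive (fun t => RInt f 0 (clamp 0 T t)) t (f t).
Proof.
  intros Hf Ht. apply is_derive_ext_loc with (fun t => RInt f 0 t).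
  - apply filter_imp with (2 := locally_interior t Ht). intros s Hs. rewrite clamp_id; [reflexivity|lra].
  - now apply is_derive_RInt_cont.
Qed.

Lemma psi_dt t x : 0 < t < T -> is_derive (fun t => psi t x) t (lU t x).
Proof.
  intros Ht. unfold psi. rewrite <- (Rplus_0_l (lU t x)). apply @is_derive_plus.
  - apply @is_derive_const.
  - apply (RInt_clamp_dt (fun s => lU s x)); auto. intros s. apply (cont2_slice1 lU), lU_cont2.
Qed.

Lemma r_dt t x : 0 < t < T -> is_derive (fun t => r t x) t (lV t x).
Proof.
  intros Ht. apply is_derive_ext with (fun t => RInt (fun s => lV s x) 0 (clamp 0 T t)).
  - intros s. symmetry. apply r_eq.
  - apply (RInt_clamp_dt (fun s => lV s x)); auto. intros s. apply (cont2_slice1 lV), lV_cont2.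
Qed.

Lemma lM_dt t x : 0 < t < T -> is_derive (fun t => lM t x) t (- lV t x * lM t x).
Proof.
  intros Ht. unfold lM, lmom. replace (- lV t x * (m0 x * exp (- r t x))) with (m0 x * (- lV t x * exp (- r t x))) by ring.
  apply is_derive_scal. apply (is_derive_comp exp (fun t => - r t x)); [apply is_derive_exp|].
  apply (is_derive_opp (fun t => r t x)). now apply r_dt.
Qed.

Lemma J_dt Q (phi f phit ft : R -> R -> R) t x : 0 < t < T -> cont2 phi -> cont2 f -> cont2 phit -> cont2 ft ->
  (forall s y, 0 < s < T -> is_derive (fun s => phi s y) s (phit s y)) ->
  (forall s y, 0 < s < T -> is_derive (fun s => f s y) s (ft s y)) ->
  is_derive (fun s => J Q (phi s) (f s) x) t
   (phit t x * J Q (phi t) (f t) x + J Q (phi t) (fun y => ft t y - phit t y * f t y) x).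
Proof.
  intros Ht Cphi Cf Cpt Cft Dphi Df. unfold J.
  assert (Cexp : cont2 (fun t y => exp (- phi t y))).
  { apply cont2_comp1; auto using continuous_exp, cont2_opp. }
  assert (D : is_derive (fun s => RInt (fun y => exp (- phi s y) * f s y) (x - 2 * PI) x) t
     (RInt (fun y => exp (- phi t y) * (ft t y - phit t y * f t y)) (x - 2 * PI) x)).
  { apply (is_derive_RInt_param_loc (fun s y => exp (- phi s y) * f s y) (fun t y => exp (- phi t y) * (ft t y - phit t y * f t y))).
    - apply filter_imp with (2 := locally_interior t Ht). intros s Hs y.
      replace (exp (- phi s y) * (ft s y - phit s y * f s y)) with ((- phit s y * exp (- phi s y)) * f s y + exp (- phi s y) * ft s y) by ring.
      apply (is_derive_mult (fun s => exp (- phi s y)) (fun s => f s y)); auto.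
      + apply (is_derive_comp exp (fun s => - phi s y)); [apply is_derive_exp|].
        apply (is_derive_opp (fun s => phi s y)). auto.
      + apply Rmult_comm.
    - apply cont2_mult; auto. apply cont2_minus; auto using cont2_mult.
    - intros s y. apply (cont2_slice (fun s y => exp (- phi s y) * f s y)). now apply cont2_mult. }
  assert (E : is_derive (fun s => exp (phi s x) / (exp Q - 1)) t (phit t x * exp (phi t x) / (exp Q - 1))).
  { apply (is_derive_ext (fun s => / (exp Q - 1) * exp (phi s x))); [intros; simpl; unfold Rdiv; ring|].
    replace (phit t x * exp (phi t x) / (exp Q - 1)) with (/ (exp Q - 1) * (phit t x * exp (phi t x))) by (unfold Rdiv; ring).
    apply is_derive_scal. apply (is_derive_comp exp (fun s => phi s x)); auto. apply is_derive_exp. }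
  assert (M := is_derive_mult _ _ t _ _ E D Rmult_comm).
  unfold mult, plus in M; simpl in M.
  match type of M with is_derive _ _ ?l => match goal with |- is_derive _ _ ?l' => replace l' with l end end.
  exact M. unfold Rdiv. ring.
Qed.

Lemma VM_cont2 : cont2 (fun t y => - lV t y * lM t y).
Proof. apply cont2_mult; auto using cont2_opp, lV_cont2, lM_cont2. Qed.

Lemma la_dt t x : 0 < t < T -> is_derive (fun t => la t x) t (/ 2 * la t x * lb t x - / 2 * lA t x).
Proof.
  intros Ht. apply is_derive_ext with (fun t => J (2 * PI) (psi t) (lM t) x); [intros; symmetry; apply la_J|].
  assert (D := J_dt (2 * PI) psi lM lU (fun t y => - lV t y * lM t y) t x Ht psi_cont2 lM_cont2 lU_cont2 VM_cont2
    (fun s y => psi_dt s y) (fun s y => lM_dt s y)).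
  match type of D with is_derive _ _ ?l => match goal with |- is_derive _ _ ?l' => replace l' with l end end.
  exact D.
  rewrite <- la_J.
  (* The change of [m q] contributes [- lV * lM] and the motion of the phase [- lU * lM]; their sum
     is [- la * lM] because [lU + lV = la]. *)
  rewrite (J_ext _ _ _ (fun y => (-1) * (la t y * lM t y))).
  2:{ intros y. unfold lU. rewrite (lV_eq t y). field. }
  assert (E : J (2 * PI) (psi t) (fun y => -1 * (la t y * lM t y)) x = - J (2 * PI) (psi t) (fun y => la t y * lM t y) x).
  { unfold J. rewrite (RInt_ext_all _ (fun y => -1 * (exp (- psi t y) * (la t y * lM t y)))) by (intros; ring).
    rewrite RInt_scal_cont. ring.
    intros y. apply (continuous_J_integrand (psi t) (fun y => la t y * lM t y)); [apply psi_cont|].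
    intros z. apply (continuous_mult (la t) (lM t)); apply cont2_slice; auto using la_cont2, lM_cont2. }
  rewrite E, J_aM. unfold lU. field.
Qed.

Lemma lb_dt t x : 0 < t < T -> is_derive (fun t => lb t x) t (- / 2 * la t x * lb t x + / 2 * lB t x).
Proof.
  intros Ht. apply is_derive_ext with (fun t => - J (- (2 * PI)) (fun y => - psi t y) (lM t) x); [intros; symmetry; apply lb_J|].
  assert (D := J_dt (- (2 * PI)) (fun t y => - psi t y) lM (fun t y => - lU t y) (fun t y => - lV t y * lM t y) t x Ht
     (cont2_opp _ psi_cont2) lM_cont2 (cont2_opp _ lU_cont2) VM_cont2
    (fun s y Hs => is_derive_opp (fun s => psi s y) s _ (psi_dt s y Hs)) (fun s y => lM_dt s y)).
  apply @is_derive_opp in D. unfold opp in D; simpl in D.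
  match type of D with is_derive _ _ ?l => match goal with |- is_derive _ _ ?l' => replace l' with l end end.
  exact D.
  assert (Eb := lb_J t x).
  rewrite (J_ext _ _ (fun y => - lV t y * lM t y - - lU t y * lM t y) (fun y => lb t y * lM t y)).
  2:{ intros y. unfold lU. rewrite (lV_eq t y). field. }
  rewrite J_bM. replace (J (- (2 * PI)) (fun y => - psi t y) (lM t) x) with (- lb t x) by lra.
  unfold lU. field.
Qed.

Lemma lU_dt t x : 0 < t < T -> is_derive (fun t => lU t x) t (- / 4 * (lA t x - lB t x)).
Proof.
  intros Ht. unfold lU. apply (is_derive_ext (fun t => / 2 * (la t x + lb t x))); [intros; simpl; field|].
  replace (- / 4 * (lA t x - lB t x)) with (/ 2 * ((/ 2 * la t x * lb t x - / 2 * lA t x) + (- / 2 * la t x * lb t x + / 2 * lB t x))) by field.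
  apply is_derive_scal. apply (is_derive_plus (fun t => la t x) (fun t => lb t x)); [now apply la_dt|now apply lb_dt].
Qed.

Lemma lV_dt t x : 0 < t < T -> is_derive (fun t => lV t x) t (/ 2 * la t x * lb t x - / 4 * (lA t x + lB t x)).
Proof.
  intros Ht. apply (is_derive_ext (fun t => / 2 * (la t x - lb t x))); [intros; simpl; rewrite lV_eq; field|].
  replace (/ 2 * la t x * lb t x - / 4 * (lA t x + lB t x)) with (/ 2 * ((/ 2 * la t x * lb t x - / 2 * lA t x) - (- / 2 * la t x * lb t x + / 2 * lB t x))) by field.
  apply is_derive_scal. apply (is_derive_minus (fun t => la t x) (fun t => lb t x)); [now apply la_dt|now apply lb_dt].
Qed.

Lemma r_0 x : r 0 x = 0.
Proof.
  rewrite r_eq, clamp_id, RInt_point. reflexivity. assert (H := flow_T_pos). lra.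
Qed.

Lemma psi_0 x : psi 0 x = x.
Proof.
  unfold psi. rewrite clamp_id, RInt_point. unfold zero; simpl; ring. assert (H := flow_T_pos). lra.
Qed.

Lemma lM_0 x : lM 0 x = m0 x.
Proof. unfold lM, lmom. rewrite r_0, Ropp_0, exp_0. ring. Qed.

Lemma lq_0 x : lq 0 x = 1.
Proof. unfold lq. now rewrite r_0, exp_0. Qed.

Section Initial.
Variables u0 du0 ddu0 : R -> R.
Hypothesis u0_periodic : periodic u0.
Hypothesis du0_periodic : periodic du0.
Hypothesis du0_spec : forall x : R, is_derive u0 x (du0 x).
Hypothesis ddu0_spec : forall x : R, is_derive du0 x (ddu0 x).
Hypothesis m0_spec : forall x, m0 x = u0 x - ddu0 x.

Lemma la_0 x : la 0 x = u0 x + du0 x.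
Proof.
  rewrite la_J. symmetry.
  apply (J_unique (2 * PI) (psi 0) (lM 0) (lq 0) (fun x => u0 x + du0 x)); auto using exp_2PI_neq, psi_dx, psi_shift_neg, lM_cont.
  - intros y. now rewrite u0_periodic, du0_periodic.
  - intros y. rewrite lq_0, lM_0, m0_spec. replace (1 * (u0 y + du0 y) - (u0 y - ddu0 y)) with (du0 y + ddu0 y) by ring.
    now apply (is_derive_plus u0 du0).
Qed.

Lemma lb_0 x : lb 0 x = u0 x - du0 x.
Proof.
  rewrite lb_J.
  rewrite <- (J_unique (- (2 * PI)) (fun y => - psi 0 y) (lM 0) (fun y => - lq 0 y) (fun x => - (u0 x - du0 x)));
    auto using exp_n2PI_neq, npsi_dx, npsi_shift_neg, lM_cont.
  - ring.
  - intros y. now rewrite u0_periodic, du0_periodic.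
  - intros y. rewrite lq_0, lM_0, m0_spec.
    replace (- (1) * - (u0 y - du0 y) - (u0 y - ddu0 y)) with (- (du0 y - ddu0 y)) by ring.
    apply (is_derive_opp (fun x => u0 x - du0 x)). now apply (is_derive_minus u0 du0).
Qed.

Lemma lU_0 x : lU 0 x = u0 x.
Proof. unfold lU. rewrite la_0, lb_0. field. Qed.
Lemma lV_0 x : lV 0 x = du0 x.
Proof. rewrite lV_eq, la_0, lb_0. field. Qed.

End Initial.

End Flow.

(** * A priori bounds and removal of the truncation *)

Lemma periodic_nat f n x : periodic f -> f (x + INR n * (2 * PI)) = f x.
Proof.
  intros H. induction n as [|n IH]; [simpl; f_equal; ring|].
  rewrite S_INR. replace (x + (INR n + 1) * (2 * PI)) with (x + INR n * (2 * PI) + 2 * PI) by ring. now rewrite H.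
Qed.

(** A single representative [y] serves all periodic functions at once, as is needed to compare two
    functions, or one function at two times, at the same point. *)
Lemma periodic_reduce x : exists y, 0 <= y <= 2 * PI /\ forall f, periodic f -> f x = f y.
Proof.
  assert (PIpos := PI_RGT_0).
  assert (Hpos : forall z, 0 <= z -> exists y, 0 <= y <= 2 * PI /\ exists n, z = y + INR n * (2 * PI)).
  { intros z Hz. destruct (nfloor_ex (z / (2 * PI))) as [n [H1 H2]]. apply Rdiv_le_0_compat; lra.
    exists (z - INR n * (2 * PI)). split; [|exists n; ring].
    assert (E : z / (2 * PI) * (2 * PI) = z) by (field; lra). split; nra. }
  destruct (Rle_dec 0 x) as [H|H].
  - destruct (Hpos x H) as [y [Hy [n E]]]. exists y. split; [exact Hy|]. intros f Hf. rewrite E. now apply periodic_nat.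
  - destruct (Hpos (- x)) as [y [Hy [n E]]]; [lra|]. exists (2 * PI - y). split; [lra|]. intros f Hf.
    rewrite <- (periodic_nat f (S n) x Hf). f_equal. rewrite S_INR. lra.
Qed.

Lemma periodic_bounded (f : R -> R) : (forall x : R, continuous f x) -> periodic f -> exists B, 0 < B /\ forall x, Rabs (f x) <= B.
Proof.
  intros Cf Pf. destruct (cont2_bounded (fun _ x => f x) 0 0 0 (2 * PI) (cont2_of_1d f Cf)) as [B [HB H]].
  exists B. split; [exact HB|]. intros x. destruct (periodic_reduce x) as [y [Hy E]]. rewrite (E f Pf). apply (H 0 y); lra.
Qed.

(** Differentiability is asked only in the open interval, because the equations provide time
    derivatives only for interior times. *)
Lemma MVT_open (f df : R -> R) a b : a < b -> (forall x : R, a <= x <= b -> continuous f x) ->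
  (forall x : R, a < x < b -> is_derive f x (df x)) -> exists c, a < c < b /\ f b - f a = df c * (b - a).
Proof.
  intros Hlt Cf Df.
  assert (pr1 : forall c, a < c < b -> derivable_pt f c).
  { intros c Hc. exists (df c). apply is_derive_Reals. auto. }
  destruct (MVT f id a b pr1 (fun c _ => derivable_pt_id c) Hlt) as [c [Hc E]].
  - intros c Hc. apply continuity_pt_of_continuous. auto.
  - intros c _. apply derivable_continuous_pt, derivable_pt_id.
  - exists c. split; [exact Hc|].
    rewrite (derive_pt_eq_0 _ _ _ _ (derivable_pt_lim_id c)) in E.
    rewrite (derive_pt_eq_0 f c (df c) (pr1 c Hc)) in E by (apply is_derive_Reals; auto).
    unfold id in E. lra.
Qed.

Lemma MVT_bound (f df : R -> R) a b K : a <= b -> (forall x : R, a <= x <= b -> continuous f x) ->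
  (forall x : R, a < x < b -> is_derive f x (df x)) -> (forall x, a < x < b -> Rabs (df x) <= K) ->
  Rabs (f b - f a) <= K * (b - a).
Proof.
  intros Hab Cf Df Bf. destruct (Req_dec a b) as [->|N].
  { rewrite !Rminus_diag, Rabs_R0. lra. }
  destruct (MVT_open f df a b) as [c [Hc E]]; auto; [lra|].
  rewrite E, Rabs_mult, (Rabs_pos_eq (b - a)) by lra. apply Rmult_le_compat_r; [lra|auto].
Qed.

Section Apriori.
Variable T : R.
Variable m0 : R -> R.
Variable r : R -> R -> R.
Hypothesis HF : lagrangian_flow T m0 r.
Variable K : R.
Hypothesis K_pos : 0 < K.
Hypothesis KT : 9 * K * T <= 1.
Hypothesis a_init : forall x, Rabs (la m0 r 0 x) <= K.
Hypothesis b_init : forall x, Rabs (lb m0 r 0 x) <= K.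

(** Under the bound [3 * K] both time derivatives are at most [9 * K ^ 2], and [9 * K * T <= 1] then
    limits the growth beyond the initial size [K] to another [K]. *)
Lemma diag_growth t : 0 <= t <= T ->
  (forall s x, 0 <= s <= t -> Rabs (la m0 r s x) <= 3 * K /\ Rabs (lb m0 r s x) <= 3 * K) ->
  forall x, Rabs (la m0 r t x) <= 2 * K /\ Rabs (lb m0 r t x) <= 2 * K.
Proof.
  intros Ht H x.
  assert (Hab : forall s y, 0 <= s <= t -> Rabs (la m0 r s y * lb m0 r s y) <= 9 * K ^ 2).
  { intros s y Hs. destruct (H s y Hs). rewrite Rabs_mult.
    replace (9 * K ^ 2) with ((3 * K) * (3 * K)) by ring. apply Rmult_le_compat; auto using Rabs_pos. }
  assert (KK : 9 * K ^ 2 * (t - 0) <= K).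
  { replace (9 * K ^ 2 * (t - 0)) with (K * (9 * K * t)) by ring.
    assert (9 * K * t <= 9 * K * T) by (apply Rmult_le_compat_l; lra). nra. }
  split.
  - assert (B : Rabs (la m0 r t x - la m0 r 0 x) <= 9 * K ^ 2 * (t - 0)).
    { apply (MVT_bound (fun s => la m0 r s x) (fun s => / 2 * la m0 r s x * lb m0 r s x - / 2 * lA T m0 r s x)); [lra| | |].
      - intros s _. apply (cont2_slice1 (la m0 r)). now apply la_cont2 with T.
      - intros s Hs. apply la_dt; auto. lra.
      - intros s Hs. assert (Ba := lA_bound T m0 r HF s (3 * K) (fun y => proj1 (H s y ltac:(lra))) x).
        assert (Bab := Hab s x ltac:(lra)).
        apply Rabs_le_between in Ba. apply Rabs_le_between in Bab. apply Rabs_le. nra. }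
    replace (la m0 r t x) with ((la m0 r t x - la m0 r 0 x) + la m0 r 0 x) by ring.
    eapply Rle_trans; [apply Rabs_triang|]. specialize (a_init x). lra.
  - assert (B : Rabs (lb m0 r t x - lb m0 r 0 x) <= 9 * K ^ 2 * (t - 0)).
    { apply (MVT_bound (fun s => lb m0 r s x) (fun s => - / 2 * la m0 r s x * lb m0 r s x + / 2 * lB T m0 r s x)); [lra| | |].
      - intros s _. apply (cont2_slice1 (lb m0 r)). now apply lb_cont2 with T.
      - intros s Hs. apply lb_dt; auto. lra.
      - intros s Hs. assert (Ba := lB_bound T m0 r HF s (3 * K) (fun y => proj2 (H s y ltac:(lra))) x).
        assert (Bab := Hab s x ltac:(lra)).
        apply Rabs_le_between in Ba. apply Rabs_le_between in Bab. apply Rabs_le. nra. }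
    replace (lb m0 r t x) with ((lb m0 r t x - lb m0 r 0 x) + lb m0 r 0 x) by ring.
    eapply Rle_trans; [apply Rabs_triang|]. specialize (b_init x). lra.
Qed.

Lemma uniform_time_continuity f : cont2 f -> (forall t, periodic (f t)) -> forall eps, 0 < eps ->
  exists h, 0 < h /\ forall s t x, 0 <= s <= T -> 0 <= t <= T -> Rabs (t - s) <= h -> Rabs (f t x - f s x) <= eps.
Proof.
  intros Cf Pf eps He.
  destruct (uniform_continuity_2d f 0 T 0 (2 * PI) (fun t x _ _ => Cf t x) (mkposreal _ He)) as [d Hd].
  exists (d / 2). assert (0 < d) by apply cond_pos. split; [lra|].
  intros s t x Hs Ht Hst. destruct (periodic_reduce x) as [y [Hy E]]. rewrite (E (f t) (Pf t)), (E (f s) (Pf s)).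
  left. apply Hd; auto; [lra|]. rewrite Rminus_diag, Rabs_R0. lra.
Qed.

(** A continuity argument by finite steps: over a time [h] the values move by at most [K], so the
    bound [2 * K] relaxes to [3 * K] on the next step, and [diag_growth] restores [2 * K]. *)
Lemma diag_apriori t x : 0 <= t <= T -> Rabs (la m0 r t x) <= 2 * K /\ Rabs (lb m0 r t x) <= 2 * K.
Proof.
  destruct (uniform_time_continuity (la m0 r) (la_cont2 _ _ _ HF) (la_periodic _ _ _ HF) K K_pos) as [h1 [Hh1 H1]].
  destruct (uniform_time_continuity (lb m0 r) (lb_cont2 _ _ _ HF) (lb_periodic _ _ _ HF) K K_pos) as [h2 [Hh2 H2]].
  set (h := Rmin h1 h2). assert (Hh : 0 < h) by now apply Rmin_glb_lt.
  assert (M1 : h <= h1) by apply Rmin_l. assert (M2 : h <= h2) by apply Rmin_r.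
  assert (Main : forall n t, 0 <= t <= T -> t <= INR n * h -> forall x, Rabs (la m0 r t x) <= 2 * K /\ Rabs (lb m0 r t x) <= 2 * K).
  { induction n as [|n IH]; intros s Hs Hn y.
    - simpl in Hn. replace s with 0 by lra. specialize (a_init y). specialize (b_init y). lra.
    - apply diag_growth; auto. intros s' z Hs'. rewrite S_INR in Hn.
      assert (Hp : 0 <= Rmax 0 (s' - h) <= T /\ Rmax 0 (s' - h) <= INR n * h /\ Rabs (s' - Rmax 0 (s' - h)) <= h).
      { assert (0 <= INR n * h) by (apply Rmult_le_pos; [apply pos_INR|lra]).
        unfold Rmax. destruct Rle_dec; rewrite Rabs_pos_eq; lra. }
      destruct Hp as [P1 [P2 P3]]. destruct (IH _ P1 P2 z) as [A B].
      assert (G1 := H1 _ s' z P1 ltac:(lra) ltac:(lra)). assert (G2 := H2 _ s' z P1 ltac:(lra) ltac:(lra)).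
      apply Rabs_le_between in A. apply Rabs_le_between in B. apply Rabs_le_between in G1. apply Rabs_le_between in G2.
      split; apply Rabs_le; lra. }
  intros Ht. destruct (nfloor_ex (T / h)) as [n [_ Hn]]. { apply Rdiv_le_0_compat; lra. }
  apply (Main (S n)); auto. rewrite S_INR.
  assert (E : T / h * h = T) by (field; lra). nra.
Qed.

End Apriori.

Section FlowExistence.
Variables u0 du0 ddu0 : R -> R.
Hypothesis u0_periodic : periodic u0.
Hypothesis du0_periodic : periodic du0.
Hypothesis ddu0_periodic : periodic ddu0.
Hypothesis du0_spec : forall x : R, is_derive u0 x (du0 x).
Hypothesis ddu0_spec : forall x : R, is_derive du0 x (ddu0 x).
Hypothesis ddu0_cont : forall x : R, continuous ddu0 x.
Variables T K : R.
Hypothesis T_pos : 0 < T.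
Hypothesis K_pos : 0 < K.
Hypothesis KT : 9 * K * T <= 1.
Hypothesis init_bound : forall x, Rabs (u0 x) + Rabs (du0 x) <= K.

Let m0 := fun x => u0 x - ddu0 x.

(** The bound on [r] comes from [2 * K * T <= 2 / 9], well inside the truncation at 1. Shorter times
    [T'] are allowed because [flow_exists] applies this before a flow on all of [[0, T]] is
    known. *)
Lemma flow_bounds T' r : T' <= T -> lagrangian_flow T' m0 r ->
  (forall t x, 0 <= t <= T' -> Rabs (la m0 r t x) <= 2 * K /\ Rabs (lb m0 r t x) <= 2 * K) /\
  forall t x, Rabs (r t x) <= / 2.
Proof.
  intros HT HF.
  assert (HT' : 0 < T') by apply HF.
  assert (KT' : 9 * K * T' <= 1). { assert (9 * K * T' <= 9 * K * T) by (apply Rmult_le_compat_l; lra). lra. }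
  assert (Hab : forall t x, 0 <= t <= T' -> Rabs (la m0 r t x) <= 2 * K /\ Rabs (lb m0 r t x) <= 2 * K).
  { intros t x. apply diag_apriori; auto.
    - intros y. rewrite (la_0 T' m0 r HF u0 du0 ddu0); auto. eapply Rle_trans; [apply Rabs_triang|apply init_bound].
    - intros y. rewrite (lb_0 T' m0 r HF u0 du0 ddu0); auto. unfold Rminus. eapply Rle_trans; [apply Rabs_triang|].
      rewrite Rabs_Ropp. apply init_bound. }
  split; [exact Hab|].
  intros t x. rewrite (r_eq T' m0 r HF). assert (Hc := clampT_between T' m0 r HF t).
  eapply Rle_trans. apply RInt_abs_le with (K := 2 * K).
  - intros s. apply (cont2_slice1 (lV m0 r)). now apply lV_cont2 with T'.
  - intros s Hs. rewrite Rmin_left, Rmax_right in Hs by lra.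
    destruct (Hab s x ltac:(lra)) as [A B]. rewrite lV_eq. apply Rabs_le_between in A. apply Rabs_le_between in B. apply Rabs_le. lra.
  - rewrite Rminus_0_r, Rabs_pos_eq by lra. assert (2 * K * clamp 0 T' t <= 2 * K * T') by (apply Rmult_le_compat_l; lra). nra.
Qed.

Theorem flow_exists : exists r, lagrangian_flow T m0 r.
Proof.
  assert (Cu0 : forall x : R, continuous u0 x) by (intros; eapply continuous_of_derive, du0_spec).
  assert (Cm : forall x : R, continuous m0 x) by (intros; apply (continuous_minus u0 ddu0); auto).
  assert (Pm : periodic m0) by (intros x; unfold m0; now rewrite u0_periodic, ddu0_periodic).
  destruct (periodic_bounded m0 Cm Pm) as [Mm [_ Bm]].
  destruct (truncated_flow m0 Mm T T_pos Cm Pm Bm) as [L [HL [r [Cr [Pr [Er Br]]]]]].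
  (* In a time [h] the truncated solution moves by at most 1/2: starting from size 1/2 it stays in
     [[-1, 1]], and [flow_bounds] brings it back to 1/2. *)
  set (h := / (2 * L)). assert (Hh : 0 < h) by (unfold h; pos).
  (* While [r] stays in [[-1, 1]] the clamp in the vector field is the identity, so stopping time at
     [T'] gives a genuine flow on [[0, T']]. *)
  assert (Freeze : forall T', 0 < T' <= T -> (forall t x, 0 <= t <= T' -> Rabs (r t x) <= 1) ->
    lagrangian_flow T' m0 (fun t x => r (clamp 0 T' t) x)).
  { intros T' HT' B.
    assert (Ct : forall t : R, continuous (clamp 0 T') t) by (intros; apply continuous_clamp; lra).
    split; [lra|]. split; [exact Cm|]. split; [exact Pm|]. split; [|split].
    - apply (cont2_comp2 r (fun t _ => clamp 0 T' t) (fun _ x => x)); auto using cont2_snd. now apply cont2_of_1d_fst.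
    - intros t. apply Pr.
    - intros t x. assert (Hc := clamp_between 0 T' t ltac:(lra)). rewrite Er, (clamp_id 0 T (clamp 0 T' t)) by lra.
      apply RInt_ext. intros s Hs. rewrite Rmin_left, Rmax_right in Hs by lra.
      unfold lV. f_equal. apply functional_extensionality. intros y. rewrite !clamp_id; try lra; auto.
      apply Rabs_le_between, B. lra. }
  assert (Lip : forall s t x, 0 <= s <= T -> 0 <= t <= T -> Rabs (r t x - r s x) <= L * Rabs (t - s)).
  { intros s t x Hs Ht. rewrite !Er, !clamp_id by lra.
    assert (CV : forall s : R, continuous (fun s : R => slope m0 (fun y : R => clamp (-1) 1 (r s y)) x) s).
    { intros z. apply (cont2_slice1 (fun s x => slope m0 (fun y => clamp (-1) 1 (r s y)) x)).
      apply (cont2_slope m0 (fun s y => clamp (-1) 1 (r s y))); auto. apply cont2_comp1; auto.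
      intros; apply continuous_clamp; lra. }
    rewrite <- (RInt_Chasles_cont _ 0 s t CV).
    rewrite Rplus_minus_l.
    apply RInt_abs_le; auto. }
  assert (Main : forall n t, 0 <= t <= T -> t <= INR n * h -> forall x, Rabs (r t x) <= / 2).
  { induction n as [|n IH]; intros t Ht Hn x.
    - simpl in Hn. replace t with 0 by lra. rewrite Er, clamp_id, RInt_point by lra. unfold zero; simpl. rewrite Rabs_R0. lra.
    - rewrite S_INR in Hn. destruct (Req_dec t 0) as [E|N].
      { apply IH; auto. rewrite E. apply Rmult_le_pos; [apply pos_INR|lra]. }
      assert (B : forall s x, 0 <= s <= t -> Rabs (r s x) <= 1).
      { intros s y Hs.
        assert (Hp : 0 <= Rmax 0 (s - h) <= T /\ Rmax 0 (s - h) <= INR n * h /\ Rabs (s - Rmax 0 (s - h)) <= h).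
        { assert (0 <= INR n * h) by (apply Rmult_le_pos; [apply pos_INR|lra]).
          unfold Rmax. destruct Rle_dec; rewrite Rabs_pos_eq; lra. }
        destruct Hp as [P1 [P2 P3]]. assert (A := IH _ P1 P2 y). assert (G := Lip _ s y P1 ltac:(lra)).
        assert (L * Rabs (s - Rmax 0 (s - h)) <= / 2).
        { replace (/ 2) with (L * h) by (unfold h; field; lra). apply Rmult_le_compat_l; lra. }
        replace (r s y) with ((r s y - r (Rmax 0 (s - h)) y) + r (Rmax 0 (s - h)) y) by ring.
        eapply Rle_trans; [apply Rabs_triang|]. lra. }
      assert (HF := Freeze t ltac:(lra) B).
      destruct (flow_bounds t _ ltac:(lra) HF) as [_ G]. specialize (G t x). simpl in G. rewrite clamp_id in G by lra. exact G. }
  exists (fun t x => r (clamp 0 T t) x). apply Freeze; [lra|].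
  intros t x Ht. destruct (nfloor_ex (T / h)) as [n [_ Hn]]. { apply Rdiv_le_0_compat; lra. }
  apply Rle_trans with (/ 2); [|lra]. apply (Main (S n)); auto. rewrite S_INR.
  assert (E : T / h * h = T) by (field; lra). nra.
Qed.

End FlowExistence.

(** * The Eulerian solution *)

(** Since [N] vanishes at [s0], continuity of the other factor at [s0] is enough for the product
    rule. *)
Lemma is_derive_mult_zero (N k : R -> R) s0 n : is_derive N s0 n -> N s0 = 0 -> continuous k s0 ->
  is_derive (fun s => N s * k s) s0 (n * k s0).
Proof.
  intros DN N0 Ck. apply is_derive_Reals. apply is_derive_Reals in DN. intros eps He.
  set (A := Rabs (k s0) + 1). assert (HA : 0 < A) by (unfold A; assert (0 <= Rabs (k s0)) by apply Rabs_pos; lra).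
  set (B := Rabs n + 1). assert (HB : 0 < B) by (unfold B; assert (0 <= Rabs n) by apply Rabs_pos; lra).
  destruct (DN (eps / (2 * A)) ltac:(pos)) as [d1 H1].
  assert (Ck' := proj1 (continuity_pt_locally k s0) (continuity_pt_of_continuous k s0 Ck)).
  assert (Hm : 0 < Rmin 1 (eps / (2 * B))) by (apply Rmin_glb_lt; [lra|pos]).
  destruct (Ck' (mkposreal _ Hm)) as [d2 H2].
  exists (mkposreal _ (Rmin_stable_in_posreal d1 d2)). simpl. intros h Hh Hd.
  assert (Rmin d1 d2 <= d1) by apply Rmin_l. assert (Rmin d1 d2 <= d2) by apply Rmin_r.
  specialize (H1 h Hh ltac:(lra)). assert (H2' : Rabs (k (s0 + h) - k s0) < Rmin 1 (eps / (2 * B))).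
  { apply H2. change (Rabs (s0 + h - s0) < d2). replace (s0 + h - s0) with h by ring. lra. }
  assert (Rmin 1 (eps / (2 * B)) <= 1) by apply Rmin_l. assert (Rmin 1 (eps / (2 * B)) <= eps / (2 * B)) by apply Rmin_r.
  rewrite N0 in *. rewrite Rminus_0_r in H1.
  replace ((N (s0 + h) * k (s0 + h) - 0 * k s0) / h - n * k s0) with
    ((N (s0 + h) / h - n) * k (s0 + h) + n * (k (s0 + h) - k s0)) by (field; exact Hh).
  eapply Rle_lt_trans; [apply Rabs_triang|]. rewrite !Rabs_mult.
  assert (Rabs (k (s0 + h)) <= A).
  { replace (k (s0 + h)) with ((k (s0 + h) - k s0) + k s0) by ring. eapply Rle_trans; [apply Rabs_triang|]. unfold A; lra. }
  assert (Rabs (N (s0 + h) / h - n) * Rabs (k (s0 + h)) <= eps / (2 * A) * A).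
  { apply Rmult_le_compat; auto using Rabs_pos. lra. }
  assert (Rabs n * Rabs (k (s0 + h) - k s0) < eps / 2).
  { apply Rle_lt_trans with (Rabs n * (eps / (2 * B))).
    - apply Rmult_le_compat_l; [apply Rabs_pos|lra].
    - replace (eps / 2) with (B * (eps / (2 * B))) by (field; lra). apply Rmult_lt_compat_r; [pos|unfold B; lra]. }
  replace (eps / (2 * A) * A) with (eps / 2) in * by (field; lra). lra.
Qed.

(** A Hadamard factorization with the difference quotient [k] along the curve [y]. Each [k s] is a
    value of [Fy] at a point between [y s0] and [y s], which gives continuity at [s0] and also
    transfers a sign of [Fy] to [k]. *)
Lemma slope_factor (F Fy : R -> R -> R) (y : R -> R) s0 :
  (forall s v : R, is_derive (F s) v (Fy s v)) -> cont2 Fy -> continuous y s0 ->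
  exists k : R -> R, continuous k s0 /\ k s0 = Fy s0 (y s0) /\
    (forall s, F s (y s) - F s (y s0) = k s * (y s - y s0)) /\
    (forall s, exists v, k s = Fy s v).
Proof.
  intros DF CF Cy.
  set (k := fun s => if Req_EM_T (y s) (y s0) then Fy s (y s0) else (F s (y s) - F s (y s0)) / (y s - y s0)).
  assert (Hk : forall s, exists v, k s = Fy s v /\ Rabs (v - y s0) <= Rabs (y s - y s0)).
  { intros s. unfold k. destruct (Req_EM_T (y s) (y s0)) as [E|N].
    - exists (y s0). split; [reflexivity|]. rewrite E. lra.
    - destruct (MVT_gen (F s) (y s0) (y s) (Fy s)) as [v [Hv E]].
      + intros; apply DF.
      + intros; apply continuity_pt_of_continuous. eapply continuous_of_derive, DF.
      + exists v. split. rewrite E. field. lra.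
        unfold Rmin, Rmax in Hv. destruct Rle_dec; unfold Rabs; repeat destruct Rcase_abs; lra. }
  exists k. split; [|split; [|split]].
  - apply continuity_pt_filterlim. apply continuity_pt_locally. intros eps.
    assert (Ek : k s0 = Fy s0 (y s0)).
    { unfold k. destruct (Req_EM_T (y s0) (y s0)); [reflexivity|lra]. }
    destruct (CF s0 (y s0) eps) as [d1 H1].
    assert (Cy' := proj1 (continuity_pt_locally y s0) (continuity_pt_of_continuous y s0 Cy)).
    destruct (Cy' d1) as [d2 H2].
    exists (mkposreal _ (Rmin_stable_in_posreal d1 d2)). intros s Hs. simpl in Hs.
    assert (Rmin d1 d2 <= d1) by apply Rmin_l. assert (Rmin d1 d2 <= d2) by apply Rmin_r.
    assert (Hs' : Rabs (s - s0) < Rmin d1 d2) by exact Hs.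
    assert (H2' : Rabs (y s - y s0) < d1). { apply H2. apply Rlt_le_trans with (1 := Hs'). lra. }
    destruct (Hk s) as [v [E Hv]]. rewrite E, Ek. apply H1; lra.
  - unfold k. destruct (Req_EM_T (y s0) (y s0)); [reflexivity|lra].
  - intros s. unfold k. destruct (Req_EM_T (y s) (y s0)) as [->|N]; [ring|]. field. lra.
  - intros s. destruct (Hk s) as [v [E _]]. now exists v.
Qed.

Lemma chain_rule2 (F Fy : R -> R -> R) (y : R -> R) s0 Fs dy :
  (forall s v : R, is_derive (F s) v (Fy s v)) -> cont2 Fy -> is_derive (fun s => F s (y s0)) s0 Fs -> is_derive y s0 dy ->
  is_derive (fun s => F s (y s)) s0 (Fs + dy * Fy s0 (y s0)).
Proof.
  intros DF CF DFs Dy.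
  destruct (slope_factor F Fy y s0 DF CF (continuous_of_derive _ _ _ Dy)) as [k [Ck [Ek [Hk _]]]].
  apply (is_derive_ext (fun s => F s (y s0) + (y s - y s0) * k s)).
  - intros s. specialize (Hk s). simpl. lra.
  - apply @is_derive_plus; [exact DFs|]. rewrite <- Ek.
    apply (is_derive_mult_zero (fun s => y s - y s0)); auto; [|ring].
    replace dy with (dy - 0) by ring. apply (is_derive_minus y (fun _ => y s0)); auto. apply @is_derive_const.
Qed.

(** The factorization solves for the increment: [y s - y s0] is [(G s - F s (y s0)) / k s], whose
    numerator vanishes at [s0]. Only continuity of [y] is assumed, its differentiability being the
    point. *)
Lemma implicit_derive (F Fy : R -> R -> R) (y G : R -> R) s0 Fs g :
  (forall s v : R, is_derive (F s) v (Fy s v)) -> cont2 Fy -> (forall s v, 0 < Fy s v) ->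
  is_derive (fun s => F s (y s0)) s0 Fs -> continuous y s0 -> (forall s, F s (y s) = G s) -> is_derive G s0 g ->
  is_derive y s0 ((g - Fs) / Fy s0 (y s0)).
Proof.
  intros DF CF PF DFs Cy EG DG.
  destruct (slope_factor F Fy y s0 DF CF Cy) as [k [Ck [Ek [Hk Hv]]]].
  assert (Pk : forall s, 0 < k s) by (intros s; destruct (Hv s) as [v ->]; apply PF).
  apply (is_derive_ext (fun s => y s0 + (G s - F s (y s0)) * / k s)).
  - intros s. specialize (Hk s). specialize (Pk s). rewrite <- EG, Hk. simpl. field. lra.
  - rewrite <- (Rplus_0_l ((g - Fs) / Fy s0 (y s0))). apply @is_derive_plus; [apply @is_derive_const|].
    rewrite <- Ek. apply (is_derive_mult_zero (fun s => G s - F s (y s0)) (fun s => / k s)).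
    + now apply (is_derive_minus G (fun s => F s (y s0))).
    + rewrite EG. ring.
    + apply (continuous_comp k Rinv); auto. apply continuous_Rinv_pt. specialize (Pk s0). lra.
Qed.

Lemma derive_periodic (f df : R -> R) : periodic f -> (forall x : R, is_derive f x (df x)) -> periodic df.
Proof.
  intros Pf Df x. rewrite <- (is_derive_unique f x _ (Df x)). symmetry. apply is_derive_unique.
  apply (is_derive_ext (fun y => f (y + 2 * PI))); [intros; apply Pf|].
  rewrite <- (Rmult_1_l (df (x + 2 * PI))). apply (is_derive_comp f (fun y => y + 2 * PI)); auto. auto_derive; auto.
Qed.

Section Eulerian.
Variable T : R.
Variable m0 : R -> R.
Variable r : R -> R -> R.
Hypothesis HF : lagrangian_flow T m0 r.
Hypothesis r_bound : forall t x, Rabs (r t x) <= 1.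
Hypothesis m0_smooth : smooth m0.

(** Regularity bootstraps: the [x]-derivatives of [la] and [lb] are polynomials in [lq], [la], [lb]
    and [lM], so both gain one order, and [r] then gains it as a time integral of
    [(la - lb) / 2]. *)
Lemma flow_CK k : CK k r /\ CK k (la m0 r) /\ CK k (lb m0 r).
Proof.
  induction k as [|k [Hr [Ha Hb]]].
  - split; [|split]; [eapply r_cont2|eapply la_cont2|eapply lb_cont2]; exact HF.
  - assert (Hq : CK k (lq r)) by now apply CK_exp.
    assert (HM : CK k (lM m0 r)).
    { apply (CK_mult k (fun _ x => m0 x)); [now apply CK_of_1d|]. apply CK_exp. now apply CK_opp. }
    assert (Ha' : CK (S k) (la m0 r)).
    { apply CK_S with (fun t x => lq r t x * la m0 r t x - lM m0 r t x).
      - eapply la_cont2; exact HF.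
      - intros t x. eapply la_dx; exact HF.
      - auto using CK_minus, CK_mult. }
    assert (Hb' : CK (S k) (lb m0 r)).
    { apply CK_S with (fun t x => - lq r t x * lb m0 r t x + lM m0 r t x).
      - eapply lb_cont2; exact HF.
      - intros t x. eapply lb_dx; exact HF.
      - auto using CK_plus, CK_mult, CK_opp. }
    split; [|split; assumption].
    apply CK_ext with (fun t x => RInt (fun s => lV m0 r s x) 0 (clamp 0 T t)).
    { intros t x. symmetry. eapply r_eq; exact HF. }
    apply CK_RInt_time. intros t. eapply clampT_cont; exact HF.
    apply CK_ext with (fun t x => / 2 * (la m0 r t x - lb m0 r t x)).
    { intros t x. rewrite lV_eq. field. }
    apply CK_scal. now apply CK_minus.
Qed.

Lemma lU_CK k : CK k (lU m0 r).
Proof.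
  apply CK_ext with (fun t x => / 2 * (la m0 r t x + lb m0 r t x)).
  { intros t x. unfold lU. field. }
  apply CK_scal. apply CK_plus; apply flow_CK.
Qed.

Lemma inv_lq_CK k : CK k (fun t x => / lq r t x).
Proof.
  apply CK_ext with (fun t x => exp (- r t x)).
  { intros t x. unfold lq. apply exp_Ropp. }
  apply CK_exp, CK_opp. apply flow_CK.
Qed.

(** The Jacobian is at least [exp (-1)]. This one inequality yields injectivity of the flow map, its
    surjectivity, and the joint continuity of the inverse. *)
Lemma psi_expand t x y : Rabs (x - y) <= exp 1 * Rabs (psi T m0 r t x - psi T m0 r t y).
Proof.
  destruct (MVT_gen (psi T m0 r t) y x (lq r t)) as [c [_ E]].
  - intros z _. apply psi_dx; auto.
  - intros z _. apply continuity_pt_of_continuous. apply psi_cont; auto.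
  - rewrite E, Rabs_mult. assert (Hc := r_bound t c). apply Rabs_le_between in Hc.
    unfold lq. rewrite (Rabs_pos_eq (exp _)) by (left; apply exp_pos).
    rewrite <- Rmult_assoc, <- exp_plus. assert (He := exp_le 0 (1 + r t c) ltac:(lra)). rewrite exp_0 in He.
    assert (0 <= Rabs (x - y)) by apply Rabs_pos. nra.
Qed.

Lemma psi_increasing t x y : x <= y -> psi T m0 r t x <= psi T m0 r t y.
Proof.
  intros H. destruct (MVT_gen (psi T m0 r t) x y (lq r t)) as [c [_ E]].
  - intros z _. apply psi_dx; auto.
  - intros z _. apply continuity_pt_of_continuous. apply psi_cont; auto.
  - assert (P := lq_pos r t c). nra.
Qed.

Lemma psi_inverse_exists t z : {x : R | psi T m0 r t x = z}.
Proof.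
  (* By [psi_expand], moving the label by [d] moves the image by at least
     [Rabs (z - psi T m0 r t 0)], so [- d] and [d] bracket the preimage of [z]. *)
  set (d := exp 1 * Rabs (z - psi T m0 r t 0)).
  assert (Hd : 0 <= d) by (apply Rmult_le_pos; [left; apply exp_pos|apply Rabs_pos]).
  destruct (IVT_gen_consistent (psi T m0 r t) (- d) d z) as [x [_ Hx]].
  - intros x. apply psi_cont; auto.
  - assert (I1 := psi_increasing t (- d) 0 ltac:(lra)). assert (I2 := psi_increasing t 0 d ltac:(lra)).
    assert (E1 := psi_expand t d 0). assert (E2 := psi_expand t (- d) 0).
    rewrite Rminus_0_r in E1, E2. rewrite Rabs_Ropp in E2. rewrite (Rabs_pos_eq d) in E1, E2 by lra.
    apply Rmult_le_reg_l in E1; [|apply exp_pos]. apply Rmult_le_reg_l in E2; [|apply exp_pos].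
    rewrite Rmin_left, Rmax_right by lra.
    rewrite (Rabs_pos_eq (psi T m0 r t d - _)) in E1 by lra.
    rewrite (Rabs_minus_sym (psi T m0 r t (- d))), (Rabs_pos_eq (psi T m0 r t 0 - psi T m0 r t (- d))) in E2 by lra.
    assert (A := Rle_abs (z - psi T m0 r t 0)). assert (B := Rle_abs (- (z - psi T m0 r t 0))). rewrite Rabs_Ropp in B. lra.
  - now exists x.
Qed.

Definition inv_psi (t z : R) : R := proj1_sig (psi_inverse_exists t z).

Lemma psi_inv t z : psi T m0 r t (inv_psi t z) = z.
Proof. unfold inv_psi. now destruct psi_inverse_exists. Qed.

Lemma psi_inj t x y : psi T m0 r t x = psi T m0 r t y -> x = y.
Proof.
  intros E. apply Rminus_diag_uniq. assert (H := psi_expand t x y). rewrite E, Rminus_diag, Rabs_R0, Rmult_0_r in H.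
  destruct (Req_dec (x - y) 0) as [E0|N]; [exact E0|]. apply Rabs_pos_lt in N. lra.
Qed.

Lemma inv_psi_psi t x : inv_psi t (psi T m0 r t x) = x.
Proof. apply (psi_inj t). apply psi_inv. Qed.

Lemma inv_psi_shift t z : inv_psi t (z + 2 * PI) = inv_psi t z + 2 * PI.
Proof. apply (psi_inj t). rewrite psi_inv, psi_shift, psi_inv; auto. Qed.

Lemma inv_psi_cont2 : cont2 inv_psi.
Proof.
  intros t z eps. set (e := exp 1). assert (He : 0 < e) by apply exp_pos.
  assert (He2 : 0 < eps / (2 * e)) by (assert (0 < eps) by apply cond_pos; pos).
  destruct (psi_cont2 T m0 r HF t (inv_psi t z) (mkposreal _ He2)) as [d Hd].
  exists (mkposreal _ (Rmin_stable_in_posreal d (mkposreal _ He2))). simpl. intros s w Hs Hw.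
  assert (M1 : Rmin d (eps / (2 * e)) <= d) by apply Rmin_l.
  assert (M2 : Rmin d (eps / (2 * e)) <= eps / (2 * e)) by apply Rmin_r.
  eapply Rle_lt_trans; [apply (psi_expand s)|]. rewrite psi_inv. fold e.
  specialize (Hd s (inv_psi t z) ltac:(lra)). rewrite Rminus_diag, Rabs_R0 in Hd. specialize (Hd (cond_pos d)).
  simpl in Hd. rewrite psi_inv in Hd.
  replace (pos eps) with (e * (eps / (2 * e) + eps / (2 * e))) by (field; lra).
  apply Rmult_lt_compat_l; [exact He|].
  replace (w - psi T m0 r s (inv_psi t z)) with ((w - z) - (psi T m0 r s (inv_psi t z) - z)) by ring.
  unfold Rminus at 1. eapply Rle_lt_trans; [apply Rabs_triang|]. rewrite Rabs_Ropp. lra.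
Qed.

Lemma inv_psi_dz t z : is_derive (inv_psi t) z (/ lq r t (inv_psi t z)).
Proof.
  replace (/ lq r t (inv_psi t z)) with ((1 - 0) / lq r t (inv_psi t z)) by (field; apply Rgt_not_eq, lq_pos).
  (* The parameter is now the space point [z], on which [F] does not depend; it occurs only on the
     right-hand side. *)
  apply (implicit_derive (fun _ v => psi T m0 r t v) (fun _ v => lq r t v) (inv_psi t) (fun z => z)).
  - intros _ v. apply psi_dx; auto.
  - apply cont2_of_1d. intros v. apply cont2_slice. eapply lq_cont2; exact HF.
  - intros _ v. apply lq_pos.
  - apply @is_derive_const.
  - apply cont2_slice, inv_psi_cont2.
  - intros s. apply psi_inv.
  - apply @is_derive_id.
Qed.

Lemma inv_psi_dt t z : 0 < t < T -> is_derive (fun t => inv_psi t z) t (- lU m0 r t (inv_psi t z) / lq r t (inv_psi t z)).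
Proof.
  intros Ht. replace (- lU m0 r t (inv_psi t z) / lq r t (inv_psi t z)) with ((0 - lU m0 r t (inv_psi t z)) / lq r t (inv_psi t z))
    by (field; apply Rgt_not_eq, lq_pos).
  apply (implicit_derive (psi T m0 r) (lq r) (fun t => inv_psi t z) (fun _ => z)).
  - intros s v. apply psi_dx; auto.
  - eapply lq_cont2; exact HF.
  - intros s v. apply lq_pos.
  - apply psi_dt; auto.
  - apply (cont2_slice1 inv_psi), inv_psi_cont2.
  - intros s. apply psi_inv.
  - apply @is_derive_const.
Qed.

Definition euler (F : R -> R -> R) (t z : R) : R := F t (inv_psi t z).

Lemma euler_periodic F t : periodic (F t) -> periodic (euler F t).
Proof. intros H z. unfold euler. now rewrite inv_psi_shift, H. Qed.

Lemma euler_dz F F' t z : (forall x : R, is_derive (F t) x (F' t x)) ->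
  is_derive (euler F t) z (euler (fun t x => F' t x * / lq r t x) t z).
Proof.
  intros H. unfold euler. rewrite Rmult_comm. apply (is_derive_comp (F t) (inv_psi t)); auto. apply inv_psi_dz.
Qed.

Lemma euler_dz' F F' t z l : (forall x : R, is_derive (F t) x (F' t x)) ->
  (forall x, F' t x = lq r t x * l t x) -> is_derive (euler F t) z (euler l t z).
Proof.
  intros H E. replace (euler l t z) with (euler (fun t x => F' t x * / lq r t x) t z).
  - now apply euler_dz.
  - unfold euler. rewrite E. field. apply Rgt_not_eq, lq_pos.
Qed.

Lemma euler_CK k F : CK k F -> CK k (euler F).
Proof.
  revert F. induction k as [|k IH]; intros F.
  - intros H. exact (cont2_comp2 F (fun t _ => t) inv_psi H cont2_fst inv_psi_cont2).
  - intros HK. simpl in HK. destruct HK as [CF [F' [DF KF]]]. apply CK_S with (euler (fun t x => F' t x * / lq r t x)).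
    + exact (cont2_comp2 F (fun t _ => t) inv_psi CF cont2_fst inv_psi_cont2).
    + intros t z. apply euler_dz. apply DF.
    + apply IH. apply CK_mult; auto using inv_lq_CK.
Qed.

(** Here [l] is the derivative at a fixed label; the motion of the label that reaches the fixed
    point [z] contributes the transport term. *)
Lemma euler_dt F Fx t z l : 0 < t < T -> (forall s x : R, is_derive (F s) x (lq r s x * Fx s x)) -> cont2 Fx ->
  is_derive (fun s => F s (inv_psi t z)) t l ->
  is_derive (fun s => euler F s z) t (l - euler (lU m0 r) t z * euler Fx t z).
Proof.
  intros Ht DF CF Dl. unfold euler.
  replace (l - lU m0 r t (inv_psi t z) * Fx t (inv_psi t z)) with
    (l + (- lU m0 r t (inv_psi t z) / lq r t (inv_psi t z)) * (lq r t (inv_psi t z) * Fx t (inv_psi t z)))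
    by (field; apply Rgt_not_eq, lq_pos).
  apply (chain_rule2 F (fun s x => lq r s x * Fx s x) (fun s => inv_psi s z)); auto.
  - apply cont2_mult; auto. eapply lq_cont2; exact HF.
  - apply inv_psi_dt; auto.
Qed.

Lemma euler_lU_dz t z : is_derive (euler (lU m0 r) t) z (euler (lV m0 r) t z).
Proof. apply (euler_dz' _ (fun t x => lq r t x * lV m0 r t x)); auto. intros x. eapply lU_dx; exact HF. Qed.

Lemma euler_solution u0 : (forall x, lU m0 r 0 x = u0 x) -> CH_solution T u0 (euler (lU m0 r)).
Proof.
  intros H0. assert (HT := flow_T_pos T m0 r HF).
  assert (HCK : forall k, CK k (euler (lU m0 r))) by (intros; apply euler_CK, lU_CK).
  split; [exact HT|]. split; [|split; [|split]].
  - intros x. unfold euler. rewrite H0. f_equal. apply (psi_inj 0). rewrite psi_inv. symmetry. now apply psi_0.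
  - intros t Ht. split.
    + apply euler_periodic. apply lU_periodic with T; auto.
    + intros k x. apply (CK_Derive_n (euler (lU m0 r)) k HCK).
  - intros k t x Ht eps He. destruct (proj1 (CK_Derive_n (euler (lU m0 r)) k HCK) t x (mkposreal _ He)) as [d Hd].
    exists d. split; [apply cond_pos|]. intros s y _ Hs Hy. now apply Hd.
  - intros t Ht.
    assert (Dt : forall x, is_derive (fun s : R => euler (lU m0 r) s x) t
       (- / 4 * (euler (lA T m0 r) t x - euler (lB T m0 r) t x) - euler (lU m0 r) t x * euler (lV m0 r) t x)).
    { intros x. apply (euler_dt (lU m0 r) (lV m0 r)); auto.
      - intros s y. eapply lU_dx; exact HF.
      - eapply lV_cont2; exact HF.
      - apply lU_dt; auto. }
    split. { intros x. eexists. apply Dt. }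
    set (A := euler (lA T m0 r) t). set (B := euler (lB T m0 r) t). set (u := euler (lU m0 r) t). set (v := euler (lV m0 r) t).
    set (ea := euler (la m0 r) t). set (eb := euler (lb m0 r) t).
    assert (DA : forall x : R, is_derive A x (A x - ea x ^ 2)).
    { intros x. apply (euler_dz' (lA T m0 r) (fun t x => lq r t x * lA T m0 r t x - lq r t x * la m0 r t x ^ 2) t x (fun t x => lA T m0 r t x - la m0 r t x ^ 2)).
      - intros y. apply lA_dx; auto.
      - intros y. toR; ring. }
    assert (DB : forall x : R, is_derive B x (- B x + eb x ^ 2)).
    { intros x. apply (euler_dz' (lB T m0 r) (fun t x => - lq r t x * lB T m0 r t x + lq r t x * lb m0 r t x ^ 2) t x (fun t x => - lB T m0 r t x + lb m0 r t x ^ 2)).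
      - intros y. apply lB_dx; auto.
      - intros y. toR; ring. }
    assert (Du : forall x : R, is_derive u x (v x)) by (intros; apply euler_lU_dz).
    assert (Eu : forall x, u x = (ea x + eb x) / 2) by (intros; reflexivity).
    assert (Ev : forall x, v x = (ea x - eb x) / 2) by (intros; reflexivity).
    (* Chosen so that [P' = (A - B) / 4], the quantity found in [lU_dt]: differentiating [A + B]
       leaves [- (ea ^ 2 - eb ^ 2) / 4 = - u v], which the derivative of [u ^ 2 / 2] cancels. One
       more derivative gives [P - P'' = u ^ 2 + v ^ 2 / 2]. *)
    set (P := fun x => / 4 * (A x + B x) + / 2 * (u x * u x)).
    assert (DP : forall x : R, is_derive P x (/ 4 * (A x - B x))).
    { intros x. unfold P.
      replace (/ 4 * (A x - B x)) with (/ 4 * ((A x - ea x ^ 2) + (- B x + eb x ^ 2)) + / 2 * (v x * u x + u x * v x)).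
      2:{ rewrite Eu, Ev. field. }
      apply @is_derive_plus; apply is_derive_scal.
      - apply (is_derive_plus A B); auto.
      - apply (is_derive_mult u u); auto. apply Rmult_comm. }
    exists P. split; [|split].
    + intros x. unfold P, A, B, u.
      rewrite (euler_periodic (lA T m0 r)), (euler_periodic (lB T m0 r)), (euler_periodic (lU m0 r)); auto.
      * apply lU_periodic with T; auto.
      * apply lB_periodic; auto.
      * apply lA_periodic; auto.
    + intros y.
      assert (DP2 : is_derive (Derive P) y (/ 4 * ((A y - ea y ^ 2) - (- B y + eb y ^ 2)))).
      { apply (is_derive_ext (fun x => / 4 * (A x - B x))).
        - intros x. symmetry. now apply is_derive_unique.
        - apply is_derive_scal. apply (is_derive_minus A B); auto. }
      split; [eexists; apply DP|]. split; [eexists; apply DP2|].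
      rewrite (is_derive_unique _ _ _ DP2), (is_derive_unique u y _ (Du y)).
      unfold P. fold u. rewrite Ev, Eu. field.
    + intros y. rewrite (is_derive_unique _ _ _ (Dt y)), (is_derive_unique _ _ _ (DP y)).
      rewrite (is_derive_unique u y _ (Du y)). unfold A, B, u, v. toR; field.
Qed.

End Eulerian.

(** * Uniqueness *)

(** The integrand is at most [C z^2] plus the derivative of the periodic function
    [2 Q Q' + Q z s' - z^2 s / 2], where [s = u + w]; the terms with [z'] cancel. *)
Lemma energy_inequality (u du ddu w dw ddw Q dQ : R -> R) B :
  periodic u -> periodic w -> periodic du -> periodic dw -> periodic Q -> periodic dQ ->
  (forall x : R, is_derive u x (du x)) -> (forall x : R, is_derive du x (ddu x)) ->
  (forall x : R, is_derive w x (dw x)) -> (forall x : R, is_derive dw x (ddw x)) ->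
  (forall x : R, continuous ddu x) -> (forall x : R, continuous ddw x) ->
  (forall x : R, is_derive Q x (dQ x)) ->
  (forall x : R, is_derive dQ x (Q x - ((u x ^ 2 + / 2 * du x ^ 2) - (w x ^ 2 + / 2 * dw x ^ 2)))) ->
  (forall x, Rabs (u x + w x) <= B /\ Rabs (du x + dw x) <= B /\ Rabs (ddu x + ddw x) <= B) ->
  RInt (fun x => 2 * (u x - w x) * (- (u x * du x - w x * dw x) - dQ x)) 0 (2 * PI) <=
  (B / 2 + (2 + B) ^ 2 / 8 + 9 * B ^ 2 / 8) * RInt (fun x => (u x - w x) ^ 2) 0 (2 * PI).
Proof.
  intros Pu Pw Pdu Pdw PQ PdQ Du Ddu Dw Ddw Cu Cw DQ DdQ HB.
  assert (PIpos := PI_RGT_0).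
  set (ddQ := fun x => Q x - ((u x ^ 2 + / 2 * du x ^ 2) - (w x ^ 2 + / 2 * dw x ^ 2))) in *.
  set (Psi := fun x => 2 * (Q x * dQ x) + Q x * ((u x - w x) * (du x + dw x)) - / 2 * ((u x - w x) * ((u x - w x) * (u x + w x)))).
  set (dPsi := fun x => 2 * (dQ x * dQ x + Q x * ddQ x)
     + (dQ x * ((u x - w x) * (du x + dw x)) + Q x * ((du x - dw x) * (du x + dw x) + (u x - w x) * (ddu x + ddw x)))
     - / 2 * ((du x - dw x) * ((u x - w x) * (u x + w x)) + (u x - w x) * ((du x - dw x) * (u x + w x) + (u x - w x) * (du x + dw x)))).
  assert (DP : forall x : R, is_derive Psi x (dPsi x)).
  { intros x. unfold Psi, dPsi.
    der. unfold ddQ. ring. }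
  assert (Cu0 : forall x : R, continuous u x) by (intros; eapply continuous_of_derive; eauto).
  assert (Cdu : forall x : R, continuous du x) by (intros; eapply continuous_of_derive; eauto).
  assert (Cw0 : forall x : R, continuous w x) by (intros; eapply continuous_of_derive; eauto).
  assert (Cdw : forall x : R, continuous dw x) by (intros; eapply continuous_of_derive; eauto).
  assert (CQ : forall x : R, continuous Q x) by (intros; eapply continuous_of_derive; eauto).
  assert (CdQ : forall x : R, continuous dQ x) by (intros; eapply continuous_of_derive; eauto).
  assert (CdP : forall x : R, continuous dPsi x).
  { intros x. unfold dPsi, ddQ. cont. }
  assert (E0 : RInt dPsi 0 (2 * PI) = 0).
  { rewrite (RInt_derive Psi dPsi) by auto. apply Rminus_diag_eq.
    rewrite <- (Rplus_0_l (2 * PI)). unfold Psi. now rewrite Pu, Pw, Pdu, Pdw, PQ, PdQ. }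
  set (C := B / 2 + (2 + B) ^ 2 / 8 + 9 * B ^ 2 / 8).
  assert (Cz : forall x : R, continuous (fun x => C * (u x - w x) ^ 2) x).
  { intros x. cont. }
  assert (ER : C * RInt (fun x => (u x - w x) ^ 2) 0 (2 * PI) = RInt (fun x => C * (u x - w x) ^ 2 + dPsi x) 0 (2 * PI)).
  { rewrite RInt_plus_cont, E0, RInt_scal_cont by (auto; intros; cont). ring. }
  rewrite ER.
  apply RInt_le; [lra| | |].
  - apply ex_RInt_cont. intros x. cont.
  - apply ex_RInt_cont. intros x. apply (continuous_plus (fun x => C * (u x - w x) ^ 2) dPsi); auto.
  - intros x _. destruct (HB x) as [B1 [B2 B3]].
    unfold dPsi, ddQ, C. set (z := u x - w x).
    set (s := u x + w x) in *. set (s1 := du x + dw x) in *. set (s2 := ddu x + ddw x) in *.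
    set (q := Q x). set (q1 := dQ x).
    apply Rabs_le_between in B1. apply Rabs_le_between in B2. apply Rabs_le_between in B3.
    replace (u x ^ 2 + / 2 * du x ^ 2 - (w x ^ 2 + / 2 * dw x ^ 2)) with (z * s + / 2 * ((du x - dw x) * s1)) by (unfold z, s, s1; field).
    replace (u x * du x - w x * dw x) with (/ 2 * ((du x - dw x) * s + z * s1)) by (unfold z, s, s1; field).
    set (z1 := du x - dw x).
    (* The derivative of [2 Q Q'] supplies the squares [2 q ^ 2] and [2 q1 ^ 2] on the larger side;
       completing squares absorbs in them the products of [z] with [q] and [q1]. *)
    assert (A1 : - (2 + s1) * z * q1 - 2 * q1 ^ 2 <= (2 + B) ^ 2 / 8 * z ^ 2).
    { assert (0 <= (q1 + (2 + s1) * z / 4) ^ 2) by apply pow2_ge_0.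
      assert (G : (2 + s1) ^ 2 <= (2 + B) ^ 2) by nra. assert (Z : 0 <= z ^ 2) by apply pow2_ge_0.
      assert (G2 := Rmult_le_compat_r _ _ _ Z G). lra. }
    assert (A2 : q * z * (2 * s - s2) - 2 * q ^ 2 <= 9 * B ^ 2 / 8 * z ^ 2).
    { assert (0 <= (q - (2 * s - s2) * z / 4) ^ 2) by apply pow2_ge_0.
      assert (G : (2 * s - s2) ^ 2 <= 9 * B ^ 2) by nra. assert (Z : 0 <= z ^ 2) by apply pow2_ge_0.
      assert (G2 := Rmult_le_compat_r _ _ _ Z G). lra. }
    assert (A3 : - / 2 * z ^ 2 * s1 <= B / 2 * z ^ 2) by (assert (Z : 0 <= z ^ 2) by apply pow2_ge_0; nra).
    match goal with |- ?L <= ?Rr => assert (E : L - (Rr - (B / 2 + (2 + B) ^ 2 / 8 + 9 * B ^ 2 / 8) * z ^ 2)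
      = (- / 2 * z ^ 2 * s1) + (- (2 + s1) * z * q1 - 2 * q1 ^ 2) + (q * z * (2 * s - s2) - 2 * q ^ 2)) by field end.
    lra.
Qed.

(** The product [E t * exp (- (C * t))] starts at 0 and has a nonpositive derivative, so it cannot
    be positive at [t1]. *)
Lemma gronwall_zero (E dE : R -> R) C t1 : 0 <= t1 -> (forall t : R, continuous E t) ->
  (forall t, 0 < t < t1 -> is_derive E t (dE t) /\ dE t <= C * E t) -> E 0 = 0 -> 0 <= E t1 -> E t1 = 0.
Proof.
  intros Ht CE HE E0 Ep. destruct (Req_dec t1 0) as [->|N]; [exact E0|].
  destruct (MVT_open (fun t => E t * exp (- (C * t))) (fun t => dE t * exp (- (C * t)) + E t * (- C * exp (- (C * t)))) 0 t1) as [c [Hc Eq]].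
  - lra.
  - intros t _. apply (continuous_mult E (fun t => exp (- (C * t)))); auto.
    apply (continuous_exp_opp (fun t => C * t)). cont.
  - intros t Ht'. apply (is_derive_mult E (fun t => exp (- (C * t)))); [now apply HE| |intros; apply Rmult_comm].
    auto_derive; auto; ring.
  - rewrite E0, Rmult_0_l, !Rminus_0_r in Eq.
    assert (Hx := exp_pos (- (C * t1))). assert (Hy := exp_pos (- (C * c))).
    destruct (HE c Hc) as [_ H].
    assert (dE c * exp (- (C * c)) + E c * (- C * exp (- (C * c))) <= 0) by nra.
    assert (E t1 * exp (- (C * t1)) <= 0) by nra. nra.
Qed.

(** The period is centred at [x0]: the primitive from [x0 - PI] is squeezed between 0 and 0 near
    [x0], hence has derivative 0 there, and that derivative is [f x0]. *)
Lemma RInt_zero_nonneg (f : R -> R) : (forall x : R, continuous f x) -> periodic f -> (forall x, 0 <= f x) ->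
  RInt f 0 (2 * PI) = 0 -> forall x, f x = 0.
Proof.
  intros Cf Pf Hf H0 x0. assert (PIpos := PI_RGT_0).
  assert (H : RInt f (x0 - PI) (x0 + PI) = 0).
  { replace (x0 + PI) with (x0 - PI + 2 * PI) by ring. rewrite RInt_periodic_shift; auto. }
  assert (Mono : forall a b, a <= b -> 0 <= RInt f a b).
  { intros a b Hab. apply RInt_ge_0; auto. now apply ex_RInt_cont. }
  assert (D := is_derive_RInt_cont f (x0 - PI) x0 Cf).
  assert (D0 : is_derive (fun z => RInt f (x0 - PI) z) x0 0).
  { apply (is_derive_ext_loc (fun _ => 0)); [|apply @is_derive_const].
    exists (mkposreal _ PIpos). intros z Hz. apply Rabs_lt_between' in Hz. simpl in Hz.
    assert (A1 := Mono (x0 - PI) z ltac:(lra)). assert (A2 := Mono z (x0 + PI) ltac:(lra)).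
    assert (Ch := RInt_Chasles_cont f (x0 - PI) z (x0 + PI) Cf). lra. }
  rewrite <- (is_derive_unique _ _ _ D). now apply is_derive_unique.
Qed.

(** [d_x (1 - d_x^2)^{-1} f]. *)
Definition grad_resolvent (f : R -> R) (x : R) : R :=
  (J (2 * PI) (fun y => y) f x + J (- (2 * PI)) (fun y => - y) f x) / 2.

(** [P + P'] and [P' - P] solve first-order equations with the two opposite phases, so [J_unique]
    determines them. The gradient thereby becomes an explicit functional of [f], jointly continuous
    in time, a property that [CH_solution] does not state for [P]. *)
Lemma resolvent_gradient (P dP f : R -> R) : periodic P -> periodic dP -> (forall x : R, continuous f x) ->
  (forall x : R, is_derive P x (dP x)) -> (forall x : R, is_derive dP x (P x - f x)) ->
  forall x, dP x = grad_resolvent f x.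
Proof.
  intros PP PdP Cf DP DdP x. unfold grad_resolvent.
  rewrite <- (J_unique (2 * PI) (fun y => y) f (fun _ => 1) (fun x => P x + dP x)); auto using exp_2PI_neq.
  rewrite <- (J_unique (- (2 * PI)) (fun y => - y) f (fun _ => - (1)) (fun x => dP x - P x)); auto using exp_n2PI_neq.
  - field.
  - intros y. der.
  - intros y. ring.
  - intros y. now rewrite PP, PdP.
  - intros y. der.
  - intros y. der.
  - intros y. now rewrite PP, PdP.
  - intros y. der.
Qed.

Lemma cont2_grad_resolvent f : cont2 f -> cont2 (fun t x => grad_resolvent (f t) x).
Proof.
  intros Cf. unfold grad_resolvent, Rdiv. apply cont2_mult; [|apply cont2_const]. apply cont2_plus.
  - apply (cont2_J (fun _ => 2 * PI) (fun _ x => x) f); auto using cont2_snd, exp_2PI_neq. intros; apply continuous_const.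
  - apply (cont2_J (fun _ => - (2 * PI)) (fun _ x => - x) f); auto using cont2_snd, cont2_opp, exp_n2PI_neq. intros; apply continuous_const.
Qed.

Section FrozenSolution.
Variables (T t1 : R) (u0 : R -> R) (u : R -> R -> R).
Hypothesis Hu : CH_solution T u0 u.
Hypothesis Ht1 : 0 <= t1 < T.

(** A solution is only given on [[0, T)]; clamping time to the compact interval [[0, t1]] turns its
    derivatives into functions to which [cont2] applies. *)
Definition frozen (k : nat) (t x : R) : R := Derive_n (u (clamp 0 t1 t)) k x.

Lemma frozen_cont2 k : cont2 (frozen k).
Proof.
  destruct Hu as [_ [_ [_ [Hc _]]]]. intros t x eps.
  assert (B := clamp_between 0 t1 t ltac:(lra)).
  destruct (Hc k (clamp 0 t1 t) x ltac:(lra) eps (cond_pos eps)) as [d [Hd H]].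
  exists (mkposreal _ Hd). simpl. intros s y Hs Hy. apply H; auto.
  - assert (B' := clamp_between 0 t1 s ltac:(lra)). lra.
  - eapply Rle_lt_trans; [apply clamp_lipschitz; lra|exact Hs].
Qed.

Lemma frozen_smooth t : periodic (u (clamp 0 t1 t)) /\ smooth (u (clamp 0 t1 t)).
Proof.
  destruct Hu as [_ [_ [HH _]]]. assert (B := clamp_between 0 t1 t ltac:(lra)). apply HH. lra.
Qed.

Lemma frozen_dx k t x : is_derive (frozen k t) x (frozen (S k) t x).
Proof. apply Derive_correct. apply frozen_smooth. Qed.

Lemma frozen_periodic k t : periodic (frozen k t).
Proof.
  induction k as [|k IH]; [apply frozen_smooth|]. eapply derive_periodic; [exact IH|]. intros x. apply frozen_dx.
Qed.

Definition flux (t x : R) : R := frozen 0 t x ^ 2 + / 2 * frozen 1 t x ^ 2.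

Lemma cont2_sq f : cont2 f -> cont2 (fun t x => f t x ^ 2).
Proof. intros H. apply (cont2_ext (fun t x => f t x * f t x)); [intros; ring|]. now apply cont2_mult. Qed.

Lemma flux_cont2 : cont2 flux.
Proof.
  apply cont2_plus; [apply cont2_sq, frozen_cont2|]. apply cont2_mult; [apply cont2_const|apply cont2_sq, frozen_cont2].
Qed.

Lemma frozen_dt t : 0 < t < t1 -> exists P dP, periodic P /\ periodic dP /\
  (forall x : R, is_derive P x (dP x)) /\ (forall x : R, is_derive dP x (P x - flux t x)) /\
  (forall x, dP x = grad_resolvent (flux t) x) /\
  (forall x : R, is_derive (fun s => frozen 0 s x) t (- (frozen 0 t x * frozen 1 t x) - dP x)).
Proof.
  intros Ht. destruct Hu as [_ [_ [_ [_ H]]]]. destruct (H t ltac:(lra)) as [Hd [P [PP [HP Heq]]]].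
  assert (Ec : clamp 0 t1 t = t) by (apply clamp_id; lra).
  assert (DP : forall x : R, is_derive P x (Derive P x)) by (intros; apply Derive_correct, HP).
  assert (Ef : forall x, flux t x = u t x ^ 2 + / 2 * Derive (u t) x ^ 2).
  { intros x. unfold flux, frozen. now rewrite Ec. }
  assert (DdP : forall x : R, is_derive (Derive P) x (P x - flux t x)).
  { intros x. destruct (HP x) as [_ [E2 E3]]. rewrite Ef.
    replace (P x - (u t x ^ 2 + / 2 * Derive (u t) x ^ 2)) with (Derive (Derive P) x) by lra. now apply Derive_correct. }
  assert (PdP : periodic (Derive P)) by (apply (derive_periodic P); auto).
  exists P, (Derive P). do 4 (split; [assumption|]). split.
  - apply (resolvent_gradient P (Derive P) (flux t)); auto. intros x. apply cont2_slice, flux_cont2.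
  - intros x. apply (is_derive_ext_loc (fun s => u s x)).
    + assert (Hp : 0 < Rmin t (t1 - t)) by (apply Rmin_glb_lt; lra).
      exists (mkposreal _ Hp). intros s Hs. apply Rabs_lt_between' in Hs. simpl in Hs.
      assert (Rmin t (t1 - t) <= t) by apply Rmin_l. assert (Rmin t (t1 - t) <= t1 - t) by apply Rmin_r.
      unfold frozen. rewrite clamp_id by lra. reflexivity.
    + replace (- (frozen 0 t x * frozen 1 t x) - Derive P x) with (Derive (fun s => u s x) t).
      * apply Derive_correct. apply Hd.
      * specialize (Heq x). unfold frozen. rewrite Ec. simpl. change (fun x0 : R => u t x0) with (u t). lra.
Qed.

End FrozenSolution.

(** The coefficients of the energy inequality involve the sum [u + w] and two of its derivatives,
    bounded on the compact interval [[0, t1]]; Gronwall applies to the squared [L^2] norm of the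
    difference. *)
Theorem CH_unique T u0 u w t1 : CH_solution T u0 u -> CH_solution T u0 w -> 0 <= t1 < T ->
  forall x, u t1 x = w t1 x.
Proof.
  intros Hu Hw Ht1 x0. assert (PIpos := PI_RGT_0).
  assert (Cu := fun k => frozen_cont2 T t1 u0 u Hu Ht1 k). assert (Cw := fun k => frozen_cont2 T t1 u0 w Hw Ht1 k).
  assert (Pu := fun k => frozen_periodic T t1 u0 u Hu Ht1 k). assert (Pw := fun k => frozen_periodic T t1 u0 w Hw Ht1 k).
  assert (Du := fun k => frozen_dx T t1 u0 u Hu Ht1 k). assert (Dw := fun k => frozen_dx T t1 u0 w Hw Ht1 k).
  set (U := frozen t1 u) in *. set (W := frozen t1 w) in *.
  assert (HB : exists B, forall k t x, (k <= 2)%nat -> 0 <= t <= t1 -> Rabs (U k t x + W k t x) <= B).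
  { assert (HBk : forall k, exists B, 0 < B /\ forall t x, 0 <= t <= t1 -> Rabs (U k t x + W k t x) <= B).
    { intros k. destruct (cont2_bounded (fun t x => U k t x + W k t x) 0 t1 0 (2 * PI) (cont2_plus _ _ (Cu k) (Cw k))) as [B [HB H]].
      exists B. split; [exact HB|]. intros t x Ht. destruct (periodic_reduce x) as [y [Hy E]].
      rewrite (E (U k t) (Pu k t)), (E (W k t) (Pw k t)). now apply H. }
    destruct (HBk 0%nat) as [B0 [P0 H0]], (HBk 1%nat) as [B1 [P1 H1]], (HBk 2%nat) as [B2 [P2 H2]].
    exists (B0 + B1 + B2). intros k t x Hk Ht. specialize (H0 t x Ht). specialize (H1 t x Ht). specialize (H2 t x Ht).
    destruct k as [|[|[|k]]]; try lia; lra. }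
  destruct HB as [B HB].
  set (C := B / 2 + (2 + B) ^ 2 / 8 + 9 * B ^ 2 / 8).
  (* Writing the pressure gradients with [grad_resolvent] makes [G] jointly continuous at all times,
     although the pressures exist only at interior times and are chosen separately at each. *)
  set (G := fun t x => 2 * (U 0%nat t x - W 0%nat t x) * (- (U 0%nat t x * U 1%nat t x - W 0%nat t x * W 1%nat t x)
      - (grad_resolvent (flux t1 u t) x - grad_resolvent (flux t1 w t) x))).
  assert (CG : cont2 G).
  { unfold G. repeat first [apply cont2_grad_resolvent | apply Cu | apply Cw | apply cont2_const | apply cont2_minus | apply cont2_opp | apply cont2_mult].
    - eapply flux_cont2; eauto.
    - eapply flux_cont2; eauto. }
  assert (Cz : cont2 (fun t x => (U 0%nat t x - W 0%nat t x) ^ 2)) by (apply cont2_sq, cont2_minus; auto).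
  assert (E0 : RInt (fun x => (U 0%nat t1 x - W 0%nat t1 x) ^ 2) 0 (2 * PI) = 0).
  { apply (gronwall_zero (fun t => RInt (fun x => (U 0%nat t x - W 0%nat t x) ^ 2) 0 (2 * PI)) (fun t => RInt (G t) 0 (2 * PI)) C t1).
    - lra.
    - intros t. apply (cont2_slice1 (fun t x => RInt (fun x => (U 0%nat t x - W 0%nat t x) ^ 2) 0 x) t (2 * PI)).
      apply (cont2_RInt (fun t x => (U 0%nat t x - W 0%nat t x) ^ 2)). exact Cz.
    - intros t Ht. split.
      + apply (is_derive_RInt_param_loc (fun t x => (U 0%nat t x - W 0%nat t x) ^ 2) G); [|exact CG|intros; now apply (cont2_slice (fun t x => (U 0%nat t x - W 0%nat t x) ^ 2))].
        apply filter_imp with (2 := locally_interior t1 t Ht). intros s Hs x.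
        destruct (frozen_dt T t1 u0 u Hu Ht1 s Hs) as [P [dP [_ [_ [_ [_ [EP HP]]]]]]].
        destruct (frozen_dt T t1 u0 w Hw Ht1 s Hs) as [P' [dP' [_ [_ [_ [_ [EP' HP']]]]]]].
        specialize (HP x). specialize (HP' x). fold U in HP. fold W in HP'.
        apply (is_derive_ext (fun s => (U 0%nat s x - W 0%nat s x) * (U 0%nat s x - W 0%nat s x))); [intros; simpl; toR; ring|].
        unfold G. rewrite <- EP, <- EP'. der.
      + destruct (frozen_dt T t1 u0 u Hu Ht1 t Ht) as [P [dP [PP [PdP [DP [DdP [EP _]]]]]]].
        destruct (frozen_dt T t1 u0 w Hw Ht1 t Ht) as [P' [dP' [PP' [PdP' [DP' [DdP' [EP' _]]]]]]].
        rewrite (RInt_ext_all (G t) (fun x => 2 * (U 0%nat t x - W 0%nat t x) * (- (U 0%nat t x * U 1%nat t x - W 0%nat t x * W 1%nat t x) - (dP x - dP' x)))).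
        2:{ intros x. unfold G. now rewrite EP, EP'. }
        apply (energy_inequality (U 0%nat t) (U 1%nat t) (U 2%nat t) (W 0%nat t) (W 1%nat t) (W 2%nat t) (fun x => P x - P' x) (fun x => dP x - dP' x) B);
          [apply Pu|apply Pw|apply Pu|apply Pw| | |intros; apply Du|intros; apply Du|intros; apply Dw|intros; apply Dw| | | | |].
        * intros x. now rewrite PP, PP'.
        * intros x. now rewrite PdP, PdP'.
        * intros x. apply cont2_slice, Cu.
        * intros x. apply cont2_slice, Cw.
        * intros x. der.
        * intros x. der. unfold flux. fold U W. simpl; toR; ring.
        * intros x. repeat split; apply HB; auto; lra.
    - apply RInt_zero_fun. intros x. unfold U, W, frozen. rewrite !clamp_id by lra. simpl.
      destruct Hu as [_ [-> _]], Hw as [_ [-> _]]. ring.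
    - apply RInt_ge_0; [lra| |].
      + apply ex_RInt_cont. intros y. apply (cont2_slice (fun t x => (U 0%nat t x - W 0%nat t x) ^ 2)). exact Cz.
      + intros y _. apply pow2_ge_0. }
  assert (Z := RInt_zero_nonneg (fun x => (U 0%nat t1 x - W 0%nat t1 x) ^ 2)
    (fun y => cont2_slice _ t1 y Cz) (fun y => ltac:(simpl; now rewrite (Pu 0%nat), (Pw 0%nat))) (fun y => pow2_ge_0 _) E0 x0).
  simpl in Z. unfold U, W, frozen in Z. rewrite !clamp_id in Z by lra. simpl in Z. nra.
Qed.

(** * Test functions and the sawtooth *)

(** The normalized Fejer kernel [(sin (2^i x / 2) / (2^i sin (x / 2)))^2], as a product. *)
Fixpoint fejer (i : nat) (x : R) : R :=
  match i with
  | O => 1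
  | S i => fejer i x * ((1 + cos (2 ^ i * x)) / 2)
  end.

Fixpoint dfejer (i : nat) (x : R) : R :=
  match i with
  | O => 0
  | S i => dfejer i x * ((1 + cos (2 ^ i * x)) / 2) - fejer i x * (2 ^ i * sin (2 ^ i * x) / 2)
  end.

Lemma fejer_deriv i x : is_derive (fejer i) x (dfejer i x).
Proof.
  revert x. induction i as [|i IH]; intros x; simpl.
  - apply @is_derive_const.
  - assert (D : is_derive (fun x => (1 + cos (2 ^ i * x)) / 2) x (- (2 ^ i * sin (2 ^ i * x) / 2))).
    { auto_derive; auto. field. }
    eapply is_derive_eq; [apply (is_derive_mult (fejer i)); [apply IH|exact D|intros; apply Rmult_comm]|].
    unfold plus, mult; simpl. unfold mult; simpl. toR; ring.
Qed.

Lemma fejer_between i x : 0 <= fejer i x <= 1.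
Proof.
  induction i as [|i IH]; simpl; [lra|]. assert (H := COS_bound (2 ^ i * x)).
  split; [apply Rmult_le_pos; lra|]. replace 1 with (1 * 1) by ring. apply Rmult_le_compat; lra.
Qed.

Lemma two_pow_pos i : 0 < 2 ^ i. Proof. apply pow_lt. lra. Qed.

Lemma dfejer_bound i x : Rabs (dfejer i x) <= 2 ^ i.
Proof.
  induction i as [|i IH]; simpl; [rewrite Rabs_R0; lra|].
  assert (P := two_pow_pos i). assert (H := COS_bound (2 ^ i * x)). assert (H' := SIN_bound (2 ^ i * x)). assert (F := fejer_between i x).
  unfold Rminus. eapply Rle_trans; [apply Rabs_triang|]. rewrite Rabs_Ropp, !Rabs_mult.
  assert (Rabs ((1 + cos (2 ^ i * x)) / 2) <= 1) by (apply Rabs_le; lra).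
  assert (Rabs (fejer i x) <= 1) by (apply Rabs_le; lra).
  assert (Rabs (2 ^ i * sin (2 ^ i * x) / 2) <= 2 ^ i).
  { apply Rabs_le. nra. }
  assert (Rabs (dfejer i x) * Rabs ((1 + cos (2 ^ i * x)) / 2) <= 2 ^ i * 1) by (apply Rmult_le_compat; auto using Rabs_pos).
  assert (Rabs (fejer i x) * Rabs (2 ^ i * sin (2 ^ i * x) / 2) <= 1 * 2 ^ i) by (apply Rmult_le_compat; auto using Rabs_pos).
  lra.
Qed.

Lemma fejer_sin i x : fejer i x * (2 ^ i * sin (x / 2)) ^ 2 = sin (2 ^ i * x / 2) ^ 2.
Proof.
  induction i as [|i IH]; cbn [fejer pow].
  - rewrite !Rmult_1_l. reflexivity.
  - set (th := 2 ^ i * x / 2) in *.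
    replace (2 * 2 ^ i * x / 2) with (2 * th) by (unfold th; field). replace (2 ^ i * x) with (2 * th) by (unfold th; field).
    rewrite sin_2a, cos_2a_cos.
    transitivity (4 * cos th ^ 2 * (fejer i x * (2 ^ i * sin (x / 2)) ^ 2)); [field|rewrite IH; ring].
Qed.

Lemma sin_lower y : 0 <= y <= 2 * PI / 3 -> y / 4 <= sin y.
Proof.
  intros Hy. assert (PIpos := PI_RGT_0).
  assert (Hc : forall z, 0 <= z <= PI / 3 -> / 2 <= cos z).
  { intros z Hz. replace (/ 2) with (cos (PI / 3)) by (rewrite cos_PI3; lra). apply cos_decr_1; lra. }
  assert (H1 : y / 4 <= sin (y / 2)).
  { destruct (MVT_gen sin 0 (y / 2) cos) as [c [Hc' E]].
    - intros; apply is_derive_sin.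
    - intros. apply continuity_sin.
    - rewrite Rmin_left, Rmax_right in Hc' by lra. rewrite sin_0 in E.
      assert (G := Hc c ltac:(lra)). nra. }
  replace y with (2 * (y / 2)) at 2 by field. rewrite sin_2a.
  assert (G := Hc (y / 2) ltac:(lra)). nra.
Qed.

Lemma sin_half_lower x : Rabs x <= 4 * PI / 3 -> x ^ 2 / 64 <= sin (x / 2) ^ 2.
Proof.
  intros H. assert (A : Rabs x / 8 <= Rabs (sin (x / 2))).
  { apply Rabs_le_between in H. unfold Rabs at 1. destruct Rcase_abs as [N|N].
    - rewrite <- Rabs_Ropp, <- sin_neg. assert (G := sin_lower (- (x / 2)) ltac:(lra)).
      eapply Rle_trans; [|apply Rle_abs]. lra.
    - assert (G := sin_lower (x / 2) ltac:(lra)). eapply Rle_trans; [|apply Rle_abs]. lra. }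
  rewrite <- (pow2_abs x), <- (pow2_abs (sin (x / 2))). assert (P := Rabs_pos x). nra.
Qed.

(** The constant is [1 + 64], from [fejer <= 1] and [sin_half_lower]. The range [4 * PI / 3], larger
    than half a period, leaves room for points displaced by the flow. *)
Lemma fejer_decay i x : Rabs x <= 4 * PI / 3 -> fejer i x * (1 + (2 ^ i * x) ^ 2) <= 65.
Proof.
  intros H. assert (F := fejer_between i x). assert (E := fejer_sin i x). assert (L := sin_half_lower x H).
  assert (S := SIN_bound (2 ^ i * x / 2)). assert (P := two_pow_pos i).
  assert (G : fejer i x * (2 ^ i) ^ 2 * (x ^ 2 / 64) <= fejer i x * (2 ^ i) ^ 2 * sin (x / 2) ^ 2).
  { apply Rmult_le_compat_l; auto. apply Rmult_le_pos; [lra|apply pow2_ge_0]. }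
  assert (sin (2 ^ i * x / 2) ^ 2 <= 1) by nra.
  replace (fejer i x * (1 + (2 ^ i * x) ^ 2)) with (fejer i x + 64 * (fejer i x * (2 ^ i) ^ 2 * (x ^ 2 / 64))) by field.
  replace (fejer i x * (2 ^ i * sin (x / 2)) ^ 2) with (fejer i x * (2 ^ i) ^ 2 * sin (x / 2) ^ 2) in E by ring. lra.
Qed.

(** Test functions with frequencies in [[87 * 2^i, 93 * 2^i]], where the multiplier of the block [i + 6]
    equals 1, concentrated at distance [2^{-i}] from the origin. *)
Definition theta (i : nat) (x : R) : R := 2 ^ i * (sin (90 * 2 ^ i * x) * fejer i x ^ 3).
Definition dtheta (i : nat) (x : R) : R :=
  2 ^ i * (90 * 2 ^ i * cos (90 * 2 ^ i * x) * fejer i x ^ 3 + sin (90 * 2 ^ i * x) * (3 * fejer i x ^ 2 * dfejer i x)).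
(** A Cauchy kernel at scale [2^(-i)]: its mass is at most [PI] for every [i], so pointwise bounds
    by [mu] integrate to bounds independent of [i]. *)
Definition mu (i : nat) (x : R) : R := 2 ^ i / (1 + (2 ^ i * x) ^ 2).

Lemma theta_deriv i x : is_derive (theta i) x (dtheta i x).
Proof.
  unfold theta, dtheta. apply is_derive_scal.
  assert (D := fejer_deriv i x).
  assert (D3 : is_derive (fun x => fejer i x ^ 3) x (3 * fejer i x ^ 2 * dfejer i x)).
  { apply (is_derive_ext (fun x => fejer i x * (fejer i x * fejer i x))); [intros; simpl; ring|]. der. }
  assert (Ds : is_derive (fun x => sin (90 * 2 ^ i * x)) x (90 * 2 ^ i * cos (90 * 2 ^ i * x))).
  { auto_derive; auto. ring. }
  eapply is_derive_eq; [apply (is_derive_mult (fun x => sin (90 * 2 ^ i * x)) (fun x => fejer i x ^ 3)); [exact Ds|exact D3|intros; apply Rmult_comm]|].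
  unfold plus, mult; simpl. unfold mult; simpl. toR; ring.
Qed.

Lemma theta_cont i x : continuous (theta i) x.
Proof. eapply continuous_of_derive, theta_deriv. Qed.

Lemma dfejer_deriv i x : ex_derive (dfejer i) x.
Proof.
  revert x. induction i as [|i IH]; intros x; simpl; [apply ex_derive_const|].
  assert (F : ex_derive (fejer i) x) by (eexists; apply fejer_deriv).
  auto_derive. repeat split; auto.
Qed.

Lemma dtheta_cont i x : continuous (dtheta i) x.
Proof.
  apply (ex_derive_continuous (dtheta i)). unfold dtheta.
  assert (F : ex_derive (fejer i) x) by (eexists; apply fejer_deriv). assert (F' := dfejer_deriv i x).
  auto_derive. repeat split; auto.
Qed.

Lemma mu_pos i x : 0 < mu i x.
Proof. unfold mu. apply Rdiv_lt_0_compat. apply two_pow_pos. assert (0 <= (2 ^ i * x) ^ 2) by apply pow2_ge_0. lra. Qed.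

Lemma mu_cont i x : continuous (mu i) x.
Proof.
  apply (ex_derive_continuous (mu i)). unfold mu. auto_derive. assert (0 <= (2 ^ i * x) ^ 2) by apply pow2_ge_0. nra.
Qed.

Lemma mu_integral i : RInt (mu i) (- PI) PI <= PI.
Proof.
  rewrite (RInt_derive (fun x => atan (2 ^ i * x)) (mu i)).
  - assert (H1 := atan_bound (2 ^ i * PI)). assert (H2 := atan_bound (2 ^ i * - PI)). lra.
  - intros x. unfold mu. auto_derive; auto. unfold Rsqr. field. assert (0 <= (2 ^ i * x) ^ 2) by apply pow2_ge_0. nra.
  - intros x. apply mu_cont.
Qed.

Lemma mu_half i x y : Rabs x <= 2 * Rabs y -> mu i y <= 4 * mu i x.
Proof.
  intros H. unfold mu. assert (P := two_pow_pos i).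
  assert (X : 0 <= (2 ^ i * x) ^ 2) by apply pow2_ge_0. assert (Y : 0 <= (2 ^ i * y) ^ 2) by apply pow2_ge_0.
  assert (G : x ^ 2 <= 4 * y ^ 2). { rewrite <- (pow2_abs x), <- (pow2_abs y). assert (Hx := Rabs_pos x). nra. }
  assert (G2 : (2 ^ i * x) ^ 2 <= 4 * (2 ^ i * y) ^ 2).
  { rewrite !Rpow_mult_distr. assert (0 <= (2 ^ i) ^ 2) by apply pow2_ge_0. nra. }
  apply Rmult_le_reg_r with ((1 + (2 ^ i * y) ^ 2) * (1 + (2 ^ i * x) ^ 2)); [nra|].
  unfold Rdiv. field_simplify; nra.
Qed.

(** [93 = 90 + 3] comes from differentiating the carrier sine and the cube, [65 ^ 2] from two
    factors of [fejer_decay]. *)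
Definition Kth : R := 93 * 65 ^ 2.

(** The cube is what makes these bounds easy: after one differentiation a factor [fejer ^ 2]
    remains, so the crude [dfejer_bound] is enough. With [Y = 1 + (2 ^ i * x) ^ 2], this factor is
    at most [65 ^ 2 / Y ^ 2], and the extra weight [2 ^ i * Rabs x] costs only one [Y]. *)
Lemma theta_bounds i x : Rabs x <= 4 * PI / 3 ->
  Rabs (theta i x) <= Kth * mu i x /\ 2 ^ i * (Rabs x * Rabs (theta i x)) <= Kth * mu i x /\
  Rabs x * Rabs (dtheta i x) <= Kth * mu i x /\ Rabs (dtheta i x) <= Kth * (2 ^ i * mu i x).
Proof.
  intros H. assert (F := fejer_between i x). assert (D := fejer_decay i x H). assert (P := two_pow_pos i).
  set (W := fejer i x) in *. set (Y := 1 + (2 ^ i * x) ^ 2) in *.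
  assert (HY : 1 <= Y) by (unfold Y; assert (0 <= (2 ^ i * x) ^ 2) by apply pow2_ge_0; lra).
  assert (HW : W <= 65 / Y). { apply Rmult_le_reg_r with Y; [lra|]. unfold Rdiv. rewrite Rmult_assoc, Rinv_l; lra. }
  assert (HW2 : W ^ 2 <= 65 ^ 2 / (Y * Y)).
  { replace (65 ^ 2 / (Y * Y)) with ((65 / Y) * (65 / Y)) by (field; lra). simpl. rewrite Rmult_1_r. apply Rmult_le_compat; lra. }
  assert (W2pos : 0 <= W ^ 2) by apply pow2_ge_0.
  assert (HxY : 2 ^ i * Rabs x <= Y).
  { replace (2 ^ i * Rabs x) with (Rabs (2 ^ i * x)) by (rewrite Rabs_mult, (Rabs_pos_eq (2 ^ i)); lra).
    unfold Y. rewrite <- (pow2_abs (2 ^ i * x)). assert (Q := Rabs_pos (2 ^ i * x)). nra. }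
  assert (Hmu : mu i x = 2 ^ i / Y) by reflexivity.
  assert (S := SIN_bound (90 * 2 ^ i * x)). assert (C := COS_bound (90 * 2 ^ i * x)).
  assert (B3 : W ^ 3 <= W ^ 2) by (replace (W ^ 3) with (W ^ 2 * W) by ring; nra).
  assert (B3' : 0 <= W ^ 3) by (apply pow_le; lra).
  assert (T1 : Rabs (theta i x) <= 2 ^ i * W ^ 2).
  { unfold theta. rewrite Rabs_mult, (Rabs_pos_eq (2 ^ i)) by lra. apply Rmult_le_compat_l; [lra|].
    rewrite Rabs_mult. fold W. rewrite (Rabs_pos_eq (W ^ 3)) by lra.
    assert (Rabs (sin (90 * 2 ^ i * x)) <= 1) by (apply Rabs_le; lra). assert (Q := Rabs_pos (sin (90 * 2 ^ i * x))). nra. }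
  assert (T2 : Rabs (dtheta i x) <= 93 * 2 ^ i * (2 ^ i * W ^ 2)).
  { unfold dtheta. fold W. rewrite Rabs_mult, (Rabs_pos_eq (2 ^ i)) by lra.
    replace (93 * 2 ^ i * (2 ^ i * W ^ 2)) with (2 ^ i * (90 * 2 ^ i * 1 * W ^ 2 + 1 * (3 * W ^ 2 * 2 ^ i))) by ring.
    apply Rmult_le_compat_l; [lra|]. eapply Rle_trans; [apply Rabs_triang|]. apply Rplus_le_compat.
    - rewrite !Rabs_mult, (Rabs_pos_eq 90), (Rabs_pos_eq (2 ^ i)), (Rabs_pos_eq (W ^ 3)) by lra.
      assert (Rabs (cos (90 * 2 ^ i * x)) <= 1) by (apply Rabs_le; lra).
      apply Rmult_le_compat; try lra. apply Rmult_le_pos; [lra|apply Rabs_pos]. apply Rmult_le_compat_l; lra.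
    - rewrite !Rabs_mult, (Rabs_pos_eq 3), (Rabs_pos_eq (W ^ 2)) by lra.
      assert (Rabs (sin (90 * 2 ^ i * x)) <= 1) by (apply Rabs_le; lra).
      apply Rmult_le_compat; try apply Rabs_pos; try lra. apply Rmult_le_pos; [lra|apply Rabs_pos].
      apply Rmult_le_compat_l; [lra|apply dfejer_bound]. }
  assert (I1 : 2 ^ i * (65 ^ 2 / (Y * Y)) <= 65 ^ 2 * mu i x).
  { rewrite Hmu. replace (65 ^ 2 * (2 ^ i / Y)) with (2 ^ i * (65 ^ 2 / Y)) by (field; lra).
    apply Rmult_le_compat_l; [lra|]. apply Rmult_le_compat_l; [lra|]. apply Rinv_le_contravar; nra. }
  assert (I2 : 2 ^ i * W ^ 2 <= 65 ^ 2 * mu i x).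
  { eapply Rle_trans; [|exact I1]. apply Rmult_le_compat_l; lra. }
  assert (I3 : 2 ^ i * Rabs x * (2 ^ i * W ^ 2) <= 65 ^ 2 * mu i x).
  { apply Rle_trans with (Y * (2 ^ i * (65 ^ 2 / (Y * Y)))).
    - apply Rmult_le_compat; auto. apply Rmult_le_pos; [lra|apply Rabs_pos]. apply Rmult_le_pos; lra.
      apply Rmult_le_compat_l; lra.
    - right. rewrite Hmu. field. lra. }
  assert (M := mu_pos i x). assert (Qx := Rabs_pos x).
  unfold Kth. repeat split.
  - lra.
  - apply Rle_trans with (2 ^ i * Rabs x * (2 ^ i * W ^ 2)); [|lra]. rewrite <- Rmult_assoc. apply Rmult_le_compat_l; [nra|exact T1].
  - apply Rle_trans with (Rabs x * (93 * 2 ^ i * (2 ^ i * W ^ 2))); [apply Rmult_le_compat_l; auto|]. lra.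
  - apply Rle_trans with (93 * 2 ^ i * (65 ^ 2 * mu i x)); [|lra]. eapply Rle_trans; [exact T2|]. apply Rmult_le_compat_l; lra.
Qed.

(** Bounds without decay, valid on the whole line; they are used where the loss [4 ^ i] is
    compensated by a factor [1 / L]. *)
Lemma theta_crude i x : Rabs (theta i x) <= 2 ^ i /\ Rabs (dtheta i x) <= 93 * 4 ^ i.
Proof.
  assert (F := fejer_between i x). assert (P := two_pow_pos i). set (W := fejer i x) in *.
  assert (S := SIN_bound (90 * 2 ^ i * x)). assert (C := COS_bound (90 * 2 ^ i * x)).
  assert (HS : Rabs (sin (90 * 2 ^ i * x)) <= 1) by (apply Rabs_le; lra). assert (HC : Rabs (cos (90 * 2 ^ i * x)) <= 1) by (apply Rabs_le; lra).
  assert (W2 : 0 <= W ^ 2 <= 1) by (simpl; rewrite Rmult_1_r; nra).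
  assert (W3 : 0 <= W ^ 3 <= 1) by (replace (W ^ 3) with (W ^ 2 * W) by ring; nra).
  split.
  - unfold theta. fold W. rewrite !Rabs_mult, (Rabs_pos_eq (2 ^ i)), (Rabs_pos_eq (W ^ 3)) by lra.
    assert (Q := Rabs_pos (sin (90 * 2 ^ i * x))). apply Rle_trans with (2 ^ i * 1); [apply Rmult_le_compat_l; nra|lra].
  - unfold dtheta. fold W. rewrite Rabs_mult, (Rabs_pos_eq (2 ^ i)) by lra.
    replace (93 * 4 ^ i) with (2 ^ i * (90 * 2 ^ i * 1 * 1 + 1 * (3 * 1 * 2 ^ i))).
    2:{ replace 4 with (2 * 2) by ring. rewrite Rpow_mult_distr. ring. }
    apply Rmult_le_compat_l; [lra|]. eapply Rle_trans; [apply Rabs_triang|]. apply Rplus_le_compat.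
    + rewrite !Rabs_mult, (Rabs_pos_eq 90), (Rabs_pos_eq (2 ^ i)), (Rabs_pos_eq (W ^ 3)) by lra.
      apply Rmult_le_compat; try lra. apply Rmult_le_pos; [lra|apply Rabs_pos]. apply Rmult_le_compat_l; lra.
    + rewrite !Rabs_mult, (Rabs_pos_eq 3), (Rabs_pos_eq (W ^ 2)) by lra.
      apply Rmult_le_compat; try apply Rabs_pos; try lra. apply Rmult_le_pos; [lra|apply Rabs_pos].
      apply Rmult_le_compat; try apply Rabs_pos; try lra. apply dfejer_bound.
Qed.

Definition isint (a : R) : Prop := exists z : Z, a = IZR z.

Lemma isint_INR n : isint (INR n). Proof. exists (Z.of_nat n). apply INR_IZR_INZ. Qed.
Lemma isint_plus a b : isint a -> isint b -> isint (a + b).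
Proof. intros [z ->] [z' ->]. exists (z + z')%Z. now rewrite plus_IZR. Qed.
Lemma isint_minus a b : isint a -> isint b -> isint (a - b).
Proof. intros [z ->] [z' ->]. exists (z - z')%Z. now rewrite minus_IZR. Qed.

Lemma sin_isint a : isint a -> sin (a * (2 * PI)) = 0.
Proof. intros [z ->]. apply sin_eq_0_1. exists (z * 2)%Z. rewrite mult_IZR. ring. Qed.

Lemma cos_isint a : isint a -> cos (a * (2 * PI)) = 1.
Proof.
  intros [z ->]. replace (IZR z * (2 * PI)) with (2 * (IZR z * PI)) by ring. rewrite cos_2a_sin.
  rewrite sin_eq_0_1; [ring|]. now exists z.
Qed.

Lemma cos_cont a x : continuous (fun x => cos (a * x)) x.
Proof. apply (ex_derive_continuous (fun x => cos (a * x))). auto_derive; auto. Qed.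
Lemma sin_cont a x : continuous (fun x => sin (a * x)) x.
Proof. apply (ex_derive_continuous (fun x => sin (a * x))). auto_derive; auto. Qed.

Lemma cos_isint_periodic a : isint a -> periodic (fun x => cos (a * x)).
Proof. intros H x. rewrite Rmult_plus_distr_l, cos_plus, sin_isint, cos_isint by auto. ring. Qed.
Lemma sin_isint_periodic a : isint a -> periodic (fun x => sin (a * x)).
Proof. intros H x. rewrite Rmult_plus_distr_l, sin_plus, sin_isint, cos_isint by auto. ring. Qed.

Lemma int_cos a : isint a -> RInt (fun x => cos (a * x)) 0 (2 * PI) = if Req_EM_T a 0 then 2 * PI else 0.
Proof.
  intros H. destruct (Req_EM_T a 0) as [->|N].
  - rewrite (RInt_ext_all _ (fun _ => 1)), RInt_const_R; [toR; ring|]. intros x. now rewrite Rmult_0_l, cos_0.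
  - rewrite (RInt_derive (fun x => sin (a * x) / a)).
    + rewrite sin_isint, Rmult_0_r, sin_0 by auto. toR; field. exact N.
    + intros x. auto_derive; auto. field. exact N.
    + intros x. apply cos_cont.
Qed.

Lemma int_sin a : isint a -> RInt (fun x => sin (a * x)) 0 (2 * PI) = 0.
Proof.
  intros H. destruct (Req_EM_T a 0) as [->|N].
  - apply RInt_zero_fun. intros x. now rewrite Rmult_0_l, sin_0.
  - rewrite (RInt_derive (fun x => - cos (a * x) / a)).
    + rewrite cos_isint, Rmult_0_r, cos_0 by auto. toR; field. exact N.
    + intros x. auto_derive; auto. field. exact N.
    + intros x. apply sin_cont.
Qed.

Lemma cos_cos a b : cos a * cos b = / 2 * cos (a + b) + / 2 * cos (a - b).
Proof. rewrite cos_plus, cos_minus. field. Qed.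
Lemma sin_sin a b : sin a * sin b = / 2 * cos (a - b) - / 2 * cos (a + b).
Proof. rewrite cos_plus, cos_minus. field. Qed.
Lemma sin_cos a b : sin a * cos b = / 2 * sin (a + b) + / 2 * sin (a - b).
Proof. rewrite sin_plus, sin_minus. field. Qed.

Definition delta (a b : R) : R := if Req_EM_T a b then 1 else 0.

Lemma int_cos_delta a b : isint a -> isint b -> RInt (fun x => cos ((a - b) * x)) 0 (2 * PI) = 2 * PI * delta a b.
Proof.
  intros Ha Hb. rewrite int_cos by now apply isint_minus. unfold delta. destruct (Req_EM_T (a - b) 0), (Req_EM_T a b); try lra.
Qed.

Lemma int_cos_delta_opp a b : isint a -> isint b -> RInt (fun x => cos ((a + b) * x)) 0 (2 * PI) = 2 * PI * delta a (- b).
Proof.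
  intros Ha Hb. rewrite int_cos by now apply isint_plus. unfold delta. destruct (Req_EM_T (a + b) 0), (Req_EM_T a (- b)); try lra.
Qed.

Lemma int_cos_cos a b : isint a -> isint b ->
  RInt (fun x => cos (a * x) * cos (b * x)) 0 (2 * PI) = PI * (delta a b + delta a (- b)).
Proof.
  intros Ha Hb. rewrite (RInt_ext_all _ (fun x => / 2 * cos ((a + b) * x) + / 2 * cos ((a - b) * x))).
  - rewrite RInt_plus_cont, !RInt_scal_cont, int_cos_delta, int_cos_delta_opp
      by (auto; intros; cont; apply cos_cont). toR; field.
  - intros x. rewrite cos_cos. toR. do 2 f_equal; [f_equal; ring|]. f_equal. ring.
Qed.

Lemma int_sin_sin a b : isint a -> isint b ->
  RInt (fun x => sin (a * x) * sin (b * x)) 0 (2 * PI) = PI * (delta a b - delta a (- b)).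
Proof.
  intros Ha Hb. rewrite (RInt_ext_all _ (fun x => / 2 * cos ((a - b) * x) - / 2 * cos ((a + b) * x))).
  - rewrite RInt_minus_cont, !RInt_scal_cont, int_cos_delta, int_cos_delta_opp
      by (auto; intros; cont; apply cos_cont). toR; field.
  - intros x. rewrite sin_sin. toR. rewrite Rmult_minus_distr_r, Rmult_plus_distr_r. reflexivity.
Qed.

Lemma int_sin_cos a b : isint a -> isint b -> RInt (fun x => sin (a * x) * cos (b * x)) 0 (2 * PI) = 0.
Proof.
  intros Ha Hb. rewrite (RInt_ext_all _ (fun x => / 2 * sin ((a + b) * x) + / 2 * sin ((a - b) * x))).
  - rewrite RInt_plus_cont, !RInt_scal_cont, !int_sin
      by (auto using isint_plus, isint_minus; intros; cont; apply sin_cont). toR; ring.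
  - intros x. rewrite sin_cos. toR. rewrite Rmult_minus_distr_r, Rmult_plus_distr_r. reflexivity.
Qed.

(** * Trigonometric polynomials with spectrum in a window *)

(** An inductive predicate instead of a list of coefficients: a linear identity, such as the action
    of a block, is checked on single modes and extended by induction on the predicate. *)
Inductive trig (lo hi : nat) : (R -> R) -> Prop :=
| trig_cos k : (lo <= k <= hi)%nat -> trig lo hi (fun x => cos (INR k * x))
| trig_sin k : (lo <= k <= hi)%nat -> trig lo hi (fun x => sin (INR k * x))
| trig_plus f g : trig lo hi f -> trig lo hi g -> trig lo hi (fun x => f x + g x)
| trig_scal c f : trig lo hi f -> trig lo hi (fun x => c * f x)
| trig_ext f g : (forall x, f x = g x) -> trig lo hi f -> trig lo hi g.

Lemma trig_mono lo hi lo' hi' f : (lo' <= lo)%nat -> (hi <= hi')%nat -> trig lo hi f -> trig lo' hi' f.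
Proof.
  intros H1 H2 H. induction H as [k Hk|k Hk|f g _ IHf _ IHg|c f _ IH|f g E _ IH].
  - apply trig_cos. lia.
  - apply trig_sin. lia.
  - now apply trig_plus.
  - now apply trig_scal.
  - now apply trig_ext with f.
Qed.

Lemma trig_derive lo hi f : trig lo hi f -> exists g, trig lo hi g /\ forall x : R, is_derive f x (g x).
Proof.
  intros H. induction H as [k Hk|k Hk|f g _ [f' [Tf Df]] _ [g' [Tg Dg]]|c f _ [f' [Tf Df]]|f g E _ [f' [Tf Df]]].
  - exists (fun x => - INR k * sin (INR k * x)). split; [apply trig_scal; now apply trig_sin|].
    intros x. auto_derive; auto. ring.
  - exists (fun x => INR k * cos (INR k * x)). split; [apply trig_scal; now apply trig_cos|].
    intros x. auto_derive; auto. ring.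
  - exists (fun x => f' x + g' x). split; [now apply trig_plus|]. intros x. now apply (is_derive_plus f g).
  - exists (fun x => c * f' x). split; [now apply trig_scal|]. intros x. now apply is_derive_scal.
  - exists f'. split; [exact Tf|]. intros x. now apply is_derive_ext with f.
Qed.

Lemma trig_smooth lo hi f : trig lo hi f -> smooth f.
Proof.
  intros H k. revert f H. induction k as [|k IH]; intros f H x.
  - destruct (trig_derive _ _ _ H) as [g [_ D]]. exists (g x). apply D.
  - destruct (trig_derive _ _ _ H) as [g [Tg D]]. apply ex_derive_ext with (2 := IH g Tg x).
    intros y. rewrite <- Derive_n_Derive. apply Derive_n_ext. intros z. symmetry. apply is_derive_unique, D.
Qed.

Lemma trig_cont lo hi f x : trig lo hi f -> continuous f x.
Proof. intros H. destruct (trig_derive _ _ _ H) as [g [_ D]]. eapply continuous_of_derive, D. Qed.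

Lemma trig_periodic lo hi f : trig lo hi f -> periodic f.
Proof.
  intros H. induction H as [k Hk|k Hk|f g _ IHf _ IHg|c f _ IH|f g E _ IH]; intros x.
  - apply cos_isint_periodic, isint_INR.
  - apply sin_isint_periodic, isint_INR.
  - now rewrite IHf, IHg.
  - now rewrite IH.
  - now rewrite <- !E.
Qed.

Lemma trig_shift lo hi f z : trig lo hi f -> trig lo hi (fun x => f (x - z)).
Proof.
  intros H. induction H as [k Hk|k Hk|f g _ IHf _ IHg|c f _ IH|f g E _ IH].
  - apply trig_ext with (fun x => cos (INR k * z) * cos (INR k * x) + sin (INR k * z) * sin (INR k * x)).
    + intros x. rewrite Rmult_minus_distr_l, cos_minus. ring.
    + apply trig_plus; apply trig_scal; [now apply trig_cos|now apply trig_sin].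
  - apply trig_ext with (fun x => cos (INR k * z) * sin (INR k * x) + (- sin (INR k * z)) * cos (INR k * x)).
    + intros x. rewrite Rmult_minus_distr_l, sin_minus. ring.
    + apply trig_plus; apply trig_scal; [now apply trig_sin|now apply trig_cos].
  - now apply (trig_plus _ _ (fun x => f (x - z)) (fun x => g (x - z))).
  - now apply (trig_scal _ _ c (fun x => f (x - z))).
  - apply trig_ext with (fun x => f (x - z)); auto.
Qed.

Lemma trig_sin_mul lo hi L f : trig lo hi f -> (hi <= L)%nat -> trig (L - hi) (L + hi) (fun x => sin (INR L * x) * f x).
Proof.
  intros H HL. induction H as [k Hk|k Hk|f g _ IHf _ IHg|c f _ IH|f g E _ IH].
  - apply trig_ext with (fun x => / 2 * sin (INR (L + k) * x) + / 2 * sin (INR (L - k) * x)).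
    + intros x. rewrite plus_INR, minus_INR, sin_cos, Rmult_plus_distr_r, Rmult_minus_distr_r by lia. reflexivity.
    + apply trig_plus; apply trig_scal; apply trig_sin; lia.
  - apply trig_ext with (fun x => / 2 * cos (INR (L - k) * x) + (- / 2) * cos (INR (L + k) * x)).
    + intros x. rewrite plus_INR, minus_INR, sin_sin, Rmult_plus_distr_r, Rmult_minus_distr_r by lia. ring.
    + apply trig_plus; apply trig_scal; apply trig_cos; lia.
  - eapply trig_ext; [|exact (trig_plus _ _ _ _ IHf IHg)]. intros x. simpl. ring.
  - eapply trig_ext; [|exact (trig_scal _ _ c _ IH)]. intros x. simpl. ring.
  - eapply trig_ext; [|exact IH]. intros x. simpl. now rewrite E.
Qed.

Lemma trig_mean lo hi f : trig lo hi f -> (1 <= lo)%nat -> RInt f 0 (2 * PI) = 0.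
Proof.
  intros H Hlo. induction H as [k Hk|k Hk|f g Tf IHf Tg IHg|c f Tf IH|f g E _ IH].
  - rewrite int_cos by apply isint_INR. destruct Req_EM_T as [E|N]; [|reflexivity].
    assert (0 < INR k) by (apply lt_0_INR; lia). lra.
  - apply int_sin, isint_INR.
  - rewrite RInt_plus_cont, IHf, IHg; [toR; ring| |]; intros x; eapply trig_cont; eauto.
  - rewrite RInt_scal_cont, IH; [toR; ring|]; intros x; eapply trig_cont; eauto.
  - transitivity (RInt f 0 (2 * PI)); [|exact IH]. apply RInt_ext_all. intros x. symmetry. apply E.
Qed.

(** Averages of cosines of degree at most [d]: positivity of the coefficients makes lower bounds
    on linear functionals inductive. *)
Inductive hull (d : nat) : (R -> R) -> Prop :=
| hull_cos k : (k <= d)%nat -> hull d (fun x => cos (INR k * x))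
| hull_mix f g : hull d f -> hull d g -> hull d (fun x => (f x + g x) / 2)
| hull_ext f g : (forall x, f x = g x) -> hull d f -> hull d g.

Lemma hull_mono d d' f : (d <= d')%nat -> hull d f -> hull d' f.
Proof.
  intros H1 H. induction H as [k Hk|f g _ IHf _ IHg|f g E _ IH].
  - apply hull_cos. lia.
  - now apply hull_mix.
  - now apply hull_ext with f.
Qed.

Lemma hull_trig d f : hull d f -> trig 0 d f.
Proof.
  intros H. induction H as [k Hk|f g _ IHf _ IHg|f g E _ IH].
  - apply trig_cos. lia.
  - apply trig_ext with (fun x => / 2 * (f x + g x)); [intros; field|]. apply trig_scal. now apply trig_plus.
  - now apply trig_ext with f.
Qed.

Lemma hull_mul d1 d2 f g : hull d1 f -> hull d2 g -> hull (d1 + d2) (fun x => f x * g x).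
Proof.
  intros Hf Hg. induction Hf as [k Hk|f f' _ IHf _ IHf'|f f' E _ IH].
  - induction Hg as [m Hm|g g' _ IHg _ IHg'|g g' E _ IH].
    + assert (exists p, (p <= d1 + d2)%nat /\ forall x, cos (INR k * x - INR m * x) = cos (INR p * x)) as [p [Hp Ep]].
      { destruct (Nat.le_ge_cases k m).
        - exists (m - k)%nat. split; [lia|]. intros x. rewrite minus_INR, <- cos_neg by lia. f_equal. ring.
        - exists (k - m)%nat. split; [lia|]. intros x. rewrite minus_INR by lia. f_equal. ring. }
      apply hull_ext with (fun x => (cos (INR (k + m) * x) + cos (INR p * x)) / 2).
      * intros x. rewrite cos_cos, Ep, plus_INR, Rmult_plus_distr_r. field.
      * apply hull_mix; apply hull_cos; lia.
    + eapply hull_ext; [|exact (hull_mix _ _ _ IHg IHg')]. intros x. simpl. field.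
    + eapply hull_ext; [|exact IH]. intros x. simpl. now rewrite E.
  - eapply hull_ext; [|exact (hull_mix _ _ _ IHf IHf')]. intros x. simpl. field.
  - eapply hull_ext; [|exact IH]. intros x. simpl. now rewrite E.
Qed.

Lemma INR_pow2 i : INR (2 ^ i) = 2 ^ i.
Proof. rewrite pow_INR. reflexivity. Qed.

Lemma fejer_hull i : hull (2 ^ i) (fejer i).
Proof.
  induction i as [|i IH].
  - apply hull_ext with (fun x => cos (INR 0 * x)); [intros x; simpl; now rewrite Rmult_0_l, cos_0|]. apply hull_cos. lia.
  - apply hull_ext with (fun x => (fejer i x + fejer i x * cos (INR (2 ^ i) * x)) / 2).
    + intros x. simpl. rewrite INR_pow2. field.
    + apply hull_mix.
      * apply hull_mono with (2 := IH). simpl. lia.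
      * apply hull_mono with (2 ^ i + 2 ^ i)%nat; [simpl; lia|]. apply hull_mul; auto. apply hull_cos. lia.
Qed.

Lemma fejer3_hull i : hull (3 * 2 ^ i) (fun x => fejer i x ^ 3).
Proof.
  apply hull_ext with (fun x => fejer i x * (fejer i x * fejer i x)); [intros; ring|].
  replace (3 * 2 ^ i)%nat with (2 ^ i + (2 ^ i + 2 ^ i))%nat by lia.
  apply hull_mul; [|apply hull_mul]; apply fejer_hull.
Qed.

Lemma INR_90 i : INR (90 * 2 ^ i) = 90 * 2 ^ i.
Proof. rewrite mult_INR, INR_pow2. f_equal. simpl. ring. Qed.

Lemma theta_trig i : trig (87 * 2 ^ i) (93 * 2 ^ i) (theta i).
Proof.
  assert (P : (0 < 2 ^ i)%nat) by (apply Nat.neq_0_lt_0, Nat.pow_nonzero; lia).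
  apply trig_mono with (90 * 2 ^ i - 3 * 2 ^ i)%nat (90 * 2 ^ i + 3 * 2 ^ i)%nat; [lia|lia|].
  apply trig_scal. apply trig_ext with (fun x => sin (INR (90 * 2 ^ i) * x) * fejer i x ^ 3).
  - intros x. now rewrite INR_90.
  - apply trig_sin_mul with 0%nat; [|lia]. apply hull_trig, fejer3_hull.
Qed.

Lemma dtheta_trig i : trig (87 * 2 ^ i) (93 * 2 ^ i) (dtheta i).
Proof.
  destruct (trig_derive _ _ _ (theta_trig i)) as [g [Tg D]]. apply trig_ext with (2 := Tg).
  intros x. rewrite <- (is_derive_unique _ _ _ (D x)). apply is_derive_unique, theta_deriv.
Qed.

Lemma pow2_nat_pos i : (1 <= 2 ^ i)%nat.
Proof. apply Nat.neq_0_lt_0, Nat.pow_nonzero; lia. Qed.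

(** * The truncated sawtooth series: correlations with the test functions and uniform bound *)

Fixpoint saw (n : nat) (x : R) : R :=
  match n with
  | O => 0
  | S n => saw n x + / INR (S n) * sin (INR (S n) * x)
  end.

Lemma saw_trig n : trig 1 (S n) (saw n).
Proof.
  induction n as [|n IH]; cbn [saw].
  - apply trig_ext with (fun x => 0 * sin (INR 1 * x)); [intros; ring|]. apply trig_scal, trig_sin. lia.
  - apply trig_plus; [apply trig_mono with (3 := IH); lia|]. apply trig_scal, trig_sin. lia.
Qed.

Lemma saw_trig' n : (1 <= n)%nat -> trig 1 n (saw n).
Proof.
  destruct n as [|n]; [lia|]. intros _. cbn [saw].
  apply trig_plus; [apply saw_trig|]. apply trig_scal, trig_sin. lia.
Qed.

Lemma saw_cont n x : continuous (saw n) x.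
Proof. eapply trig_cont, saw_trig. Qed.

Lemma saw_sin n m : (1 <= m <= n)%nat -> RInt (fun x => saw n x * sin (INR m * x)) 0 (2 * PI) = PI / INR m.
Proof.
  intros Hm.
  (* The conditional form is what an induction on [n] can carry. For [m = 0] it holds because [/ 0]
     is 0. *)
  assert (H : RInt (fun x => saw n x * sin (INR m * x)) 0 (2 * PI) = if le_dec m n then PI / INR m else 0).
  { clear Hm. assert (G : (1 <= m)%nat \/ m = 0%nat) by lia. destruct G as [G| ->].
    2:{ rewrite RInt_zero_fun by (intros; simpl INR; rewrite Rmult_0_l, sin_0; apply Rmult_0_r).
        simpl INR. unfold Rdiv. rewrite Rinv_0, Rmult_0_r. now destruct le_dec. }
    assert (Pm : 0 < INR m) by (apply lt_0_INR; lia).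
    induction n as [|n IH].
    - cbn [saw]. destruct le_dec; [lia|].
      apply RInt_zero_fun. intros; apply Rmult_0_l.
    - assert (Pn : 0 < INR (S n)) by (apply lt_0_INR; lia).
      rewrite (RInt_ext_all _ (fun x => saw n x * sin (INR m * x) + / INR (S n) * (sin (INR (S n) * x) * sin (INR m * x)))).
      2:{ intros x. cbn [saw]. toR; ring. }
      rewrite RInt_plus_cont, RInt_scal_cont, IH, int_sin_sin; auto using isint_INR.
      2-4: intros; cont; auto using saw_cont, sin_cont.
      assert (E1 : delta (INR (S n)) (- INR m) = 0) by (unfold delta; destruct Req_EM_T; lra).
      assert (E2 : delta (INR (S n)) (INR m) = if Nat.eq_dec m (S n) then 1 else 0).
      { unfold delta. destruct Req_EM_T as [E|N], Nat.eq_dec as [E'|N']; auto.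
        - apply INR_eq in E. congruence.
        - subst. lra. }
      rewrite E1, E2. destruct (Nat.eq_dec m (S n)) as [->|N].
      + destruct le_dec; [lia|]. destruct le_dec; [|lia]. toR; field. lra.
      + destruct (le_dec m n), (le_dec m (S n)); try lia; (toR; ring). }
  rewrite H. destruct le_dec; [reflexivity|lia].
Qed.

(** For a single cosine of frequency [k], the product with [sin (INR c * x)] splits into two modes
    [c + k] and [c - k], each correlated with [saw n] by at least [PI / INR (c + d)]. Averaging
    preserves the lower bound. *)
Lemma hull_saw d c n f : hull d f -> (d < c)%nat -> (c + d <= n)%nat ->
  PI / INR (c + d) <= RInt (fun x => saw n x * (sin (INR c * x) * f x)) 0 (2 * PI).
Proof.
  intros H Hc Hn. assert (PIpos := PI_RGT_0).
  induction H as [k Hk|f g Hf IHf Hg IHg|f g E _ IH].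
  - rewrite (RInt_ext_all _ (fun x => / 2 * (saw n x * sin (INR (c + k) * x)) + / 2 * (saw n x * sin (INR (c - k) * x)))).
    2:{ intros x. rewrite plus_INR, minus_INR, sin_cos, Rmult_plus_distr_r, Rmult_minus_distr_r by lia. toR; ring. }
    rewrite RInt_plus_cont, !RInt_scal_cont, !saw_sin; try lia.
    2-5: intros; cont; auto using saw_cont, sin_cont.
    assert (I : forall m, (1 <= m <= c + d)%nat -> PI / INR (c + d) <= PI / INR m).
    { intros m Hm. apply Rmult_le_compat_l; [lra|]. apply Rinv_le_contravar; [apply lt_0_INR; lia|apply le_INR; lia]. }
    assert (I1 := I (c + k)%nat ltac:(lia)). assert (I2 := I (c - k)%nat ltac:(lia)). lra.
  - assert (Cf : forall x : R, continuous f x) by (intros; eapply trig_cont, hull_trig; eauto).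
    assert (Cg : forall x : R, continuous g x) by (intros; eapply trig_cont, hull_trig; eauto).
    rewrite (RInt_ext_all _ (fun x => / 2 * (saw n x * (sin (INR c * x) * f x)) + / 2 * (saw n x * (sin (INR c * x) * g x)))).
    2:{ intros x. toR; field. }
    rewrite RInt_plus_cont, !RInt_scal_cont; [lra| | | |]; intros; cont; auto using saw_cont, sin_cont.
  - rewrite (RInt_ext_all _ (fun x => saw n x * (sin (INR c * x) * f x))); [exact IH|]. intros x. now rewrite E.
Qed.

(** The normalization [2 ^ i] of [theta] cancels the decay of the sawtooth coefficients near the
    frequency [90 * 2 ^ i]: every dyadic scale sees the jump with the same strength. *)
Lemma saw_theta n i : (93 * 2 ^ i <= n)%nat -> PI / 93 <= RInt (fun x => saw n x * theta i x) 0 (2 * PI).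
Proof.
  intros Hn. assert (P := two_pow_pos i). assert (P' := pow2_nat_pos i).
  rewrite (RInt_ext_all _ (fun x => 2 ^ i * (saw n x * (sin (INR (90 * 2 ^ i) * x) * fejer i x ^ 3)))).
  2:{ intros x. unfold theta. rewrite INR_90. toR; ring. }
  rewrite RInt_scal_cont.
  2:{ intros; cont; auto using saw_cont, sin_cont. eapply continuous_of_derive, fejer_deriv. }
  assert (H := hull_saw _ (90 * 2 ^ i) n _ (fejer3_hull i) ltac:(lia) ltac:(lia)).
  replace (90 * 2 ^ i + 3 * 2 ^ i)%nat with (93 * 2 ^ i)%nat in H by lia.
  rewrite mult_INR, INR_pow2 in H. replace (INR 93) with 93 in H by (simpl; ring).
  assert (E : PI / 93 = 2 ^ i * (PI / (93 * 2 ^ i))). { field. lra. } rewrite E. apply Rmult_le_compat_l; [lra|exact H].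
Qed.

Fixpoint sin_sum (n : nat) (x : R) : R :=
  match n with
  | O => 0
  | S n => sin_sum n x + sin (INR (S n) * x)
  end.

(** Multiplying by [sin (x / 2)] makes the sum telescope. *)
Lemma sin_sum_bound n x : 0 < x <= PI -> Rabs (sin_sum n x) <= 8 / x.
Proof.
  intros Hx. assert (PIpos := PI_RGT_0).
  assert (H : sin (x / 2) * sin_sum n x = / 2 * (cos (x / 2) - cos (INR n * x + x / 2))).
  { induction n as [|n IH].
    - simpl. rewrite Rmult_0_l, Rplus_0_l. ring.
    - cbn [sin_sum]. rewrite Rmult_plus_distr_l, IH, S_INR.
      rewrite sin_sin. rewrite <- (cos_neg (x / 2 - _)).
      replace (- (x / 2 - (INR n + 1) * x)) with (INR n * x + x / 2) by field.
      replace (x / 2 + (INR n + 1) * x) with ((INR n + 1) * x + x / 2) by field. field. }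
  assert (S : x / 8 <= sin (x / 2)) by (assert (G := sin_lower (x / 2) ltac:(lra)); lra).
  assert (B : Rabs (sin (x / 2) * sin_sum n x) <= 1).
  { rewrite H. assert (C1 := COS_bound (x / 2)). assert (C2 := COS_bound (INR n * x + x / 2)). apply Rabs_le. lra. }
  rewrite Rabs_mult, (Rabs_pos_eq (sin (x / 2))) in B by lra.
  apply Rmult_le_reg_l with (x / 8); [lra|]. replace (x / 8 * (8 / x)) with 1 by (field; lra).
  assert (Q := Rabs_pos (sin_sum n x)). nra.
Qed.

Lemma saw_small n x : Rabs (saw n x) <= INR n * Rabs x.
Proof.
  induction n as [|n IH]; [simpl; rewrite Rabs_R0; lra|].
  assert (P : 0 < INR (S n)) by (apply lt_0_INR; lia). cbn [saw]. eapply Rle_trans; [apply Rabs_triang|].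
  assert (Rabs (/ INR (S n) * sin (INR (S n) * x)) <= Rabs x).
  { assert (G : Rabs (sin (INR (S n) * x)) <= Rabs (INR (S n) * x)).
    { assert (M := MVT_gen sin 0 (INR (S n) * x) cos). destruct M as [c [_ E]].
      - intros; apply is_derive_sin.
      - intros; apply continuity_sin.
      - rewrite sin_0, !Rminus_0_r in E. rewrite E, Rabs_mult. assert (C := COS_bound c).
        assert (Rabs (cos c) <= 1) by (apply Rabs_le; lra). assert (Q := Rabs_pos (INR (S n) * x)). nra. }
    rewrite Rabs_mult in *. rewrite (Rabs_pos_eq (INR (S n))) in G by lra. rewrite Rabs_pos_eq by (left; now apply Rinv_0_lt_compat).
    apply Rmult_le_reg_l with (INR (S n)); [lra|]. rewrite <- Rmult_assoc, Rinv_r; lra. }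
  replace (INR (S n) * Rabs x) with (INR n * Rabs x + Rabs x) by (rewrite S_INR; ring). lra.
Qed.

(** Summation by parts between [m] and [n], with the boundary terms kept on the left so that the
    remainder telescopes in [n]. *)
Lemma saw_abel m n x : (m <= n)%nat -> 0 < x <= PI ->
  Rabs (saw n x - saw m x - sin_sum n x / INR (S n) + sin_sum m x / INR (S m)) <= 8 / x * (/ INR (S m) - / INR (S n)).
Proof.
  intros Hmn Hx. induction Hmn as [|n Hmn IH].
  - match goal with |- Rabs ?a <= ?b => replace a with 0 by ring; replace b with 0 by ring end. rewrite Rabs_R0. lra.
  - assert (P1 : 0 < INR (S n)) by (apply lt_0_INR; lia).
    assert (E : INR (S (S n)) = INR (S n) + 1) by apply S_INR.
    assert (Hi : 0 <= / INR (S n) - / INR (S (S n))).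
    { rewrite E. assert (/ (INR (S n) + 1) <= / INR (S n)) by (apply Rinv_le_contravar; lra). lra. }
    assert (B := sin_sum_bound (S n) x Hx).
    match goal with |- Rabs ?a <= _ => replace a with ((saw n x - saw m x - sin_sum n x / INR (S n) + sin_sum m x / INR (S m)) + sin_sum (S n) x * (/ INR (S n) - / INR (S (S n)))) end.
    2:{ cbn [saw sin_sum]. unfold Rdiv. ring. }
    eapply Rle_trans; [apply Rabs_triang|]. rewrite (Rabs_mult (sin_sum (S n) x)), (Rabs_pos_eq (/ INR (S n) - _)) by lra.
    assert (Rabs (sin_sum (S n) x) * (/ INR (S n) - / INR (S (S n))) <= 8 / x * (/ INR (S n) - / INR (S (S n)))) by (apply Rmult_le_compat_r; auto).
    lra.
Qed.

Lemma saw_opp n x : saw n (- x) = - saw n x.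
Proof.
  induction n as [|n IH]; cbn [saw]; [ring|]. rewrite IH, <- Ropp_mult_distr_r, sin_neg. ring.
Qed.

(** For [0 < x <= PI] the sum is cut at [m], the integer part of [1 / x]: the first [m] terms give
    at most [m x <= 1], and the tail costs at most [16 / (x (m + 1)) <= 16] by Abel summation. *)
Lemma saw_bound n x : Rabs (saw n x) <= 17.
Proof.
  assert (PIpos := PI_RGT_0).
  assert (Main : forall y, 0 < y <= PI -> Rabs (saw n y) <= 17).
  { intros y Hy. destruct (nfloor_ex (/ y)) as [m [Hm1 Hm2]]. { left. apply Rinv_0_lt_compat. lra. }
    assert (Hmy : INR m * y <= 1). { apply Rmult_le_reg_r with (/ y); [apply Rinv_0_lt_compat; lra|]. rewrite Rmult_assoc, Rinv_r; lra. }
    assert (Hm : forall k, (k <= m)%nat -> Rabs (saw k y) <= 1).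
    { intros k Hk. eapply Rle_trans; [apply saw_small|]. rewrite Rabs_pos_eq by lra.
      apply le_INR in Hk. nra. }
    destruct (le_lt_dec n m) as [Hn|Hn]; [specialize (Hm n Hn); lra|].
    assert (A := saw_abel m n y ltac:(lia) Hy). assert (B1 := sin_sum_bound n y Hy). assert (B2 := sin_sum_bound m y Hy).
    specialize (Hm m (le_n _)).
    assert (Pn : 0 < INR (S n)) by (apply lt_0_INR; lia). assert (Pm : 0 < INR (S m)) by (apply lt_0_INR; lia).
    assert (Q1 : Rabs (sin_sum n y / INR (S n)) <= 8 / y * / INR (S n)).
    { unfold Rdiv. rewrite Rabs_mult, (Rabs_pos_eq (/ _)) by (left; now apply Rinv_0_lt_compat).
      apply Rmult_le_compat_r; [left; now apply Rinv_0_lt_compat|exact B1]. }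
    assert (Q2 : Rabs (sin_sum m y / INR (S m)) <= 8 / y * / INR (S m)).
    { unfold Rdiv. rewrite Rabs_mult, (Rabs_pos_eq (/ _)) by (left; now apply Rinv_0_lt_compat).
      apply Rmult_le_compat_r; [left; now apply Rinv_0_lt_compat|exact B2]. }
    assert (Q3 : 8 / y * / INR (S m) <= 8).
    { rewrite S_INR. apply Rmult_le_reg_r with (INR m + 1); [rewrite <- S_INR; lra|].
      rewrite Rmult_assoc, Rinv_l, Rmult_1_r by (rewrite <- S_INR; lra). unfold Rdiv. nra. }
    apply Rabs_le_between in A. apply Rabs_le_between in Q1. apply Rabs_le_between in Q2. apply Rabs_le_between in Hm.
    rewrite Rmult_minus_distr_l in A. apply Rabs_le. lra. }
  destruct (periodic_reduce x) as [y [Hy E]]. rewrite (E (saw n) (trig_periodic _ _ _ (saw_trig n))).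
  destruct (Req_dec y 0) as [->|N]. { eapply Rle_trans; [apply saw_small|]. rewrite Rabs_R0. lra. }
  destruct (Rle_dec y PI) as [L|L]; [apply Main; lra|].
  destruct (Req_dec y (2 * PI)) as [->|N'].
  { rewrite <- (Rplus_0_l (2 * PI)), (trig_periodic _ _ _ (saw_trig n) 0). eapply Rle_trans; [apply saw_small|]. rewrite Rabs_R0. lra. }
  assert (M := Main (2 * PI - y) ltac:(lra)).
  replace (2 * PI - y) with (- y + 2 * PI) in M by ring. rewrite (trig_periodic _ _ _ (saw_trig n) (- y)), saw_opp, Rabs_Ropp in M. exact M.
Qed.

Lemma saw_deriv n : exists g, (forall x : R, is_derive (saw n) x (g x)) /\ forall x, Rabs (g x) <= INR n.
Proof.
  induction n as [|n [g [D B]]].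
  - exists (fun _ => 0). split; [intros; apply @is_derive_const|]. intros. simpl. rewrite Rabs_R0. lra.
  - exists (fun x => g x + cos (INR (S n) * x)). assert (P : 0 < INR (S n)) by (apply lt_0_INR; lia). split.
    + intros x. cbn [saw]. apply (is_derive_plus (saw n)); [apply D|].
      set (c := INR (S n)) in *.
      assert (D' : is_derive (fun x => / c * sin (c * x)) x (/ c * (c * cos (c * x)))) by (auto_derive; auto; ring).
      eapply is_derive_eq; [exact D'|]. toR; field. lra.
    + intros x. replace (INR (S n)) with (INR n + 1) at 2 by (symmetry; apply S_INR). eapply Rle_trans; [apply Rabs_triang|]. specialize (B x).
      assert (C := COS_bound (INR (S n) * x)). assert (Rabs (cos (INR (S n) * x)) <= 1) by (apply Rabs_le; lra). lra.
Qed.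

(** * Dyadic blocks and the Besov norm *)

Lemma fst_sum_n (f : nat -> C) n : fst (sum_n f n) = sum_n (fun i => fst (f i)) n.
Proof. induction n as [|n IH]; [now rewrite !sum_O|]. rewrite !sum_Sn, <- IH. reflexivity. Qed.

Lemma snd_sum_n (f : nat -> C) n : snd (sum_n f n) = sum_n (fun i => snd (f i)) n.
Proof. induction n as [|n IH]; [now rewrite !sum_O|]. rewrite !sum_Sn, <- IH. reflexivity. Qed.

Lemma sum_n_plus_R (f g : nat -> R) n : sum_n (fun i => f i + g i) n = sum_n f n + sum_n g n.
Proof. apply (sum_n_plus f g). Qed.

Lemma sum_n_scal_R (f : nat -> R) c n : sum_n (fun i => c * f i) n = c * sum_n f n.
Proof. apply (sum_n_mult_l (K := R_Ring) c f n). Qed.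

Lemma sum_single p A M : sum_n (fun i => if Nat.eq_dec i p then A else 0) M = if le_dec p M then A else 0.
Proof.
  induction M as [|M IH].
  - rewrite sum_O. destruct (Nat.eq_dec 0 p), (le_dec p 0); try lia; reflexivity.
  - rewrite sum_Sn, IH. change (@plus R_AbelianMonoid) with Rplus. toR.
    destruct (le_dec p M), (Nat.eq_dec (S M) p), (le_dec p (S M)); try lia; ring.
Qed.

Lemma sum_delta N n A B : (n <= N)%nat ->
  sum_n (fun i => A * delta (INR i - INR N) (INR n) + B * delta (INR i - INR N) (- INR n)) (2 * N) = A + B.
Proof.
  intros Hn. rewrite sum_n_plus_R.
  rewrite (sum_n_ext (fun i => A * delta (INR i - INR N) (INR n)) (fun i => if Nat.eq_dec i (N + n) then A else 0)).
  2:{ intros i. unfold delta. toR. destruct Req_EM_T as [E|E], Nat.eq_dec as [E'|E']; try ring; exfalso.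
      - apply E', INR_eq. rewrite plus_INR. lra.
      - apply E. rewrite E', plus_INR. ring. }
  rewrite (sum_n_ext (fun i => B * delta (INR i - INR N) (- INR n)) (fun i => if Nat.eq_dec i (N - n) then B else 0)).
  2:{ intros i. unfold delta. toR. destruct Req_EM_T as [E|E], Nat.eq_dec as [E'|E']; try ring; exfalso.
      - apply E', INR_eq. rewrite minus_INR by lia. lra.
      - apply E. rewrite E', minus_INR by lia. ring. }
  rewrite !sum_single. destruct (le_dec (N + n) (2 * N)), (le_dec (N - n) (2 * N)); try lia. reflexivity.
Qed.

Lemma sum_n_cont (F : nat -> R -> R) M x : (forall i, continuous (F i) x) -> continuous (fun x => sum_n (fun i => F i x) M) x.
Proof.
  intros H. induction M as [|M IH].
  - apply (continuous_ext (F 0%nat)); auto. intros y. now rewrite sum_O.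
  - apply (continuous_ext (fun x => sum_n (fun i => F i x) M + F (S M) x)).
    + intros y. now rewrite sum_Sn.
    + now apply (continuous_plus (fun x => sum_n (fun i => F i x) M)).
Qed.

Lemma RInt_sum_n (F : nat -> R -> R) M a b : (forall i (x : R), continuous (F i) x) ->
  RInt (fun x => sum_n (fun i => F i x) M) a b = sum_n (fun i => RInt (F i) a b) M.
Proof.
  intros H. induction M as [|M IH].
  - rewrite sum_O. apply RInt_ext_all. intros y. now rewrite sum_O.
  - rewrite sum_Sn, <- IH. rewrite (RInt_ext_all _ (fun x => sum_n (fun i => F i x) M + F (S M) x)) by (intros; now rewrite sum_Sn).
    apply RInt_plus_cont; auto. intros x. now apply sum_n_cont.
Qed.

Definition cos_coef (u : R -> R) (xi : R) : R := RInt (fun x => cos (x * xi) * u x) 0 (2 * PI).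
Definition sin_coef (u : R -> R) (xi : R) : R := RInt (fun x => sin (x * xi) * u x) 0 (2 * PI).

Lemma cos_cont_r a x : continuous (fun x => cos (x * a)) x.
Proof. apply (ex_derive_continuous (fun x => cos (x * a))). auto_derive; auto. Qed.
Lemma sin_cont_r a x : continuous (fun x => sin (x * a)) x.
Proof. apply (ex_derive_continuous (fun x => sin (x * a))). auto_derive; auto. Qed.

Section Blocks.
Variable chi : R -> R.

Lemma block_re k u x : let N := (2 ^ S k)%nat in fst (dyadic_block chi k u x) = / (2 * PI) *
  sum_n (fun i => block_mult chi k (INR i - INR N) *
    (cos_coef u (INR i - INR N) * cos (x * (INR i - INR N)) + sin_coef u (INR i - INR N) * sin (x * (INR i - INR N)))) (2 * N).
Proof.
  intros N. unfold dyadic_block. fold N. cbv zeta. unfold Cmult at 1. cbn [fst snd RtoC].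
  rewrite Rmult_0_l, Rminus_0_r. f_equal. rewrite fst_sum_n. apply sum_n_ext. intros i.
  unfold Cmult, RtoC, fourier, cexp_i, cos_coef, sin_coef. cbn [fst snd]. toR; ring.
Qed.

Lemma block_im k u x : let N := (2 ^ S k)%nat in snd (dyadic_block chi k u x) = / (2 * PI) *
  sum_n (fun i => block_mult chi k (INR i - INR N) *
    (cos_coef u (INR i - INR N) * sin (x * (INR i - INR N)) - sin_coef u (INR i - INR N) * cos (x * (INR i - INR N)))) (2 * N).
Proof.
  intros N. unfold dyadic_block. fold N. cbv zeta. unfold Cmult at 1. cbn [fst snd RtoC].
  rewrite Rmult_0_l, Rplus_0_r. f_equal. rewrite snd_sum_n. apply sum_n_ext. intros i.
  unfold Cmult, RtoC, fourier, cexp_i, cos_coef, sin_coef. cbn [fst snd]. toR; ring.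
Qed.

Lemma isint_diff i N : isint (INR i - INR N).
Proof. apply isint_minus; apply isint_INR. Qed.

Lemma cos_coef_cos a n : isint a -> cos_coef (fun x => cos (INR n * x)) a = PI * (delta a (INR n) + delta a (- INR n)).
Proof.
  intros H. rewrite <- int_cos_cos by auto using isint_INR. apply RInt_ext_all. intros x. now rewrite (Rmult_comm x).
Qed.
Lemma sin_coef_cos a n : isint a -> sin_coef (fun x => cos (INR n * x)) a = 0.
Proof.
  intros H. rewrite <- (int_sin_cos a (INR n)) by auto using isint_INR. apply RInt_ext_all. intros x. now rewrite (Rmult_comm x).
Qed.
Lemma cos_coef_sin a n : isint a -> cos_coef (fun x => sin (INR n * x)) a = 0.
Proof.
  intros H. rewrite <- (int_sin_cos (INR n) a) by auto using isint_INR. apply RInt_ext_all. intros x. rewrite (Rmult_comm x). apply Rmult_comm.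
Qed.
Lemma sin_coef_sin a n : isint a -> sin_coef (fun x => sin (INR n * x)) a = PI * (delta a (INR n) - delta a (- INR n)).
Proof.
  intros H. rewrite <- int_sin_sin by auto using isint_INR. apply RInt_ext_all. intros x. now rewrite (Rmult_comm x).
Qed.

Lemma cos_coef_plus u w xi : (forall x : R, continuous u x) -> (forall x : R, continuous w x) ->
  cos_coef (fun x => u x + w x) xi = cos_coef u xi + cos_coef w xi.
Proof.
  intros Cu Cw. unfold cos_coef. rewrite <- RInt_plus_cont by (intros; cont; apply cos_cont_r).
  apply RInt_ext_all. intros x. toR; ring.
Qed.
Lemma sin_coef_plus u w xi : (forall x : R, continuous u x) -> (forall x : R, continuous w x) ->
  sin_coef (fun x => u x + w x) xi = sin_coef u xi + sin_coef w xi.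
Proof.
  intros Cu Cw. unfold sin_coef. rewrite <- RInt_plus_cont by (intros; cont; apply sin_cont_r).
  apply RInt_ext_all. intros x. toR; ring.
Qed.
Lemma cos_coef_scal u c xi : (forall x : R, continuous u x) -> cos_coef (fun x => c * u x) xi = c * cos_coef u xi.
Proof.
  intros Cu. unfold cos_coef. rewrite <- RInt_scal_cont by (intros; cont; apply cos_cont_r).
  apply RInt_ext_all. intros x. toR; ring.
Qed.
Lemma sin_coef_scal u c xi : (forall x : R, continuous u x) -> sin_coef (fun x => c * u x) xi = c * sin_coef u xi.
Proof.
  intros Cu. unfold sin_coef. rewrite <- RInt_scal_cont by (intros; cont; apply sin_cont_r).
  apply RInt_ext_all. intros x. toR; ring.
Qed.
Lemma cos_coef_ext u w xi : (forall x, u x = w x) -> cos_coef u xi = cos_coef w xi.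
Proof. intros E. apply RInt_ext_all. intros x. now rewrite E. Qed.
Lemma sin_coef_ext u w xi : (forall x, u x = w x) -> sin_coef u xi = sin_coef w xi.
Proof. intros E. apply RInt_ext_all. intros x. now rewrite E. Qed.

Lemma delta_eval (F : R -> R) a b : F a * delta a b = F b * delta a b.
Proof. unfold delta. destruct Req_EM_T as [->|N]; ring. Qed.

Lemma sum_modes (F : R -> R) N n A B c : (forall i, F (INR i - INR N) =
    c * (A * delta (INR i - INR N) (INR n) + B * delta (INR i - INR N) (- INR n))) -> (n <= N)%nat \/ c = 0 ->
  sum_n (fun i => F (INR i - INR N)) (2 * N) = c * (A + B).
Proof.
  intros H Hn. rewrite (sum_n_ext _ (fun i => c * (A * delta (INR i - INR N) (INR n) + B * delta (INR i - INR N) (- INR n)))) by exact H.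
  rewrite sum_n_scal_R. destruct Hn as [Hn| ->]; [now rewrite sum_delta|]. now rewrite !Rmult_0_l.
Qed.

(** The last clause reflects that [dyadic_block] sums only over [|xi| <= 2 ^ (k + 1)]: a mode
    outside this range is annihilated, consistently only with [c = 0]. *)
Definition mult_const (k : nat) (c : R) (n : nat) : Prop :=
  block_mult chi k (INR n) = c /\ block_mult chi k (- INR n) = c /\ ((n <= 2 ^ S k)%nat \/ c = 0).

Lemma mult_delta k c n a : mult_const k c n -> block_mult chi k a * delta a (INR n) = c * delta a (INR n) /\
  block_mult chi k a * delta a (- INR n) = c * delta a (- INR n).
Proof. intros [H1 [H2 _]]. now rewrite !(delta_eval (block_mult chi k)), H1, H2. Qed.

Lemma block_cos k c n x : mult_const k c n ->
  fst (dyadic_block chi k (fun x => cos (INR n * x)) x) = c * cos (INR n * x) /\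
  snd (dyadic_block chi k (fun x => cos (INR n * x)) x) = 0.
Proof.
  intros H. assert (PIpos := PI_RGT_0). set (N := (2 ^ S k)%nat). split.
  - rewrite block_re. fold N.
    rewrite (sum_modes (fun a => block_mult chi k a * (cos_coef (fun x => cos (INR n * x)) a * cos (x * a) + sin_coef (fun x => cos (INR n * x)) a * sin (x * a))) N n
       (PI * cos (INR n * x)) (PI * cos (INR n * x)) c); [toR; field; lra| |apply H].
    intros i. set (a := INR i - INR N). rewrite cos_coef_cos, sin_coef_cos by apply isint_diff.
    destruct (mult_delta k c n a H) as [E1 E2]. assert (F1 := delta_eval (fun a => cos (x * a)) a (INR n)). assert (F2 := delta_eval (fun a => cos (x * a)) a (- INR n)).
    simpl in F1, F2. replace (x * - INR n) with (- (INR n * x)) in F2 by ring. rewrite cos_neg in F2. rewrite (Rmult_comm x (INR n)) in F1.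
    transitivity (PI * ((block_mult chi k a * (cos (x * a) * delta a (INR n))) + (block_mult chi k a * (cos (x * a) * delta a (- INR n))))); [ring|].
    rewrite F1, F2. transitivity (PI * cos (INR n * x) * (block_mult chi k a * delta a (INR n) + block_mult chi k a * delta a (- INR n))); [ring|]. rewrite E1, E2. ring.
  - rewrite block_im. fold N.
    rewrite (sum_modes (fun a => block_mult chi k a * (cos_coef (fun x => cos (INR n * x)) a * sin (x * a) - sin_coef (fun x => cos (INR n * x)) a * cos (x * a))) N n
       (PI * sin (INR n * x)) (- (PI * sin (INR n * x))) c); [toR; ring| |apply H].
    intros i. set (a := INR i - INR N). rewrite cos_coef_cos, sin_coef_cos by apply isint_diff.
    destruct (mult_delta k c n a H) as [E1 E2]. assert (F1 := delta_eval (fun a => sin (x * a)) a (INR n)). assert (F2 := delta_eval (fun a => sin (x * a)) a (- INR n)).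
    simpl in F1, F2. replace (x * - INR n) with (- (INR n * x)) in F2 by ring. rewrite sin_neg in F2. rewrite (Rmult_comm x (INR n)) in F1.
    transitivity (PI * ((block_mult chi k a * (sin (x * a) * delta a (INR n))) + (block_mult chi k a * (sin (x * a) * delta a (- INR n))))); [ring|].
    rewrite F1, F2. transitivity (PI * sin (INR n * x) * (block_mult chi k a * delta a (INR n) - block_mult chi k a * delta a (- INR n))); [ring|]. rewrite E1, E2. ring.
Qed.

Lemma block_sin k c n x : mult_const k c n ->
  fst (dyadic_block chi k (fun x => sin (INR n * x)) x) = c * sin (INR n * x) /\
  snd (dyadic_block chi k (fun x => sin (INR n * x)) x) = 0.
Proof.
  intros H. assert (PIpos := PI_RGT_0). set (N := (2 ^ S k)%nat). split.
  - rewrite block_re. fold N.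
    rewrite (sum_modes (fun a => block_mult chi k a * (cos_coef (fun x => sin (INR n * x)) a * cos (x * a) + sin_coef (fun x => sin (INR n * x)) a * sin (x * a))) N n
       (PI * sin (INR n * x)) (PI * sin (INR n * x)) c); [toR; field; lra| |apply H].
    intros i. set (a := INR i - INR N). rewrite cos_coef_sin, sin_coef_sin by apply isint_diff.
    destruct (mult_delta k c n a H) as [E1 E2]. assert (F1 := delta_eval (fun a => sin (x * a)) a (INR n)). assert (F2 := delta_eval (fun a => sin (x * a)) a (- INR n)).
    simpl in F1, F2. replace (x * - INR n) with (- (INR n * x)) in F2 by ring. rewrite sin_neg in F2. rewrite (Rmult_comm x (INR n)) in F1.
    transitivity (PI * ((block_mult chi k a * (sin (x * a) * delta a (INR n))) - (block_mult chi k a * (sin (x * a) * delta a (- INR n))))); [ring|].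
    rewrite F1, F2. transitivity (PI * sin (INR n * x) * (block_mult chi k a * delta a (INR n) + block_mult chi k a * delta a (- INR n))); [ring|]. rewrite E1, E2. ring.
  - rewrite block_im. fold N.
    rewrite (sum_modes (fun a => block_mult chi k a * (cos_coef (fun x => sin (INR n * x)) a * sin (x * a) - sin_coef (fun x => sin (INR n * x)) a * cos (x * a))) N n
       (- (PI * cos (INR n * x))) (PI * cos (INR n * x)) c); [toR; ring| |apply H].
    intros i. set (a := INR i - INR N). rewrite cos_coef_sin, sin_coef_sin by apply isint_diff.
    destruct (mult_delta k c n a H) as [E1 E2]. assert (F1 := delta_eval (fun a => cos (x * a)) a (INR n)). assert (F2 := delta_eval (fun a => cos (x * a)) a (- INR n)).
    simpl in F1, F2. replace (x * - INR n) with (- (INR n * x)) in F2 by ring. rewrite cos_neg in F2. rewrite (Rmult_comm x (INR n)) in F1.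
    transitivity (- PI * ((block_mult chi k a * (cos (x * a) * delta a (INR n))) - (block_mult chi k a * (cos (x * a) * delta a (- INR n))))); [ring|].
    rewrite F1, F2. transitivity (- PI * cos (INR n * x) * (block_mult chi k a * delta a (INR n) - block_mult chi k a * delta a (- INR n))); [ring|]. rewrite E1, E2. ring.
Qed.

Lemma block_plus k u w x : (forall x : R, continuous u x) -> (forall x : R, continuous w x) ->
  dyadic_block chi k (fun x => u x + w x) x = Cplus (dyadic_block chi k u x) (dyadic_block chi k w x).
Proof.
  intros Cu Cw. apply injective_projections; unfold Cplus; cbn [fst snd].
  - rewrite !block_re, <- Rmult_plus_distr_l, <- sum_n_plus_R. f_equal. apply sum_n_ext. intros i.
    rewrite cos_coef_plus, sin_coef_plus by auto. toR; ring.
  - rewrite !block_im, <- Rmult_plus_distr_l, <- sum_n_plus_R. f_equal. apply sum_n_ext. intros i.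
    rewrite cos_coef_plus, sin_coef_plus by auto. toR; ring.
Qed.

Lemma block_scal k u c x : (forall x : R, continuous u x) ->
  fst (dyadic_block chi k (fun x => c * u x) x) = c * fst (dyadic_block chi k u x) /\
  snd (dyadic_block chi k (fun x => c * u x) x) = c * snd (dyadic_block chi k u x).
Proof.
  intros Cu. split.
  - rewrite !block_re. rewrite (Rmult_comm c), Rmult_assoc. f_equal. rewrite Rmult_comm, <- sum_n_scal_R. apply sum_n_ext. intros i.
    rewrite cos_coef_scal, sin_coef_scal by auto. toR; ring.
  - rewrite !block_im. rewrite (Rmult_comm c), Rmult_assoc. f_equal. rewrite Rmult_comm, <- sum_n_scal_R. apply sum_n_ext. intros i.
    rewrite cos_coef_scal, sin_coef_scal by auto. toR; ring.
Qed.

Lemma block_ext k u w x : (forall x, u x = w x) -> dyadic_block chi k u x = dyadic_block chi k w x.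
Proof.
  intros E. apply injective_projections.
  - rewrite !block_re. f_equal. apply sum_n_ext. intros i. now rewrite (cos_coef_ext u w), (sin_coef_ext u w).
  - rewrite !block_im. f_equal. apply sum_n_ext. intros i. now rewrite (cos_coef_ext u w), (sin_coef_ext u w).
Qed.

Lemma block_trig k c lo hi f : (forall n, (lo <= n <= hi)%nat -> mult_const k c n) -> trig lo hi f ->
  forall x, dyadic_block chi k f x = RtoC (c * f x).
Proof.
  intros Hm H x.
  assert (G : fst (dyadic_block chi k f x) = c * f x /\ snd (dyadic_block chi k f x) = 0).
  { induction H as [n Hn|n Hn|f g Tf IHf Tg IHg|d f Tf IH|f g E _ IH].
    - exact (block_cos k c n x (Hm n Hn)).
    - exact (block_sin k c n x (Hm n Hn)).
    - rewrite block_plus by (intros; eapply trig_cont; eauto). destruct IHf as [Ef If], IHg as [Eg Ig].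
      unfold Cplus; cbn [fst snd]. rewrite Ef, If, Eg, Ig. split; ring.
    - destruct (block_scal k f d x) as [E1 E2]; [intros; eapply trig_cont; eauto|].
      destruct IH as [Ef If]. rewrite E1, E2, Ef, If. split; ring.
    - rewrite <- (block_ext k f g) by exact E. rewrite <- E. exact IH. }
  apply injective_projections; cbn [fst snd RtoC]; apply G.
Qed.

(** The block acts by the same constant on the modes [n] and [- n], so it can be moved onto [f],
    where it is the identity. The real part is used because [chi] is not assumed even and a block of
    a real function may be complex. *)
Lemma block_pairing k lo hi f u : (forall n, (lo <= n <= hi)%nat -> mult_const k 1 n) -> trig lo hi f ->
  (forall x : R, continuous u x) ->
  RInt (fun x => fst (dyadic_block chi k u x) * f x) 0 (2 * PI) = RInt (fun x => u x * f x) 0 (2 * PI).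
Proof.
  intros Hm H Cu. assert (PIpos := PI_RGT_0). set (N := (2 ^ S k)%nat).
  set (m := block_mult chi k).
  assert (Cb : forall x : R, continuous (fun x => fst (dyadic_block chi k u x)) x).
  { intros x. eapply continuous_ext; [intros; symmetry; apply block_re|]. cont.
    apply (sum_n_cont (fun i x => m (INR i - INR N) * (cos_coef u (INR i - INR N) * cos (x * (INR i - INR N)) + sin_coef u (INR i - INR N) * sin (x * (INR i - INR N))))).
    intros i. cont; auto using cos_cont_r, sin_cont_r. }
  assert (Expand : forall g : R -> R, (forall x : R, continuous g x) -> RInt (fun x => fst (dyadic_block chi k u x) * g x) 0 (2 * PI)
     = / (2 * PI) * sum_n (fun i => (fun a => m a * (cos_coef u a * RInt (fun x => cos (x * a) * g x) 0 (2 * PI)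
         + sin_coef u a * RInt (fun x => sin (x * a) * g x) 0 (2 * PI))) (INR i - INR N)) (2 * N)).
  { intros g Cg.
    rewrite (RInt_ext_all _ (fun x => / (2 * PI) * sum_n (fun i => m (INR i - INR N) * (cos_coef u (INR i - INR N) * (cos (x * (INR i - INR N)) * g x) + sin_coef u (INR i - INR N) * (sin (x * (INR i - INR N)) * g x))) (2 * N))).
    2:{ intros x. rewrite block_re. fold N. fold m. toR. rewrite Rmult_assoc. f_equal. rewrite Rmult_comm, <- sum_n_scal_R.
        apply sum_n_ext. intros i. toR; ring. }
    assert (Ci : forall i (x : R), continuous (fun x => m (INR i - INR N) * (cos_coef u (INR i - INR N) * (cos (x * (INR i - INR N)) * g x) + sin_coef u (INR i - INR N) * (sin (x * (INR i - INR N)) * g x))) x).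
    { intros i x. cont; auto using cos_cont_r, sin_cont_r. }
    rewrite RInt_scal_cont.
    2:{ intros x. apply (sum_n_cont (fun i x => m (INR i - INR N) * (cos_coef u (INR i - INR N) * (cos (x * (INR i - INR N)) * g x) + sin_coef u (INR i - INR N) * (sin (x * (INR i - INR N)) * g x)))). auto. }
    f_equal. rewrite (RInt_sum_n (fun i x => m (INR i - INR N) * (cos_coef u (INR i - INR N) * (cos (x * (INR i - INR N)) * g x) + sin_coef u (INR i - INR N) * (sin (x * (INR i - INR N)) * g x)))) by exact Ci.
    apply sum_n_ext. intros i.
    rewrite RInt_scal_cont, RInt_plus_cont, !RInt_scal_cont; [reflexivity|..]; intros; cont; auto using cos_cont_r, sin_cont_r. }
  induction H as [n Hn|n Hn|f g Tf IHf Tg IHg|d f Tf IH|f g E _ IH].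
  - specialize (Hm n Hn). rewrite Expand by (intros; apply cos_cont).
    rewrite (sum_modes (fun a => m a * (cos_coef u a * RInt (fun x => cos (x * a) * cos (INR n * x)) 0 (2 * PI)
         + sin_coef u a * RInt (fun x => sin (x * a) * cos (INR n * x)) 0 (2 * PI))) N n (PI * cos_coef u (INR n)) (PI * cos_coef u (INR n)) 1); [| |apply Hm].
    + rewrite (RInt_ext_all _ (fun x => cos (x * INR n) * u x)) by (intros; rewrite (Rmult_comm x); apply Rmult_comm).
      fold (cos_coef u (INR n)). toR; field. lra.
    + intros i. set (a := INR i - INR N).
      assert (E1 := cos_coef_cos a n (isint_diff i N)). assert (E2 := sin_coef_cos a n (isint_diff i N)). unfold cos_coef in E1. unfold sin_coef in E2.
      rewrite E1, E2. destruct (mult_delta k 1 n a Hm) as [D1 D2]. fold m in D1, D2.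
      assert (F1 := delta_eval (cos_coef u) a (INR n)). assert (F2 := delta_eval (cos_coef u) a (- INR n)).
      assert (Ev : cos_coef u (- INR n) = cos_coef u (INR n)).
      { apply RInt_ext_all. intros x. rewrite <- Ropp_mult_distr_r, cos_neg. reflexivity. }
      rewrite Ev in F2.
      transitivity (PI * (m a * (cos_coef u a * delta a (INR n)) + m a * (cos_coef u a * delta a (- INR n)))); [ring|].
      rewrite F1, F2. transitivity (PI * cos_coef u (INR n) * (m a * delta a (INR n) + m a * delta a (- INR n))); [ring|]. rewrite D1, D2. ring.
  - specialize (Hm n Hn). rewrite Expand by (intros; apply sin_cont).
    rewrite (sum_modes (fun a => m a * (cos_coef u a * RInt (fun x => cos (x * a) * sin (INR n * x)) 0 (2 * PI)
         + sin_coef u a * RInt (fun x => sin (x * a) * sin (INR n * x)) 0 (2 * PI))) N n (PI * sin_coef u (INR n)) (PI * sin_coef u (INR n)) 1); [| |apply Hm].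
    + rewrite (RInt_ext_all _ (fun x => sin (x * INR n) * u x)) by (intros; rewrite (Rmult_comm x); apply Rmult_comm).
      fold (sin_coef u (INR n)). toR; field. lra.
    + intros i. set (a := INR i - INR N).
      assert (E1 := cos_coef_sin a n (isint_diff i N)). assert (E2 := sin_coef_sin a n (isint_diff i N)). unfold cos_coef in E1. unfold sin_coef in E2.
      rewrite E1, E2. destruct (mult_delta k 1 n a Hm) as [D1 D2]. fold m in D1, D2.
      assert (F1 := delta_eval (sin_coef u) a (INR n)). assert (F2 := delta_eval (sin_coef u) a (- INR n)).
      assert (Ev : sin_coef u (- INR n) = - sin_coef u (INR n)).
      { unfold sin_coef. rewrite (RInt_ext_all _ (fun x => (-1) * (sin (x * INR n) * u x))).
        - rewrite RInt_scal_cont; [toR; ring|]. intros; cont; auto using sin_cont_r.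
        - intros x. rewrite <- Ropp_mult_distr_r, sin_neg. toR; ring. }
      rewrite Ev in F2.
      transitivity (PI * (m a * (sin_coef u a * delta a (INR n)) - m a * (sin_coef u a * delta a (- INR n)))); [ring|].
      rewrite F1, F2. transitivity (PI * sin_coef u (INR n) * (m a * delta a (INR n) + m a * delta a (- INR n))); [ring|]. rewrite D1, D2. ring.
  - assert (Cf : forall x : R, continuous f x) by (intros; eapply trig_cont; eauto).
    assert (Cg : forall x : R, continuous g x) by (intros; eapply trig_cont; eauto).
    rewrite (RInt_ext_all _ (fun x => fst (dyadic_block chi k u x) * f x + fst (dyadic_block chi k u x) * g x)) by (intros; apply Rmult_plus_distr_l).
    rewrite (RInt_ext_all (fun x => u x * (f x + g x)) (fun x => u x * f x + u x * g x)) by (intros; apply Rmult_plus_distr_l).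
    rewrite !RInt_plus_cont, IHf, IHg; [reflexivity|..]; intros; cont.
  - assert (Cf : forall x : R, continuous f x) by (intros; eapply trig_cont; eauto).
    rewrite (RInt_ext_all _ (fun x => d * (fst (dyadic_block chi k u x) * f x))) by (intros; toR; ring).
    rewrite (RInt_ext_all (fun x => u x * (d * f x)) (fun x => d * (u x * f x))) by (intros; toR; ring).
    rewrite !RInt_scal_cont, IH; [reflexivity|..]; intros; cont.
  - rewrite (RInt_ext_all _ (fun x => fst (dyadic_block chi k u x) * f x)) by (intros; now rewrite E).
    rewrite IH. apply RInt_ext_all. intros x. now rewrite E.
Qed.

Hypothesis Hchi : admissible_chi chi.

Lemma chi_one xi : Rabs xi <= 3 / 4 -> chi xi = 1. Proof. apply Hchi. Qed.
Lemma chi_zero xi : 4 / 3 < Rabs xi -> chi xi = 0. Proof. apply Hchi. Qed.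

Lemma two_pow_le j k : (j <= k)%nat -> 2 ^ j <= 2 ^ k.
Proof. intros H. apply Rle_pow; [lra|exact H]. Qed.

(** Between [4 / 3 * 2 ^ j] and [3 / 2 * 2 ^ j] there is no overlap of blocks: [chi (xi / 2 ^ j)] is
    already 0 while [chi (xi / 2 ^ (j + 1))] is still 1. The index [S j] stands for the block of
    order [j]. *)
Lemma block_mult_band j k xi : 4 / 3 * 2 ^ j < Rabs xi <= 3 / 2 * 2 ^ j ->
  block_mult chi k xi = if Nat.eq_dec k (S j) then 1 else 0.
Proof.
  intros [H1 H2]. assert (Pj := two_pow_pos j).
  assert (Ad : forall p, Rabs (xi / 2 ^ p) = Rabs xi / 2 ^ p).
  { intros p. unfold Rdiv. rewrite Rabs_mult. f_equal. apply Rabs_pos_eq. left. apply Rinv_0_lt_compat, two_pow_pos. }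
  assert (Ad2 : forall p, Rabs (xi / 2 ^ p / 2) = Rabs xi / 2 ^ p / 2).
  { intros p. unfold Rdiv at 1. rewrite Rabs_mult, Ad. unfold Rdiv. f_equal. apply Rabs_pos_eq. lra. }
  assert (Lo : forall p c, Rabs xi <= c * 2 ^ p -> Rabs xi / 2 ^ p <= c).
  { intros p c H. assert (P := two_pow_pos p). apply Rmult_le_reg_r with (2 ^ p); [exact P|]. unfold Rdiv. rewrite Rmult_assoc, Rinv_l; lra. }
  assert (Hi : forall p c, c * 2 ^ p < Rabs xi -> c < Rabs xi / 2 ^ p).
  { intros p c H. assert (P := two_pow_pos p). apply Rmult_lt_reg_r with (2 ^ p); [exact P|]. unfold Rdiv. rewrite Rmult_assoc, Rinv_l; lra. }
  destruct k as [|p]; cbn [block_mult].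
  - destruct Nat.eq_dec; [lia|]. apply chi_zero. assert (H := two_pow_le 0 j ltac:(lia)). simpl in H. lra.
  - destruct (Nat.eq_dec (S p) (S j)) as [E|N].
    + replace p with j in * by lia. rewrite (chi_one (xi / 2 ^ j / 2)), (chi_zero (xi / 2 ^ j)); [ring| |].
      * rewrite Ad. now apply Hi.
      * rewrite Ad2. specialize (Lo j (3 / 2) H2). lra.
    + destruct (Nat.lt_ge_cases p j) as [L|L].
      * assert (Q := two_pow_le (S p) j ltac:(lia)). simpl in Q. assert (P := two_pow_pos p).
        rewrite (chi_zero (xi / 2 ^ p / 2)), (chi_zero (xi / 2 ^ p)); [ring| |].
        -- rewrite Ad. apply Hi. lra.
        -- rewrite Ad2. assert (G := Hi p (8 / 3) ltac:(lra)). lra.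
      * assert (Q := two_pow_le (S j) p ltac:(lia)). simpl in Q.
        rewrite (chi_one (xi / 2 ^ p / 2)), (chi_one (xi / 2 ^ p)); [ring| |].
        -- rewrite Ad. apply Lo. lra.
        -- rewrite Ad2. assert (G := Lo p (3 / 4) ltac:(lra)). lra.
Qed.

Lemma band_mult_const j k n : 4 / 3 * 2 ^ j < INR n <= 3 / 2 * 2 ^ j ->
  mult_const k (if Nat.eq_dec k (S j) then 1 else 0) n.
Proof.
  intros H. assert (Hn : Rabs (INR n) = INR n) by apply Rabs_pos_eq, pos_INR.
  split; [|split].
  - apply block_mult_band. now rewrite Hn.
  - apply block_mult_band. now rewrite Rabs_Ropp, Hn.
  - destruct (Nat.eq_dec k (S j)) as [->|N]; [left|now right].
    apply INR_le. rewrite INR_pow2. simpl. assert (P := two_pow_pos j). lra.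
Qed.

End Blocks.

(** [real] sends an infinite supremum to 0, so boundedness must be known before [Linf_norm]
    dominates any value; [block_bounded] supplies it for blocks. *)
Lemma Linf_norm_between (f : R -> C) M : (forall x, Cmod (f x) <= M) ->
  (forall x, Cmod (f x) <= Linf_norm f) /\ Linf_norm f <= M.
Proof.
  intros H. unfold Linf_norm. destruct (Lub_Rbar_correct (fun r => exists x, r = Cmod (f x))) as [U L].
  assert (LM : Rbar_le (Lub_Rbar (fun r => exists x, r = Cmod (f x))) (Finite M)).
  { apply L. intros r [x ->]. apply H. }
  assert (L0 := U (Cmod (f 0)) (ex_intro _ 0 eq_refl)).
  destruct (Lub_Rbar _) as [l| |]; simpl in *; try contradiction. split; [|exact LM].
  intros x. exact (U (Cmod (f x)) (ex_intro _ x eq_refl)).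
Qed.

Lemma Cmod_le_sum (z : C) : Cmod z <= Rabs (fst z) + Rabs (snd z).
Proof.
  replace z with (Cplus (RtoC (fst z)) (0, snd z)%R) at 1.
  - eapply Rle_trans; [apply Cmod_triangle|]. rewrite Cmod_R. apply Rplus_le_compat_l.
    unfold Cmod. cbn [fst snd]. rewrite pow_i, Rplus_0_l by lia. rewrite <- (pow2_abs (snd z)), sqrt_pow2 by apply Rabs_pos. lra.
  - apply injective_projections; unfold Cplus, RtoC; cbn [fst snd]; ring.
Qed.

Lemma sum_n_bounded (F : R -> nat -> R) M : (forall i, exists B, forall x, Rabs (F x i) <= B) ->
  exists B, forall x, Rabs (sum_n (F x) M) <= B.
Proof.
  intros H. induction M as [|M [B IH]].
  - destruct (H 0%nat) as [B HB]. exists B. intros x. rewrite sum_O. apply HB.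
  - destruct (H (S M)) as [B' HB]. exists (B + B'). intros x. rewrite sum_Sn.
    eapply Rle_trans; [apply Rabs_triang|]. specialize (IH x). specialize (HB x). lra.
Qed.

Lemma block_bounded chi k u : exists B, forall x, Cmod (dyadic_block chi k u x) <= B.
Proof.
  assert (PIpos := PI_RGT_0). set (N := (2 ^ S k)%nat).
  assert (trivial_bound : forall m a b x y, Rabs x <= 1 -> Rabs y <= 1 -> Rabs (m * (a * x + b * y)) <= Rabs m * (Rabs a + Rabs b)).
  { intros m a b x y Hx Hy. rewrite Rabs_mult. apply Rmult_le_compat_l; [apply Rabs_pos|].
    eapply Rle_trans; [apply Rabs_triang|]. rewrite !Rabs_mult. assert (P := Rabs_pos a). assert (Q := Rabs_pos b). nra. }
  assert (sub_form : forall m a b x y : R, m * (a * x - b * y) = m * (a * x + - b * y)) by (intros; ring).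
  assert (HC : forall x, Rabs (cos x) <= 1) by (intros x; apply Rabs_le, COS_bound).
  assert (HS : forall x, Rabs (sin x) <= 1) by (intros x; apply Rabs_le, SIN_bound).
  destruct (sum_n_bounded (fun x i => block_mult chi k (INR i - INR N) *
    (cos_coef u (INR i - INR N) * cos (x * (INR i - INR N)) + sin_coef u (INR i - INR N) * sin (x * (INR i - INR N)))) (2 * N)) as [B1 H1].
  { intros i. eexists. intros x. apply trivial_bound; auto. }
  destruct (sum_n_bounded (fun x i => block_mult chi k (INR i - INR N) *
    (cos_coef u (INR i - INR N) * sin (x * (INR i - INR N)) - sin_coef u (INR i - INR N) * cos (x * (INR i - INR N)))) (2 * N)) as [B2 H2].
  { intros i. eexists. intros x. rewrite sub_form. apply trivial_bound; auto. }
  exists (/ (2 * PI) * B1 + / (2 * PI) * B2). intros x. eapply Rle_trans; [apply Cmod_le_sum|].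
  assert (P : 0 < / (2 * PI)) by (apply Rinv_0_lt_compat; lra).
  rewrite block_re, block_im, !Rabs_mult, (Rabs_pos_eq (/ (2 * PI))) by lra.
  apply Rplus_le_compat; apply Rmult_le_compat_l; try lra; [apply H1|apply H2].
Qed.

Lemma block_le_Linf chi k u x : Cmod (dyadic_block chi k u x) <= Linf_norm (dyadic_block chi k u).
Proof. destruct (block_bounded chi k u) as [B HB]. apply (Linf_norm_between _ B HB). Qed.

Lemma Linf_block_nonneg chi k u : 0 <= Linf_norm (dyadic_block chi k u).
Proof. eapply Rle_trans; [apply Cmod_ge_0|apply (block_le_Linf chi k u 0)]. Qed.

Lemma besov_ge_partial chi f M : Rbar_le (Finite (sum_n (fun k => 2 ^ k / 2 * Linf_norm (dyadic_block chi k f)) M)) (besov_1_inf_1 chi f).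
Proof.
  unfold besov_1_inf_1. set (u := fun M : nat => Finite _).
  change (Rbar_le (u M) (Sup_seq u)). apply (Sup_seq_minor_le u (u M) M). apply Rbar_le_refl.
Qed.

Lemma besov_lower_sum chi f c i0 N : 0 <= c -> (forall i, (i0 <= i < N)%nat -> c <= 2 ^ (i + 6) * Linf_norm (dyadic_block chi (S (i + 6)) f)) ->
  Rbar_le (Finite (INR (N - i0) * c)) (besov_1_inf_1 chi f).
Proof.
  intros Hc H. eapply Rbar_le_trans; [|apply (besov_ge_partial chi f (N + 6))]. simpl.
  set (t := fun k => 2 ^ k / 2 * Linf_norm (dyadic_block chi k f)).
  assert (Ht : forall k, 0 <= t k).
  { intros k. apply Rmult_le_pos; [|apply Linf_block_nonneg]. assert (P := two_pow_pos k). lra. }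
  assert (Hnn : forall M, 0 <= sum_n t M).
  { induction M as [|M IH]; [rewrite sum_O; apply Ht|]. rewrite sum_Sn. apply Rplus_le_le_0_compat; auto. }
  induction N as [|N IH].
  - simpl. rewrite Rmult_0_l. apply Hnn.
  - change (S N + 6)%nat with (S (N + 6)). rewrite sum_Sn. change (@plus R_AbelianMonoid) with Rplus.
    destruct (le_lt_dec i0 N) as [L|L].
    + replace (S N - i0)%nat with (S (N - i0)) by lia. rewrite S_INR.
      (* The block of index [S (N + 6)] has weight [2 ^ S (N + 6) / 2], that is [2 ^ (N + 6)]. *)
      specialize (IH (fun i Hi => H i ltac:(lia))). specialize (H N ltac:(lia)).
      assert (E : t (S (N + 6)) = 2 ^ (N + 6) * Linf_norm (dyadic_block chi (S (N + 6)) f)).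
      { unfold t. simpl (2 ^ S (N + 6)). field. }
      rewrite E. lra.
    + replace (S N - i0)%nat with 0%nat by lia. simpl INR. rewrite Rmult_0_l.
      apply Rplus_le_le_0_compat; auto.
Qed.

(** With one nonzero block the partial sums are 0 before the index [S j] and do not change after
    it. *)
Lemma besov_upper_single chi f j B : 0 <= B ->
  (forall k, Linf_norm (dyadic_block chi k f) <= if Nat.eq_dec k (S j) then B else 0) ->
  Rbar_le (besov_1_inf_1 chi f) (Finite (2 ^ j * B)).
Proof.
  intros HB H. unfold besov_1_inf_1.
  match goal with |- Rbar_le (Sup_seq ?u) _ => set (v := u) end.
  apply (proj2 (is_sup_seq_lub v (Sup_seq v) (Sup_seq_correct v))).
  intros x [M ->]. unfold v.
  apply (Rle_trans _ (if le_dec (S j) M then 2 ^ j * B else 0)).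
  - assert (P := two_pow_pos j). induction M as [|M IH].
    + rewrite sum_O. specialize (H 0%nat). simpl in *. lra.
    + rewrite sum_Sn. change (@plus R_AbelianMonoid) with Rplus. specialize (H (S M)).
      assert (P' := two_pow_pos (S M)). assert (L0 := Linf_block_nonneg chi (S M) f).
      destruct (Nat.eq_dec (S M) (S j)) as [E|N].
      * injection E as ->. destruct (le_dec (S j) j); [lia|]. destruct (le_dec (S j) (S j)); [|lia].
        assert (2 ^ S j / 2 * Linf_norm (dyadic_block chi (S j) f) <= 2 ^ j * B).
        { replace (2 ^ S j / 2) with (2 ^ j) by (simpl; field). apply Rmult_le_compat_l; lra. }
        lra.
      * replace (Linf_norm (dyadic_block chi (S M) f)) with 0 by lra. rewrite Rmult_0_r, Rplus_0_r.
        destruct (le_dec (S j) M), (le_dec (S j) (S M)); try lia; exact IH.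
  - assert (P := two_pow_pos j). destruct le_dec; [lra|]. apply Rmult_le_pos; lra.
Qed.

(** With [2 ^ 6 = 64], the band of order [i + 6] runs from below [86 * 2 ^ i] to [96 * 2 ^ i], and
    so contains all frequencies of [theta i]. *)
Lemma band_theta chi i n : admissible_chi chi -> (87 * 2 ^ i <= n <= 93 * 2 ^ i)%nat -> mult_const chi (S (i + 6)) 1 n.
Proof.
  intros Hchi [H1 H2]. assert (P := two_pow_pos i).
  apply le_INR in H1. apply le_INR in H2. rewrite mult_INR, INR_pow2 in H1, H2.
  replace (INR 87) with 87 in H1 by (simpl; ring). replace (INR 93) with 93 in H2 by (simpl; ring).
  assert (G := band_mult_const chi Hchi (i + 6) (S (i + 6)) n). destruct Nat.eq_dec; [|congruence]. apply G.
  rewrite pow_add. simpl (2 ^ 6). lra.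
Qed.

Lemma RInt_period_abs (f : R -> R) z : (forall x : R, continuous f x) -> periodic f ->
  RInt (fun x => f (x - z)) 0 (2 * PI) = RInt f (- PI) PI.
Proof.
  intros Cf Pf. change (RInt (fun x => f (x + - z)) 0 (2 * PI) = RInt f (- PI) PI). rewrite (RInt_shift f 0 (2 * PI) (- z)) by auto.
  replace (2 * PI + - z) with (0 + - z + 2 * PI) by ring. rewrite RInt_periodic_shift by auto.
  replace PI with (- PI + 2 * PI) at 3 by ring. now rewrite RInt_periodic_shift.
Qed.

Lemma theta_periodic i : periodic (theta i). Proof. eapply trig_periodic, theta_trig. Qed.
Lemma dtheta_periodic i : periodic (dtheta i). Proof. eapply trig_periodic, dtheta_trig. Qed.

Lemma dtheta_L1 i : RInt (fun x => Rabs (dtheta i x)) (- PI) PI <= Kth * (2 ^ i * PI).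
Proof.
  assert (PIpos := PI_RGT_0). assert (P := two_pow_pos i). assert (HK : 0 < Kth) by (unfold Kth; lra).
  apply Rle_trans with (RInt (fun x => Kth * 2 ^ i * mu i x) (- PI) PI).
  - apply RInt_le; [lra| | |].
    + apply ex_RInt_cont. intros x. apply (continuous_comp (dtheta i) Rabs); [apply dtheta_cont|apply continuous_Rabs].
    + apply ex_RInt_cont. intros x. cont. apply mu_cont.
    + intros x Hx. rewrite Rmult_assoc. apply theta_bounds. apply Rabs_le. lra.
  - rewrite RInt_scal_cont by (intros; apply mu_cont). assert (M := mu_integral i).
    replace (Kth * (2 ^ i * PI)) with (Kth * 2 ^ i * PI) by ring. apply Rmult_le_compat_l; [nra|exact M].
Qed.

(** Duality: the derivative is moved onto the test function, whose frequencies the block preserves.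
    The [L^1] norm of [dtheta i] is of order [2 ^ i], which is the weight of the block in the norm
    [B^1_{oo,1}]. *)
Lemma block_lower chi i (w dw : R -> R) z : admissible_chi chi -> periodic w ->
  (forall x : R, is_derive w x (dw x)) -> (forall x : R, continuous dw x) ->
  Rabs (RInt (fun x => dw x * theta i (x - z)) 0 (2 * PI)) <= Kth * PI * (2 ^ (i + 6) * Linf_norm (dyadic_block chi (S (i + 6)) w)).
Proof.
  intros Hchi Pw Dw Cdw. assert (PIpos := PI_RGT_0). assert (P := two_pow_pos i). assert (HK : 0 < Kth) by (unfold Kth; lra).
  assert (Cw : forall x : R, continuous w x) by (intros; eapply continuous_of_derive, Dw).
  assert (Csh : forall (f : R -> R) x, (forall y : R, continuous f y) -> continuous (fun x => f (x - z)) x).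
  { intros f x Hf. apply (continuous_comp (fun x => x - z) f); auto. cont. }
  assert (Cth : forall x, continuous (fun x => theta i (x - z)) x) by (intros; apply Csh; apply theta_cont).
  assert (Cdth : forall x, continuous (fun x => dtheta i (x - z)) x) by (intros; apply Csh; apply dtheta_cont).
  assert (E : RInt (fun x => dw x * theta i (x - z)) 0 (2 * PI) = - RInt (fun x => w x * dtheta i (x - z)) 0 (2 * PI)).
  { assert (B : RInt (fun x => dw x * theta i (x - z) + w x * dtheta i (x - z)) 0 (2 * PI) = 0).
    { rewrite (RInt_derive (fun x => w x * theta i (x - z))).
      - rewrite <- (Rplus_0_l (2 * PI)) at 1 2. rewrite Pw. replace (0 + 2 * PI - z) with (0 - z + 2 * PI) by ring.
        rewrite theta_periodic. apply Rminus_diag_eq. reflexivity.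
      - intros x. assert (D : is_derive (fun x => theta i (x - z)) x (dtheta i (x - z))).
        { rewrite <- (Rmult_1_l (dtheta i (x - z))). apply (is_derive_comp (theta i) (fun x => x - z)); [apply theta_deriv|]. auto_derive; auto. }
        apply (is_derive_mult w (fun x => theta i (x - z))); auto. intros; apply Rmult_comm.
      - intros x. cont. }
    rewrite RInt_plus_cont in B by (intros; cont). lra. }
  rewrite E, Rabs_Ropp.
  rewrite <- (block_pairing chi (S (i + 6)) (87 * 2 ^ i) (93 * 2 ^ i)); auto.
  2:{ intros n Hn. now apply band_theta. }
  2:{ apply trig_shift, dtheta_trig. }
  set (L := Linf_norm (dyadic_block chi (S (i + 6)) w)).
  assert (HL : 0 <= L) by apply Linf_block_nonneg.
  assert (Cb : forall x : R, continuous (fun x => fst (dyadic_block chi (S (i + 6)) w x)) x).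
  { intros x. eapply continuous_ext; [intros; symmetry; apply block_re|]. cont.
    set (N := (2 ^ S (S (i + 6)))%nat).
    apply (sum_n_cont (fun j x => block_mult chi (S (i + 6)) (INR j - INR N) * (cos_coef w (INR j - INR N) * cos (x * (INR j - INR N)) + sin_coef w (INR j - INR N) * sin (x * (INR j - INR N))))).
    intros j. cont; auto using cos_cont_r, sin_cont_r. }
  assert (Cabs : forall x : R, continuous (fun x => Rabs (dtheta i x)) x).
  { intros x. apply (continuous_comp (dtheta i) Rabs); [apply dtheta_cont|apply continuous_Rabs]. }
  eapply Rle_trans; [apply abs_RInt_le; [lra|]|].
  { apply ex_RInt_cont. intros x. apply (continuous_mult (fun x => fst (dyadic_block chi (S (i + 6)) w x)) (fun x => dtheta i (x - z))); auto. }
  apply Rle_trans with (RInt (fun x => L * Rabs (dtheta i (x - z))) 0 (2 * PI)).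
  - apply RInt_le; [lra| | |].
    + apply ex_RInt_cont. intros x. apply (continuous_comp (fun x => fst (dyadic_block chi (S (i + 6)) w x) * dtheta i (x - z)) Rabs); [|apply continuous_Rabs].
      apply (continuous_mult (fun x => fst (dyadic_block chi (S (i + 6)) w x)) (fun x => dtheta i (x - z))); auto.
    + apply ex_RInt_cont. intros x. cont. apply (Csh (fun x => Rabs (dtheta i x))). auto.
    + intros x _. rewrite Rabs_mult. apply Rmult_le_compat_r; [apply Rabs_pos|].
      apply Rle_trans with (2 := block_le_Linf chi (S (i + 6)) w x).
      exact (Rle_trans _ _ _ (Rmax_l _ _) (Rmax_Cmod (dyadic_block chi (S (i + 6)) w x))).
  - rewrite RInt_scal_cont by (intros; apply (Csh (fun x => Rabs (dtheta i x))); auto).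
    rewrite (RInt_period_abs (fun x => Rabs (dtheta i x))) by (auto; intros x; now rewrite dtheta_periodic).
    assert (B := dtheta_L1 i). rewrite pow_add. simpl (2 ^ 6).
    apply Rle_trans with (L * (Kth * (2 ^ i * PI))); [apply Rmult_le_compat_l; auto|].
    assert (0 <= L * (Kth * (2 ^ i * PI))) by pos. lra.
Qed.

(** * Growth of the dyadic blocks of the gradient *)

Lemma Kth_pos : 0 < Kth. Proof. unfold Kth. lra. Qed.

Section NearIdentity.
Variables (i : nat) (q p : R -> R) (eta : R).
Hypothesis p_deriv : forall x : R, is_derive p x (q x).
Hypothesis q_cont : forall x : R, continuous q x.
Hypothesis p_0 : p 0 = 0.
Hypothesis q_near : forall x, Rabs (q x - 1) <= eta.
Hypothesis eta_small : eta <= / 4.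

Lemma near_identity x : Rabs (p x - x) <= eta * Rabs x.
Proof.
  destruct (MVT_gen (fun x => p x - x) 0 x (fun x => q x - 1)) as [c [_ E]].
  - intros y _. apply (is_derive_minus p (fun x => x)); auto. apply @is_derive_id.
  - intros y _. apply continuity_pt_of_continuous. apply (continuous_minus p (fun x => x)); [eapply continuous_of_derive, p_deriv|apply continuous_id].
  - rewrite p_0 in E. replace (p x - x) with ((q c - 1) * (x - 0)) by lra. rewrite Rabs_mult, Rminus_0_r.
    apply Rmult_le_compat_r; [apply Rabs_pos|apply q_near].
Qed.

Lemma between_near_identity x c : Rabs x <= PI -> Rmin x (p x) <= c <= Rmax x (p x) -> Rabs c <= 4 * PI / 3 /\ Rabs x <= 2 * Rabs c.
Proof.
  intros Hx Hc. assert (PIpos := PI_RGT_0). assert (N := near_identity x).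
  assert (N' : Rabs (p x - x) <= / 4 * Rabs x).
  { eapply Rle_trans; [exact N|]. apply Rmult_le_compat_r; [apply Rabs_pos|exact eta_small]. }
  unfold Rmin, Rmax in Hc. revert Hx N'. destruct Rle_dec; unfold Rabs; repeat destruct Rcase_abs; intros; lra.
Qed.

(** The displacement [p x - x] is at most [eta * Rabs x], and [Rabs x * Rabs (dtheta i x)] is
    bounded by [mu] without any power of [2 ^ i]. Fixing the origin therefore makes the cost of
    transport [eta], uniformly in the scale. *)
Lemma theta_shift_bounds x : Rabs x <= PI ->
  Rabs (theta i (p x)) <= 4 * Kth * mu i x /\ 2 ^ i * (Rabs x * Rabs (theta i (p x))) <= 8 * Kth * mu i x /\
  Rabs (theta i (p x) - theta i x) <= 8 * eta * Kth * mu i x.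
Proof.
  intros Hx. assert (P := two_pow_pos i). assert (HK := Kth_pos).
  destruct (between_near_identity x (p x) Hx) as [B1 B2]; [split; [apply Rmin_r|apply Rmax_r]|].
  destruct (theta_bounds i (p x) B1) as [T1 [T2 _]]. assert (M := mu_half i x (p x) B2).
  assert (A1 : Rabs (theta i (p x)) <= 4 * Kth * mu i x).
  { eapply Rle_trans; [exact T1|]. replace (4 * Kth * mu i x) with (Kth * (4 * mu i x)) by ring. apply Rmult_le_compat_l; lra. }
  split; [exact A1|]. split.
  - apply Rle_trans with (2 * (2 ^ i * (Rabs (p x) * Rabs (theta i (p x))))).
    + replace (2 * (2 ^ i * (Rabs (p x) * Rabs (theta i (p x))))) with (2 ^ i * (2 * Rabs (p x) * Rabs (theta i (p x)))) by ring.
      apply Rmult_le_compat_l; [lra|]. apply Rmult_le_compat_r; [apply Rabs_pos|exact B2].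
    + replace (8 * Kth * mu i x) with (2 * (Kth * (4 * mu i x))) by ring. apply Rmult_le_compat_l; [lra|].
      eapply Rle_trans; [exact T2|]. apply Rmult_le_compat_l; lra.
  - destruct (MVT_gen (theta i) x (p x) (dtheta i)) as [c [Hc E]].
    + intros y _. apply theta_deriv.
    + intros y _. apply continuity_pt_of_continuous, theta_cont.
    + rewrite E, Rabs_mult. destruct (between_near_identity x c Hx Hc) as [C1 C2].
      destruct (theta_bounds i c C1) as [_ [_ [T3 _]]]. assert (M' := mu_half i x c C2).
      assert (N := near_identity x). assert (Q := Rabs_pos (dtheta i c)). assert (Qc := Rabs_pos c). assert (Qx := Rabs_pos x).
      assert (He : 0 <= eta) by (eapply Rle_trans; [apply Rabs_pos|apply (q_near 0)]).
      apply Rle_trans with (Rabs (dtheta i c) * (eta * (2 * Rabs c))).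
      * apply Rmult_le_compat_l; [exact Q|]. eapply Rle_trans; [exact N|]. apply Rmult_le_compat_l; auto.
      * replace (Rabs (dtheta i c) * (eta * (2 * Rabs c))) with (2 * eta * (Rabs c * Rabs (dtheta i c))) by ring.
        replace (8 * eta * Kth * mu i x) with (2 * eta * (Kth * (4 * mu i x))) by ring.
        apply Rmult_le_compat_l; [lra|]. eapply Rle_trans; [exact T3|]. apply Rmult_le_compat_l; lra.
Qed.

Lemma RInt_mu_bound (f : R -> R) B : 0 <= B -> (forall x : R, continuous f x) -> (forall x, Rabs x <= PI -> Rabs (f x) <= B * mu i x) ->
  Rabs (RInt f (- PI) PI) <= B * PI.
Proof.
  intros HB Cf Hf. assert (PIpos := PI_RGT_0).
  eapply Rle_trans; [apply abs_RInt_le; [lra|now apply ex_RInt_cont]|].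
  apply Rle_trans with (RInt (fun x => B * mu i x) (- PI) PI).
  - apply RInt_le; [lra| | |].
    + apply ex_RInt_cont. intros x. apply (continuous_comp f Rabs); auto. apply continuous_Rabs.
    + apply ex_RInt_cont. intros x. cont. apply mu_cont.
    + intros x Hx. apply Hf. apply Rabs_le. lra.
  - rewrite RInt_scal_cont by (intros; apply mu_cont). apply Rmult_le_compat_l; [exact HB|apply mu_integral].
Qed.

Variables (k t M0 : R) (u0 d h E : R -> R).
Hypothesis k_nonneg : 0 <= k.
Hypothesis t_nonneg : 0 <= t.
Hypothesis eta_eq : eta = 2 * k * t.
Hypothesis p_shift : forall x, p (x + 2 * PI) = p x + 2 * PI.
Hypothesis u0_periodic : periodic u0.
Hypothesis u0_deriv : forall x : R, is_derive u0 x (d x).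
Hypothesis d_cont : forall x : R, continuous d x.
Hypothesis u0_bound : forall x, Rabs (u0 x) <= M0.
Hypothesis d_bound : forall x, Rabs (d x) <= k.
Hypothesis h_cont : forall x : R, continuous h x.
Hypothesis h_lip : forall x, Rabs (h x - h 0) <= 5 * k ^ 2 * t * Rabs x.
Hypothesis E_cont : forall x : R, continuous E x.
Hypothesis E_bound : forall x, Rabs (E x) <= 7 * k ^ 3 * t ^ 2.

Lemma p_cont x : continuous p x. Proof. eapply continuous_of_derive, p_deriv. Qed.
Lemma theta_p_cont x : continuous (fun x => theta i (p x)) x.
Proof. apply (continuous_comp p (theta i)); [apply p_cont|apply theta_cont]. Qed.

Lemma p_period : p PI = p (- PI) + 2 * PI.
Proof. rewrite <- p_shift. f_equal. ring. Qed.

Lemma q_le_2 x : Rabs (q x) <= 2.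
Proof. assert (H := q_near x). apply Rabs_le_between in H. apply Rabs_le. lra. Qed.

(** With the Jacobian included, the change of variables is exact and the mean of [theta] is 0. The
    value [h 0] of the Lipschitz part thus drops out, leaving an increment that vanishes at the
    origin. *)
Lemma transported_mean : RInt (fun x => q x * theta i (p x)) (- PI) PI = 0.
Proof.
  transitivity (RInt (theta i) (p (- PI)) (p PI)).
  - apply (RInt_comp (theta i) p q); intros; [apply theta_cont|split; auto].
  - rewrite p_period, RInt_periodic_shift by auto using theta_cont, theta_periodic.
    eapply trig_mean; [apply theta_trig|]. assert (H := pow2_nat_pos i). lia.
Qed.

(** One integration by parts exchanges [d] for [u0], whose size [M0] will be of order [eps / L]; the
    loss [4 ^ i] is then harmless. *)
Lemma oscillating_part : Rabs (RInt (fun x => d x * theta i (p x)) (- PI) PI) <= 1500 * 4 ^ i * M0.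
Proof.
  assert (PIpos := PI_RGT_0).
  assert (Cdp : forall x : R, continuous (fun x => dtheta i (p x)) x).
  { intros x. apply (continuous_comp p (dtheta i)); [apply p_cont|apply dtheta_cont]. }
  assert (Cu0 : forall x : R, continuous u0 x) by (intros; eapply continuous_of_derive, u0_deriv).
  assert (B : RInt (fun x => d x * theta i (p x) + u0 x * (q x * dtheta i (p x))) (- PI) PI = 0).
  { rewrite (RInt_derive (fun x => u0 x * theta i (p x))).
    - rewrite p_period, theta_periodic. replace PI with (- PI + 2 * PI) at 1 by ring. rewrite u0_periodic.
      apply Rminus_diag_eq. reflexivity.
    - intros x. apply (is_derive_mult u0 (fun x => theta i (p x))); auto; [|intros; apply Rmult_comm].
      apply (is_derive_comp (theta i) p); auto. apply theta_deriv.
    - intros x. cont. apply theta_p_cont. }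
  rewrite RInt_plus_cont in B by (intros; cont; apply theta_p_cont).
  assert (M0p : 0 <= M0) by (eapply Rle_trans; [apply Rabs_pos|apply (u0_bound 0)]).
  assert (P4 : 0 < 4 ^ i) by (apply pow_lt; lra).
  replace (RInt (fun x => d x * theta i (p x)) (- PI) PI) with (- RInt (fun x => u0 x * (q x * dtheta i (p x))) (- PI) PI) by lra.
  rewrite Rabs_Ropp. eapply Rle_trans; [apply RInt_abs_le with (K := M0 * (2 * (93 * 4 ^ i)))|].
  - intros x. cont.
  - intros x _. rewrite !Rabs_mult. destruct (theta_crude i (p x)) as [_ C].
    apply Rmult_le_compat; auto using Rabs_pos. apply Rmult_le_pos; apply Rabs_pos.
    apply Rmult_le_compat; auto using Rabs_pos, q_le_2.
  - replace (PI - - PI) with (2 * PI) by ring. rewrite Rabs_pos_eq by lra. assert (PI4 := PI_4).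
    assert (0 <= M0 * 4 ^ i) by (apply Rmult_le_pos; lra). nra.
Qed.

(** Four errors are collected: the linear term, the transport of [theta] in the quadratic term, the
    increment of [h], and [E]. The constant [36] is [8 + 7 * 4], from the transport error and [E];
    [80] is [2 * 5 * 8], from the Jacobian, the Lipschitz constant of [h] and the weighted bound on
    [theta]. *)
Lemma pairing_estimate :
  Rabs (RInt (fun x => (d x + t / 2 * d x ^ 2 + q x * h x + E x) * theta i (p x)) (- PI) PI
        - t / 2 * RInt (fun x => d x ^ 2 * theta i x) (- PI) PI)
  <= 1500 * 4 ^ i * M0 + 36 * Kth * PI * (k ^ 3 * t ^ 2) + 80 * Kth * PI * (k ^ 2 * t * / 2 ^ i).
Proof.
  assert (PIpos := PI_RGT_0). assert (P := two_pow_pos i). assert (HK := Kth_pos).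
  assert (Ct := theta_p_cont). assert (Ct0 := theta_cont i). assert (Cu0 : forall x : R, continuous u0 x) by (intros; eapply continuous_of_derive, u0_deriv).
  set (F2 := fun x => d x ^ 2 * (theta i (p x) - theta i x)).
  set (F3 := fun x => q x * (h x - h 0) * theta i (p x)).
  set (F4 := fun x => E x * theta i (p x)).
  assert (C2 : forall x : R, continuous F2 x) by (intros; unfold F2; cont).
  assert (C3 : forall x : R, continuous F3 x) by (intros; unfold F3; cont).
  assert (C4 : forall x : R, continuous F4 x) by (intros; unfold F4; cont).
  assert (Split : RInt (fun x => (d x + t / 2 * d x ^ 2 + q x * h x + E x) * theta i (p x)) (- PI) PI
        - t / 2 * RInt (fun x => d x ^ 2 * theta i x) (- PI) PI =
      RInt (fun x => d x * theta i (p x)) (- PI) PI + t / 2 * RInt F2 (- PI) PI + RInt F3 (- PI) PI + RInt F4 (- PI) PI).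
  { rewrite (RInt_ext_all _ (fun x => d x * theta i (p x) + (t / 2 * F2 x + (t / 2 * (d x ^ 2 * theta i x) + (F3 x + (h 0 * (q x * theta i (p x)) + F4 x)))))).
    2:{ intros x. unfold F2, F3, F4. toR; field. }
    rewrite !RInt_plus_cont, !RInt_scal_cont, transported_mean by (intros; cont). toR; ring. }
  rewrite Split.
  assert (A1 := oscillating_part).
  assert (Kt : 0 <= k ^ 3 * t ^ 2) by (apply Rmult_le_pos; apply pow_le; auto).
  assert (Kt2 : 0 <= k ^ 2 * t) by (apply Rmult_le_pos; auto; apply pow_le; auto).
  assert (A2 : Rabs (RInt F2 (- PI) PI) <= k ^ 2 * (8 * eta * Kth) * PI).
  { apply RInt_mu_bound; auto.
    - rewrite eta_eq. pos.
    - intros x Hx. unfold F2. rewrite Rabs_mult, <- RPow_abs. destruct (theta_shift_bounds x Hx) as [_ [_ B]].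
      replace (k ^ 2 * (8 * eta * Kth) * mu i x) with (k ^ 2 * (8 * eta * Kth * mu i x)) by ring.
      apply Rmult_le_compat; auto using Rabs_pos. apply pow_le, Rabs_pos. apply pow_incr. split; [apply Rabs_pos|auto]. }
  assert (A3 : Rabs (RInt F3 (- PI) PI) <= 80 * Kth * (k ^ 2 * t * / 2 ^ i) * PI).
  { assert (Pi : 0 < / 2 ^ i) by now apply Rinv_0_lt_compat.
    apply RInt_mu_bound; auto.
    - assert (0 <= k ^ 2 * t * / 2 ^ i) by (apply Rmult_le_pos; lra). nra.
    - intros x Hx. unfold F3. rewrite !Rabs_mult. destruct (theta_shift_bounds x Hx) as [_ [B _]].
      assert (B' : Rabs x * Rabs (theta i (p x)) <= / 2 ^ i * (8 * Kth * mu i x)).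
      { apply Rmult_le_reg_l with (2 ^ i); [exact P|]. rewrite <- Rmult_assoc, <- Rmult_assoc, Rinv_r, Rmult_1_l, Rmult_assoc; [exact B|lra]. }
      apply Rle_trans with (2 * (5 * k ^ 2 * t * Rabs x) * Rabs (theta i (p x))).
      + apply Rmult_le_compat_r; [apply Rabs_pos|]. apply Rmult_le_compat; auto using Rabs_pos, q_le_2.
      + replace (2 * (5 * k ^ 2 * t * Rabs x) * Rabs (theta i (p x))) with (10 * (k ^ 2 * t) * (Rabs x * Rabs (theta i (p x)))) by ring.
        replace (80 * Kth * (k ^ 2 * t * / 2 ^ i) * mu i x) with (10 * (k ^ 2 * t) * (/ 2 ^ i * (8 * Kth * mu i x))) by ring.
        apply Rmult_le_compat_l; [lra|exact B']. }
  assert (A4 : Rabs (RInt F4 (- PI) PI) <= 7 * (k ^ 3 * t ^ 2) * (4 * Kth) * PI).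
  { apply RInt_mu_bound; auto.
    - pos.
    - intros x Hx. unfold F4. rewrite Rabs_mult. destruct (theta_shift_bounds x Hx) as [B _].
      replace (7 * (k ^ 3 * t ^ 2) * (4 * Kth) * mu i x) with (7 * k ^ 3 * t ^ 2 * (4 * Kth * mu i x)) by ring.
      apply Rmult_le_compat; auto using Rabs_pos. }
  assert (A2' : Rabs (t / 2 * RInt F2 (- PI) PI) <= 8 * Kth * PI * (k ^ 3 * t ^ 2)).
  { rewrite Rabs_mult, (Rabs_pos_eq (t / 2)) by lra. apply Rle_trans with (t / 2 * (k ^ 2 * (8 * eta * Kth) * PI)).
    - apply Rmult_le_compat_l; lra.
    - rewrite eta_eq. right. field. }
  eapply Rle_trans; [apply Rabs_triang|]. eapply Rle_trans; [apply Rplus_le_compat_r, Rabs_triang|].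
  eapply Rle_trans; [apply Rplus_le_compat_r, Rplus_le_compat_r, Rabs_triang|]. lra.
Qed.

End NearIdentity.

Lemma exp_near_0 r : Rabs r <= / 8 -> Rabs (exp r - 1) <= 2 * Rabs r /\ Rabs (exp r - 1 - r) <= 2 * r ^ 2.
Proof.
  assert (E8 : exp (/ 8) <= 2).
  { assert (H := exp_ineq1_le (- / 8)). rewrite exp_Ropp in H. assert (P := exp_pos (/ 8)).
    assert (Q : exp (/ 8) * / exp (/ 8) = 1) by (apply Rinv_r; lra). nra. }
  assert (L : forall c, Rabs c <= / 8 -> Rabs (exp c - 1) <= 2 * Rabs c).
  { intros c Hc. rewrite <- exp_0. eapply Rle_trans; [apply (exp_abs_diff c 0 (/ 8)); auto; rewrite Rabs_R0; lra|].
    rewrite Rminus_0_r. apply Rmult_le_compat_r; [apply Rabs_pos|exact E8]. }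
  intros Hr. split; [now apply L|].
  destruct (MVT_gen (fun x => exp x - x) 0 r (fun x => exp x - 1)) as [c [Hc E]].
  - intros y _. auto_derive; auto; ring.
  - intros y _. apply continuity_pt_of_continuous. apply (continuous_minus exp (fun x => x)); [apply continuous_exp|apply continuous_id].
  - rewrite exp_0 in E. replace (exp r - 1 - r) with ((exp c - 1) * (r - 0)) by lra.
    assert (Hcr : Rabs c <= Rabs r).
    { unfold Rmin, Rmax in Hc. destruct Rle_dec; unfold Rabs; repeat destruct Rcase_abs; lra. }
    rewrite Rabs_mult, Rminus_0_r, <- (pow2_abs r). assert (G := L c ltac:(lra)). assert (Q := Rabs_pos r). nra.
Qed.

(** * Second-order expansion of the gradient along the flow *)

Section Inflation.
Variable T : R.
Variable m0 : R -> R.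
Variable r : R -> R -> R.
Hypothesis HF : lagrangian_flow T m0 r.
Variables (k t : R).
Hypothesis k_nonneg : 0 <= k.
Hypothesis ab_bound : forall s x, 0 <= s <= T -> Rabs (la m0 r s x) <= k /\ Rabs (lb m0 r s x) <= k.
Hypothesis t_range : 0 <= t < T.
Hypothesis kt_small : 8 * (k * t) <= 1.
Variables u0 d : R -> R.
Hypothesis V_init : forall x, lV m0 r 0 x = d x.

(** By [lV_dt] and [la * lb = lU ^ 2 - lV ^ 2], the time derivative of [lV] is [- lV ^ 2 / 2] plus
    this source. Its [x]-derivative involves no derivative of [lV], so its integral is Lipschitz
    even though [lV] oscillates fast. *)
Definition smooth_source (s x : R) : R := / 2 * lU m0 r s x ^ 2 - / 4 * (lA T m0 r s x + lB T m0 r s x).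
Definition smooth_part (x : R) : R := RInt (fun s => smooth_source s x) 0 t.
(** The product [lq * lV] is expanded because a pairing in Eulerian variables produces the Jacobian
    [lq]. With [lq] close to [1 + t d] and [lV] close to [d - (t / 2) d ^ 2] plus [smooth_part], the
    terms kept are exactly those below third order in [d]. *)
Definition cubic_error (x : R) : R :=
  lq r t x * lV m0 r t x - d x - t / 2 * d x ^ 2 - lq r t x * smooth_part x.

Lemma source_cont2 : cont2 smooth_source.
Proof.
  unfold smooth_source. apply cont2_minus; apply cont2_mult; try apply cont2_const.
  - apply cont2_sq. eapply lU_cont2; exact HF.
  - apply cont2_plus; [apply lA_cont2|apply lB_cont2]; exact HF.
Qed.

Lemma V_bound s x : 0 <= s <= T -> Rabs (lV m0 r s x) <= k.
Proof.
  intros Hs. destruct (ab_bound s x Hs) as [A B]. rewrite lV_eq. apply Rabs_le_between in A. apply Rabs_le_between in B.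
  apply Rabs_le. lra.
Qed.

Lemma U_bound s x : 0 <= s <= T -> Rabs (lU m0 r s x) <= k.
Proof.
  intros Hs. destruct (ab_bound s x Hs) as [A B]. unfold lU. apply Rabs_le_between in A. apply Rabs_le_between in B.
  apply Rabs_le. lra.
Qed.

Lemma AB_bound s x : 0 <= s <= T -> Rabs (lA T m0 r s x) <= k ^ 2 /\ Rabs (lB T m0 r s x) <= k ^ 2.
Proof.
  intros Hs. split; [apply lA_bound|apply lB_bound]; auto; intros y; now apply ab_bound.
Qed.

Lemma d_bound' x : Rabs (d x) <= k.
Proof. rewrite <- V_init. apply V_bound. lra. Qed.

Lemma V_cont_time x s : continuous (fun s => lV m0 r s x) s.
Proof. apply (cont2_slice1 (lV m0 r)). eapply lV_cont2; exact HF. Qed.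

Lemma V_increment s x : 0 <= s <= t -> Rabs (lV m0 r s x - d x) <= k ^ 2 * s.
Proof.
  intros Hs. rewrite <- V_init. replace (k ^ 2 * s) with (k ^ 2 * (s - 0)) by ring.
  apply (MVT_bound (fun s => lV m0 r s x) (fun s => / 2 * la m0 r s x * lb m0 r s x - / 4 * (lA T m0 r s x + lB T m0 r s x))); [lra| | |].
  - intros y _. apply V_cont_time.
  - intros y Hy. apply lV_dt; auto. lra.
  - intros y Hy. destruct (ab_bound y x ltac:(lra)) as [A B]. destruct (AB_bound y x ltac:(lra)) as [A' B'].
    assert (Rabs (la m0 r y x * lb m0 r y x) <= k * k) by (rewrite Rabs_mult; apply Rmult_le_compat; auto using Rabs_pos).
    apply Rabs_le_between in H. apply Rabs_le_between in A'. apply Rabs_le_between in B'. apply Rabs_le. lra.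
Qed.

(** The remainder has time derivative [- (lV - d) (lV + d) / 2]; the first factor is at most
    [k ^ 2 * s] by [V_increment] and the second at most [2 * k]. *)
Lemma V_expansion x : Rabs (lV m0 r t x - d x + t / 2 * d x ^ 2 - smooth_part x) <= k ^ 3 * t ^ 2.
Proof.
  assert (CS : forall s : R, continuous (fun s => smooth_source s x) s) by (intros s; apply (cont2_slice1 smooth_source), source_cont2).
  set (D := fun s => lV m0 r s x - d x + s / 2 * d x ^ 2 - RInt (fun s => smooth_source s x) 0 s).
  assert (D0 : D 0 = 0).
  { unfold D. rewrite RInt_point, V_init. unfold zero; simpl. field. }
  assert (B : Rabs (D t - D 0) <= k ^ 3 * t * (t - 0)).
  { apply (MVT_bound D (fun s => (/ 2 * la m0 r s x * lb m0 r s x - / 4 * (lA T m0 r s x + lB T m0 r s x)) + / 2 * d x ^ 2 - smooth_source s x)); [lra| | |].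
    - intros s _. unfold D. apply (continuous_minus (fun s => lV m0 r s x - d x + s / 2 * d x ^ 2) (fun s => RInt (fun s => smooth_source s x) 0 s)).
      + apply (continuous_plus (fun s => lV m0 r s x - d x) (fun s => s / 2 * d x ^ 2)); [|unfold Rdiv; cont].
        apply (continuous_minus (fun s => lV m0 r s x) (fun _ => d x)); [apply V_cont_time|apply continuous_const].
      + eapply continuous_of_derive, (is_derive_RInt_cont (fun s => smooth_source s x)). exact CS.
    - intros s Hs. assert (Dv := lV_dt T m0 r HF s x ltac:(lra)). unfold D.
      apply (is_derive_minus (fun s => lV m0 r s x - d x + s / 2 * d x ^ 2) (fun s => RInt (fun s => smooth_source s x) 0 s)).
      + apply (is_derive_plus (fun s => lV m0 r s x - d x) (fun s => s / 2 * d x ^ 2)).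
        * match type of Dv with is_derive _ _ ?l => replace l with (l - 0) by ring end.
          apply (is_derive_minus (fun s => lV m0 r s x) (fun _ => d x)); [exact Dv|apply @is_derive_const].
        * auto_derive; auto. field.
      + apply (is_derive_RInt_cont (fun s => smooth_source s x)). exact CS.
    - intros s Hs. unfold smooth_source.
      replace (/ 2 * la m0 r s x * lb m0 r s x - / 4 * (lA T m0 r s x + lB T m0 r s x) + / 2 * d x ^ 2
         - (/ 2 * lU m0 r s x ^ 2 - / 4 * (lA T m0 r s x + lB T m0 r s x)))
        with (- (/ 2) * ((lV m0 r s x - d x) * (lV m0 r s x + d x))) by (unfold lU; rewrite lV_eq; field).
      rewrite !Rabs_mult, Rabs_Ropp, (Rabs_pos_eq (/ 2)) by lra.
      assert (V1 := V_increment s x ltac:(lra)).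
      assert (V2 : Rabs (lV m0 r s x + d x) <= 2 * k).
      { eapply Rle_trans; [apply Rabs_triang|]. assert (A := V_bound s x ltac:(lra)). assert (A' := d_bound' x). lra. }
      assert (Rabs (lV m0 r s x - d x) * Rabs (lV m0 r s x + d x) <= k ^ 2 * s * (2 * k)) by (apply Rmult_le_compat; auto using Rabs_pos).
      assert (k ^ 3 * s <= k ^ 3 * t) by (apply Rmult_le_compat_l; [apply pow_le; auto|lra]). lra. }
  rewrite D0, Rminus_0_r in B. unfold D in B. fold (smooth_part x) in B.
  eapply Rle_trans; [exact B|]. right. ring.
Qed.

Lemma r_expansion x : Rabs (r t x - t * d x) <= k ^ 2 * t ^ 2 /\ Rabs (r t x) <= k * t.
Proof.
  assert (CV : forall s : R, continuous (fun s : R => lV m0 r s x) s) by (intros; apply V_cont_time).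
  assert (Er : r t x = RInt (fun s => lV m0 r s x) 0 t).
  { rewrite (r_eq T m0 r HF), clamp_id by lra. reflexivity. }
  split.
  - replace (r t x - t * d x) with (RInt (fun s => lV m0 r s x - d x) 0 t).
    + eapply Rle_trans; [apply RInt_abs_le with (K := k ^ 2 * t)|].
      * intros s. apply (continuous_minus (fun s => lV m0 r s x) (fun _ => d x)); [auto|apply continuous_const].
      * intros s Hs. rewrite Rmin_left, Rmax_right in Hs by lra. eapply Rle_trans; [apply V_increment; lra|].
        apply Rmult_le_compat_l; [apply pow2_ge_0|lra].
      * rewrite Rminus_0_r, Rabs_pos_eq by lra. right. ring.
    + rewrite RInt_minus_cont, RInt_const_R, Er by (auto; intros; apply continuous_const). toR; ring.
  - rewrite Er. replace (k * t) with (k * Rabs (t - 0)) by (rewrite Rminus_0_r, Rabs_pos_eq; lra).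
    apply RInt_abs_le; auto. intros s Hs. rewrite Rmin_left, Rmax_right in Hs by lra. apply V_bound. lra.
Qed.

Lemma q_expansion x : Rabs (lq r t x - 1) <= 2 * k * t /\ Rabs (lq r t x - 1 - t * d x) <= 3 * k ^ 2 * t ^ 2.
Proof.
  destruct (r_expansion x) as [R1 R2]. destruct (exp_near_0 (r t x)) as [E1 E2]; [lra|]. unfold lq.
  split; [lra|].
  replace (exp (r t x) - 1 - t * d x) with ((exp (r t x) - 1 - r t x) + (r t x - t * d x)) by ring.
  eapply Rle_trans; [apply Rabs_triang|].
  assert (r t x ^ 2 <= k ^ 2 * t ^ 2).
  { rewrite <- (pow2_abs (r t x)), <- Rpow_mult_distr. apply pow_incr. split; [apply Rabs_pos|exact R2]. }
  lra.
Qed.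

Lemma cubic_error_bound x : Rabs (cubic_error x) <= 7 * k ^ 3 * t ^ 2.
Proof.
  assert (Ve := V_expansion x). destruct (q_expansion x) as [Q1 Q2]. assert (Hd := d_bound' x).
  set (e1 := lV m0 r t x - d x + t / 2 * d x ^ 2 - smooth_part x) in *.
  set (e2 := lq r t x - 1 - t * d x) in *.
  assert (E : cubic_error x = - (t ^ 2 / 2 * d x ^ 3) + e2 * (d x - t / 2 * d x ^ 2) + lq r t x * e1).
  { unfold cubic_error, e1, e2. field. }
  assert (Hk3 : 0 <= k ^ 3 * t ^ 2) by (apply Rmult_le_pos; apply pow_le; lra).
  assert (B1 : Rabs (t ^ 2 / 2 * d x ^ 3) <= / 2 * (k ^ 3 * t ^ 2)).
  { rewrite Rabs_mult, <- RPow_abs, Rabs_pos_eq by (apply Rdiv_le_0_compat; [apply pow2_ge_0|lra]).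
    assert (G : Rabs (d x) ^ 3 <= k ^ 3) by (apply pow_incr; split; [apply Rabs_pos|exact Hd]).
    assert (Ht2 : 0 <= t ^ 2) by apply pow2_ge_0. nra. }
  (* The factor [17 / 16] bounds [1 + k t / 2], since [8 * (k * t) <= 1]. *)
  assert (B2 : Rabs (e2 * (d x - t / 2 * d x ^ 2)) <= 3 * k ^ 2 * t ^ 2 * (17 / 16 * k)).
  { rewrite Rabs_mult. apply Rmult_le_compat; auto using Rabs_pos.
    unfold Rminus. eapply Rle_trans; [apply Rabs_triang|]. rewrite Rabs_Ropp, Rabs_mult, (Rabs_pos_eq (t / 2)), <- RPow_abs by lra.
    assert (G : Rabs (d x) ^ 2 <= k ^ 2) by (apply pow_incr; split; [apply Rabs_pos|exact Hd]).
    assert (t / 2 * Rabs (d x) ^ 2 <= t / 2 * k ^ 2) by (apply Rmult_le_compat_l; lra).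
    assert (t / 2 * k ^ 2 <= / 16 * k) by nra. lra. }
  assert (B3 : Rabs (lq r t x * e1) <= 2 * (k ^ 3 * t ^ 2)).
  { rewrite Rabs_mult. apply Rmult_le_compat; auto using Rabs_pos.
    apply Rabs_le_between in Q1. apply Rabs_le. lra. }
  rewrite E. eapply Rle_trans; [apply Rabs_triang|]. eapply Rle_trans; [apply Rplus_le_compat_r, Rabs_triang|].
  rewrite Rabs_Ropp. lra.
Qed.

Lemma q_expansion_le s x : 0 <= s <= t -> Rabs (lq r s x) <= 2.
Proof.
  intros Hs. assert (Hr : Rabs (r s x) <= / 8).
  { rewrite (r_eq T m0 r HF), clamp_id by lra. eapply Rle_trans; [apply RInt_abs_le with (K := k)|].
    - intros y. apply V_cont_time.
    - intros y Hy. rewrite Rmin_left, Rmax_right in Hy by lra. apply V_bound. lra.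
    - rewrite Rminus_0_r, Rabs_pos_eq by lra. assert (k * s <= k * t) by (apply Rmult_le_compat_l; lra). lra. }
  destruct (exp_near_0 _ Hr) as [E _]. unfold lq. apply Rabs_le_between in E. apply Rabs_le. lra.
Qed.

Lemma smooth_part_deriv x : is_derive smooth_part x
  (RInt (fun s => lq r s x * (2 * (lU m0 r s x * lV m0 r s x) - / 4 * (lA T m0 r s x - lB T m0 r s x))) 0 t).
Proof.
  unfold smooth_part.
  apply (is_derive_RInt_param_all (fun x s => smooth_source s x)
    (fun x s => lq r s x * (2 * (lU m0 r s x * lV m0 r s x) - / 4 * (lA T m0 r s x - lB T m0 r s x)))).
  - intros y s. unfold smooth_source.
    assert (DU := lU_dx T m0 r HF s y). assert (DA := lA_dx T m0 r HF s y). assert (DB := lB_dx T m0 r HF s y).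
    apply (is_derive_ext (fun y => / 2 * (lU m0 r s y * lU m0 r s y) - / 4 * (lA T m0 r s y + lB T m0 r s y))); [intros; simpl; toR; ring|].
    der. unfold lU. rewrite lV_eq. toR; field.
  - apply (cont2_swap (fun s x => lq r s x * (2 * (lU m0 r s x * lV m0 r s x) - / 4 * (lA T m0 r s x - lB T m0 r s x)))).
    apply cont2_mult; [eapply lq_cont2; exact HF|]. apply cont2_minus; apply cont2_mult; try apply cont2_const.
    + apply cont2_mult; [eapply lU_cont2|eapply lV_cont2]; exact HF.
    + apply cont2_minus; [apply lA_cont2|apply lB_cont2]; exact HF.
  - intros y s. apply (cont2_slice1 smooth_source), source_cont2.
Qed.

Lemma smooth_part_lip x : Rabs (smooth_part x - smooth_part 0) <= 5 * k ^ 2 * t * Rabs x.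
Proof.
  destruct (MVT_gen smooth_part 0 x (fun x => RInt (fun s => lq r s x * (2 * (lU m0 r s x * lV m0 r s x) - / 4 * (lA T m0 r s x - lB T m0 r s x))) 0 t)) as [c [_ E]].
  - intros y _. apply smooth_part_deriv.
  - intros y _. apply continuity_pt_of_continuous. eapply continuous_of_derive, smooth_part_deriv.
  - rewrite E, Rabs_mult, Rminus_0_r. apply Rmult_le_compat_r; [apply Rabs_pos|].
    replace (5 * k ^ 2 * t) with (5 * k ^ 2 * Rabs (t - 0)) by (rewrite Rminus_0_r, Rabs_pos_eq; lra).
    apply RInt_abs_le.
    + intros s. apply (cont2_slice1 (fun s x => lq r s x * (2 * (lU m0 r s x * lV m0 r s x) - / 4 * (lA T m0 r s x - lB T m0 r s x)))).
      apply cont2_mult; [eapply lq_cont2; exact HF|]. apply cont2_minus; apply cont2_mult; try apply cont2_const.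
      * apply cont2_mult; [eapply lU_cont2|eapply lV_cont2]; exact HF.
      * apply cont2_minus; [apply lA_cont2|apply lB_cont2]; exact HF.
    + intros s Hs. rewrite Rmin_left, Rmax_right in Hs by lra.
      destruct (AB_bound s c ltac:(lra)) as [A B]. assert (U := U_bound s c ltac:(lra)). assert (V := V_bound s c ltac:(lra)).
      assert (UV : Rabs (lU m0 r s c * lV m0 r s c) <= k * k) by (rewrite Rabs_mult; apply Rmult_le_compat; auto using Rabs_pos).
      (* The factor 2 bounds the Jacobian; [5 / 2] is 2 from [2 * (lU * lV)] plus 1/2 from
         [/ 4 * (lA - lB)]. *)
      rewrite Rabs_mult. replace (5 * k ^ 2) with (2 * (5 / 2 * k ^ 2)) by field.
      apply Rmult_le_compat; auto using Rabs_pos, q_expansion_le.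
      apply Rabs_le_between in A. apply Rabs_le_between in B. apply Rabs_le_between in UV. apply Rabs_le. lra.
Qed.

End Inflation.

Section FlowPairing.
Variable T : R.
Variable m0 : R -> R.
Variable r : R -> R -> R.
Hypothesis HF : lagrangian_flow T m0 r.
Hypothesis r_bound : forall t x, Rabs (r t x) <= 1.
Variables (k t : R).
Hypothesis k_nonneg : 0 <= k.
Hypothesis ab_bound : forall s x, 0 <= s <= T -> Rabs (la m0 r s x) <= k /\ Rabs (lb m0 r s x) <= k.
Hypothesis t_range : 0 <= t < T.
Hypothesis kt_small : 8 * (k * t) <= 1.
Variables (u0 d : R -> R) (M0 : R).
Hypothesis V_init : forall x, lV m0 r 0 x = d x.
Hypothesis u0_periodic : periodic u0.
Hypothesis u0_deriv : forall x : R, is_derive u0 x (d x).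
Hypothesis d_cont : forall x : R, continuous d x.
Hypothesis u0_bound : forall x, Rabs (u0 x) <= M0.

(** The test function is centred at [psi t 0], the current position of the label 0 where the
    sawtooth jumps. In the variable [x] with [z = psi t x] the pairing becomes that of
    [pairing_estimate]. *)
Lemma flow_pairing i :
  Rabs (RInt (fun z => euler T m0 r HF r_bound (lV m0 r) t z * theta i (z - psi T m0 r t 0)) 0 (2 * PI)
    - t / 2 * RInt (fun x => d x ^ 2 * theta i x) (- PI) PI)
  <= 1500 * 4 ^ i * M0 + 36 * Kth * PI * (k ^ 3 * t ^ 2) + 80 * Kth * PI * (k ^ 2 * t * / 2 ^ i).
Proof.
  set (z0 := psi T m0 r t 0). set (dw := euler T m0 r HF r_bound (lV m0 r) t).
  set (p := fun x => psi T m0 r t x - z0).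
  assert (CV := lV_cont2 T m0 r HF). assert (Cq := lq_cont2 T m0 r HF).
  assert (Cdw : forall z : R, continuous dw z).
  { intros z. apply (cont2_slice (fun t z => lV m0 r t (inv_psi T m0 r HF r_bound t z))).
    exact (cont2_comp2 (lV m0 r) (fun t _ => t) _ CV cont2_fst (inv_psi_cont2 T m0 r HF r_bound)). }
  assert (Cth : forall z : R, continuous (fun z => theta i (z - z0)) z).
  { intros z. apply (continuous_comp (fun z => z - z0) (theta i)); [cont|apply theta_cont]. }
  assert (Dp : forall x : R, is_derive p x (lq r t x)).
  { intros x. assert (D := psi_dx T m0 r HF t x). unfold p. der. }
  assert (Cqx : forall x : R, continuous (lq r t) x) by (intros x; now apply cont2_slice).
  assert (Pp : forall x, p (x + 2 * PI) = p x + 2 * PI).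
  { intros x. unfold p. rewrite (psi_shift T m0 r HF). ring. }
  assert (Chg : RInt (fun z => dw z * theta i (z - z0)) 0 (2 * PI) =
    RInt (fun x => (d x + t / 2 * d x ^ 2 + lq r t x * smooth_part T m0 r t x + cubic_error T m0 r t d x) * theta i (p x)) (- PI) PI).
  { transitivity (RInt (fun x => lq r t x * (dw (psi T m0 r t x) * theta i (psi T m0 r t x - z0))) (- PI) PI).
    - symmetry. transitivity (RInt (fun z => dw z * theta i (z - z0)) (psi T m0 r t (- PI)) (psi T m0 r t PI)).
      + apply (RInt_comp (fun z => dw z * theta i (z - z0)) (psi T m0 r t) (lq r t)).
        * intros x _. cont.
        * intros x _. split; [apply psi_dx; exact HF|auto].
      + replace PI with (- PI + 2 * PI) at 2 by ring. rewrite (psi_shift T m0 r HF), RInt_periodic_shift; [reflexivity| |].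
        * intros z. cont.
        * intros z. unfold dw. rewrite (euler_periodic T m0 r HF r_bound (lV m0 r) t (lV_periodic T m0 r HF t)).
          replace (z + 2 * PI - z0) with (z - z0 + 2 * PI) by ring. now rewrite theta_periodic.
    - apply RInt_ext_all. intros x. unfold dw, euler. rewrite inv_psi_psi. unfold cubic_error, p. toR; ring. }
  rewrite Chg.
  assert (Csm : forall x : R, continuous (smooth_part T m0 r t) x).
  { intros x. eapply continuous_of_derive, smooth_part_deriv. exact HF. }
  apply (pairing_estimate i (lq r t) p (2 * k * t)) with (u0 := u0); auto; try lra.
  - unfold p, z0. ring.
  - intros x. apply (q_expansion T m0 r HF k t ab_bound t_range kt_small d V_init x).
  - intros x. rewrite <- V_init. apply (V_bound T m0 r k ab_bound). lra.
  - intros x. apply (smooth_part_lip T m0 r HF k t); auto.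
  - intros x. unfold cubic_error. assert (Cv : continuous (lV m0 r t) x) by now apply cont2_slice. cont.
  - intros x. apply (cubic_error_bound T m0 r HF k t); auto.
Qed.
End FlowPairing.

(** * Norm inflation *)

(** Small enough for the quadratic part of [(1 + amp saw)^2] to be dominated by the linear one. *)
Definition amp : R := / (93 * 289 * Kth).
Definition gain : R := amp * PI / 93.
Definition envelope (n : nat) (x : R) : R := 1 + amp * saw n x.
Definition datum (eps : R) (L n : nat) (x : R) : R := eps / INR L * (sin (INR L * x) * envelope n x).

Lemma amp_pos : 0 < amp. Proof. unfold amp. apply Rinv_0_lt_compat. assert (H := Kth_pos). lra. Qed.

Lemma amp_small : amp <= / 100.
Proof. unfold amp. apply Rinv_le_contravar; [lra|]. unfold Kth. lra. Qed.

Lemma gain_pos : 0 < gain.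
Proof. unfold gain. assert (A := amp_pos). assert (P := PI_RGT_0). pos. Qed.

Lemma envelope_between n x : / 2 <= envelope n x <= 3 / 2.
Proof.
  unfold envelope. assert (S := saw_bound n x). apply Rabs_le_between in S. assert (A := amp_pos). assert (B := amp_small). nra.
Qed.

(** The constant 1 is killed by the zero mean of [theta], the term linear in [saw] gives at least
    [2 * gain], and the quadratic one costs at most [amp ^ 2 * 17 ^ 2 * Kth * PI], which the choice
    of [amp] makes equal to [gain]. *)
Lemma envelope_theta i n : (93 * 2 ^ i <= n)%nat -> gain <= RInt (fun x => envelope n x ^ 2 * theta i x) (- PI) PI.
Proof.
  intros Hn. assert (PIpos := PI_RGT_0). assert (A := amp_pos). assert (HK := Kth_pos).
  assert (Cs := saw_cont n). assert (Ct := theta_cont i).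
  assert (Per : forall f : R -> R, (forall x : R, continuous f x) -> periodic f -> RInt f (- PI) PI = RInt f 0 (2 * PI)).
  { intros f Cf Pf. replace PI with (- PI + 2 * PI) at 2 by ring. now apply RInt_periodic_shift. }
  rewrite (RInt_ext_all _ (fun x => theta i x + (2 * amp * (saw n x * theta i x) + amp ^ 2 * (saw n x ^ 2 * theta i x)))).
  2:{ intros x. unfold envelope. toR; ring. }
  rewrite !RInt_plus_cont, !RInt_scal_cont by (intros; cont).
  rewrite (Per (theta i)), (trig_mean _ _ _ (theta_trig i)) by (auto using theta_periodic; assert (H := pow2_nat_pos i); lia).
  rewrite (Per (fun x => saw n x * theta i x)).
  2:{ intros; cont. }
  2:{ intros x. now rewrite theta_periodic, (trig_periodic _ _ _ (saw_trig n)). }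
  assert (S := saw_theta n i Hn).
  assert (Q : Rabs (RInt (fun x => saw n x ^ 2 * theta i x) (- PI) PI) <= 289 * Kth * PI).
  { apply (RInt_mu_bound i); [lra|intros; cont|]. intros x Hx. rewrite Rabs_mult, <- RPow_abs.
    replace (289 * Kth * mu i x) with (17 ^ 2 * (Kth * mu i x)) by ring.
    apply Rmult_le_compat; try apply Rabs_pos.
    - apply pow_le, Rabs_pos.
    - apply pow_incr. split; [apply Rabs_pos|apply saw_bound].
    - apply theta_bounds. lra. }
  apply Rabs_le_between in Q.
  assert (E : amp ^ 2 * (289 * Kth * PI) = gain).
  { unfold gain. unfold amp. field. lra. }
  assert (E2 : 2 * amp * (PI / 93) = 2 * gain) by (unfold gain; field).
  assert (G1 : 2 * amp * (PI / 93) <= 2 * amp * RInt (fun x => saw n x * theta i x) 0 (2 * PI)) by (apply Rmult_le_compat_l; lra).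
  assert (G2 : amp ^ 2 * - (289 * Kth * PI) <= amp ^ 2 * RInt (fun x => saw n x ^ 2 * theta i x) (- PI) PI).
  { apply Rmult_le_compat_l; [apply pow2_ge_0|lra]. }
  lra.
Qed.

Section Datum.
Variables (eps : R) (L n N : nat).
Hypothesis eps_pos : 0 < eps.
Hypothesis n_eq : n = (93 * 2 ^ N)%nat.
Hypothesis n_le_L : (n <= L)%nat.

Lemma n_pos : (1 <= n)%nat. Proof. assert (H := pow2_nat_pos N). lia. Qed.

Lemma L_ge_1 : 1 <= INR L.
Proof. assert (H := n_pos). apply (le_INR 1). lia. Qed.

Lemma n_over_L : 0 < INR n / INR L <= 1.
Proof.
  assert (H1 : 0 < INR n) by (apply lt_0_INR, n_pos). assert (H2 := L_ge_1). assert (H3 := le_INR _ _ n_le_L). split; [pos|].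
  apply Rmult_le_reg_r with (INR L); [lra|]. unfold Rdiv. rewrite Rmult_assoc, Rinv_l; lra.
Qed.

Lemma pow2_le_n i : (i <= N)%nat -> 2 ^ i <= INR n /\ 4 ^ i <= INR n ^ 2.
Proof.
  intros Hi. assert (H : 2 ^ i <= INR n).
  { rewrite <- INR_pow2. apply le_INR. assert (G := Nat.pow_le_mono_r 2 i N ltac:(lia) Hi). lia. }
  split; [exact H|]. replace (4 ^ i) with (2 ^ i * 2 ^ i) by (rewrite <- Rpow_mult_distr; f_equal; ring).
  assert (P := two_pow_pos i). simpl. rewrite Rmult_1_r. apply Rmult_le_compat; lra.
Qed.

Lemma envelope_trig : trig 0 n (envelope n).
Proof.
  apply trig_ext with (fun x => cos (INR 0 * x) + amp * saw n x).
  - intros x. simpl INR. rewrite Rmult_0_l, cos_0. reflexivity.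
  - apply trig_plus; [apply trig_cos; lia|]. apply trig_scal. apply trig_mono with 1%nat n; [lia|lia|].
    apply saw_trig', n_pos.
Qed.

Lemma datum_trig : trig (L - n) (L + n) (datum eps L n).
Proof. apply trig_scal. apply trig_sin_mul with 0%nat; [apply envelope_trig|exact n_le_L]. Qed.

Lemma datum_bound x : Rabs (datum eps L n x) <= 3 / 2 * eps / INR L.
Proof.
  assert (HL := L_ge_1). unfold datum. rewrite Rabs_mult, (Rabs_pos_eq (eps / INR L)) by (apply Rdiv_le_0_compat; lra).
  assert (S : Rabs (sin (INR L * x)) <= 1) by (apply Rabs_le, SIN_bound).
  assert (E : Rabs (envelope n x) <= 3 / 2) by (assert (H := envelope_between n x); apply Rabs_le; lra).
  replace (3 / 2 * eps / INR L) with (eps / INR L * (1 * (3 / 2))) by (field; lra).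
  apply Rmult_le_compat_l; [apply Rdiv_le_0_compat; lra|]. rewrite Rabs_mult. apply Rmult_le_compat; auto using Rabs_pos.
Qed.

Variables g d : R -> R.
Hypothesis g_deriv : forall x : R, is_derive (saw n) x (g x).
Hypothesis g_cont : forall x : R, continuous g x.
Hypothesis g_bound : forall x, Rabs (g x) <= INR n.
Hypothesis d_deriv : forall x : R, is_derive (datum eps L n) x (d x).

Lemma envelope_deriv x : is_derive (envelope n) x (amp * g x).
Proof. assert (D := g_deriv x). unfold envelope. der. Qed.

Lemma datum_deriv_formula x :
  d x = eps * (cos (INR L * x) * envelope n x + / INR L * (sin (INR L * x) * (amp * g x))).
Proof.
  rewrite <- (is_derive_unique _ _ _ (d_deriv x)). apply is_derive_unique.
  assert (HL := L_ge_1). assert (De := envelope_deriv x).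
  assert (Ds : is_derive (fun x => sin (INR L * x)) x (INR L * cos (INR L * x))) by (auto_derive; auto; ring).
  unfold datum. eapply is_derive_eq.
  - apply is_derive_scal. apply (is_derive_mult (fun x => sin (INR L * x)) (envelope n)); [exact Ds|exact De|intros; apply Rmult_comm].
  - unfold plus, mult; simpl. toR. field. lra.
Qed.

Lemma amp_g_bound x : Rabs (amp * g x) <= INR n.
Proof.
  rewrite Rabs_mult, (Rabs_pos_eq amp) by (left; apply amp_pos). assert (A := amp_small). assert (P := amp_pos). assert (B := g_bound x).
  assert (Q := Rabs_pos (g x)). nra.
Qed.

Lemma datum_deriv_bound x : Rabs (d x) <= 5 / 2 * eps.
Proof.
  rewrite datum_deriv_formula, Rabs_mult, (Rabs_pos_eq eps) by lra.
  replace (5 / 2 * eps) with (eps * (1 * (3 / 2) + 1)) by field. apply Rmult_le_compat_l; [lra|].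
  eapply Rle_trans; [apply Rabs_triang|]. assert (HL := L_ge_1).
  assert (S : Rabs (sin (INR L * x)) <= 1) by (apply Rabs_le, SIN_bound). assert (C : Rabs (cos (INR L * x)) <= 1) by (apply Rabs_le, COS_bound).
  apply Rplus_le_compat.
  - rewrite Rabs_mult. apply Rmult_le_compat; auto using Rabs_pos. assert (H := envelope_between n x); apply Rabs_le; lra.
  - rewrite !(Rabs_mult (/ INR L)), (Rabs_mult (sin _)), (Rabs_pos_eq (/ INR L)) by (left; apply Rinv_0_lt_compat; lra).
    assert (R1 := n_over_L). apply Rle_trans with (/ INR L * (1 * INR n)).
    + apply Rmult_le_compat_l; [left; apply Rinv_0_lt_compat; lra|]. apply Rmult_le_compat; auto using Rabs_pos, amp_g_bound.
    + unfold Rdiv in R1. lra.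
Qed.

(** This is the high-frequency half of [cos ^ 2]; one integration by parts gains [1 / (2 L)], while
    a derivative of the slow factor costs at most a multiple of [n ^ 2]. *)
Lemma oscillating_square i : (i <= N)%nat ->
  Rabs (RInt (fun x => cos (2 * INR L * x) * (envelope n x ^ 2 * theta i x)) (- PI) PI) <= 900 * (INR n ^ 2 / INR L).
Proof.
  intros Hi. assert (PIpos := PI_RGT_0). assert (HL := L_ge_1).
  set (F := fun x => envelope n x ^ 2 * theta i x).
  set (F' := fun x => 2 * (envelope n x * (amp * g x)) * theta i x + envelope n x ^ 2 * dtheta i x).
  assert (CE : forall x : R, continuous (envelope n) x) by (intros x; eapply continuous_of_derive, envelope_deriv).
  assert (Ct := theta_cont i). assert (Cdt := dtheta_cont i).
  assert (DF : forall x : R, is_derive F x (F' x)).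
  { intros x. assert (De := envelope_deriv x). assert (Dt := theta_deriv i x).
    apply (is_derive_ext (fun x => envelope n x * envelope n x * theta i x)); [intros; unfold F; simpl; toR; ring|]. unfold F'. der. }
  set (l := 2 * INR L). assert (Hl : 2 <= l) by (unfold l; lra).
  assert (Z : forall a, isint a -> sin (a * PI * 2) = 0).
  { intros a Ha. rewrite <- (sin_isint a Ha). f_equal. ring. }
  assert (Z1 : sin (l * PI) = 0). { unfold l. rewrite <- (Z (INR L) (isint_INR L)). f_equal. ring. }
  assert (Z2 : sin (l * - PI) = 0) by (rewrite <- Ropp_mult_distr_r, sin_neg, Z1; ring).
  assert (B : RInt (fun x => cos (l * x) * F x + / l * (sin (l * x) * F' x)) (- PI) PI = 0).
  { rewrite (RInt_derive (fun x => / l * (sin (l * x) * F x))).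
    - rewrite Z1, Z2. toR; ring.
    - intros x. assert (D := DF x). assert (Ds : is_derive (fun x => sin (l * x)) x (l * cos (l * x))) by (auto_derive; auto; ring).
      eapply is_derive_eq; [apply is_derive_scal; apply (is_derive_mult (fun x => sin (l * x)) F); [exact Ds|exact D|intros; apply Rmult_comm]|].
      unfold plus, mult; simpl. toR. field. lra.
    - intros x. unfold F, F'. cont; auto using cos_cont, sin_cont. }
  assert (CF' : forall x : R, continuous F' x) by (intros x; unfold F'; cont).
  assert (CF : forall x : R, continuous F x) by (intros x; unfold F; cont).
  rewrite RInt_plus_cont, RInt_scal_cont in B by (intros; cont; auto using cos_cont, sin_cont).
  change (Rabs (RInt (fun x => cos (l * x) * F x) (- PI) PI) <= 900 * (INR n ^ 2 / INR L)).
  replace (RInt (fun x => cos (l * x) * F x) (- PI) PI) with (- (/ l * RInt (fun x => sin (l * x) * F' x) (- PI) PI)) by lra.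
  rewrite Rabs_Ropp, Rabs_mult, (Rabs_pos_eq (/ l)) by (left; apply Rinv_0_lt_compat; lra).
  destruct (pow2_le_n i Hi) as [P2 P4]. assert (Pn : 0 < INR n) by (apply lt_0_INR, n_pos).
  (* The two terms of [F'] contribute [3 * n ^ 2] and [9 / 4 * 93 * n ^ 2], together below
     [213 * n ^ 2]. *)
  assert (I : Rabs (RInt (fun x => sin (l * x) * F' x) (- PI) PI) <= 213 * INR n ^ 2 * (2 * PI)).
  { replace (2 * PI) with (Rabs (PI - - PI)) by (rewrite Rabs_pos_eq; lra). apply RInt_abs_le.
    - intros x. cont. apply sin_cont.
    - intros x _. rewrite Rabs_mult. assert (S : Rabs (sin (l * x)) <= 1) by (apply Rabs_le, SIN_bound).
      rewrite <- (Rmult_1_l (213 * INR n ^ 2)). apply Rmult_le_compat; auto using Rabs_pos.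
      unfold F'. eapply Rle_trans; [apply Rabs_triang|]. destruct (theta_crude i x) as [T1 T2].
      assert (E : Rabs (envelope n x) <= 3 / 2) by (assert (H := envelope_between n x); apply Rabs_le; lra).
      assert (E2 : Rabs (envelope n x ^ 2) <= 9 / 4).
      { rewrite <- RPow_abs. replace (9 / 4) with ((3 / 2) ^ 2) by field. apply pow_incr. split; [apply Rabs_pos|exact E]. }
      assert (A1 : Rabs (2 * (envelope n x * (amp * g x)) * theta i x) <= 2 * (3 / 2 * INR n) * INR n).
      { rewrite Rabs_mult. apply Rmult_le_compat; auto using Rabs_pos; [|lra]. rewrite !(Rabs_mult 2), (Rabs_mult (envelope n x)), (Rabs_pos_eq 2) by lra.
        apply Rmult_le_compat_l; [lra|]. apply Rmult_le_compat; auto using Rabs_pos, amp_g_bound. }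
      assert (A2 : Rabs (envelope n x ^ 2 * dtheta i x) <= 9 / 4 * (93 * INR n ^ 2)).
      { rewrite Rabs_mult. apply Rmult_le_compat; auto using Rabs_pos. lra. }
      assert (0 <= INR n ^ 2) by apply pow2_ge_0. lra. }
  assert (PI4 := PI_4). assert (Il : / l = / 2 * / INR L) by (unfold l; rewrite Rinv_mult; reflexivity).
  assert (Ip : 0 < / INR L) by (apply Rinv_0_lt_compat; lra).
  apply Rle_trans with (/ l * (213 * INR n ^ 2 * (2 * PI))); [apply Rmult_le_compat_l; [rewrite Il; lra|exact I]|].
  rewrite Il. unfold Rdiv. assert (0 <= INR n ^ 2 * / INR L) by (apply Rmult_le_pos; [apply pow2_ge_0|lra]). nra.
Qed.

(** Squaring the carrier creates its mean 1/2, so half of the pairing with [envelope ^ 2] survives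
    at low frequency. The remaining terms total at most [482 * n ^ 2 / L], less than [gain / 4]
    under the hypothesis on [L]. *)
Lemma datum_square_lower i : (i <= N)%nat -> 2000 * INR n ^ 2 <= gain * INR L ->
  eps ^ 2 * (gain / 4) <= RInt (fun x => d x ^ 2 * theta i x) (- PI) PI.
Proof.
  intros Hi HLn. assert (PIpos := PI_RGT_0). assert (PI4 := PI_4). assert (HL := L_ge_1).
  destruct (pow2_le_n i Hi) as [P2 P4]. assert (Pn : 0 < INR n) by (apply lt_0_INR, n_pos).
  assert (CE : forall x : R, continuous (envelope n) x) by (intros x; eapply continuous_of_derive, envelope_deriv).
  assert (Ct := theta_cont i).
  assert (Cc : forall a (x : R), continuous (fun x => cos (a * x)) x) by (intros; apply cos_cont).
  assert (Cs : forall a (x : R), continuous (fun x => sin (a * x)) x) by (intros; apply sin_cont).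
  set (Rm := fun x => 2 * (/ INR L * (cos (INR L * x) * sin (INR L * x) * envelope n x * (amp * g x)))
     + (/ INR L * (sin (INR L * x) * (amp * g x))) ^ 2).
  assert (CR : forall x : R, continuous Rm x) by (intros x; unfold Rm; cont).
  rewrite (RInt_ext_all _ (fun x => eps ^ 2 * (/ 2 * (envelope n x ^ 2 * theta i x) + (/ 2 * (cos (2 * INR L * x) * (envelope n x ^ 2 * theta i x)) + Rm x * theta i x)))).
  2:{ intros x. rewrite datum_deriv_formula. unfold Rm.
      replace (2 * INR L * x) with (2 * (INR L * x)) by ring. rewrite cos_2a_cos. toR; field. lra. }
  rewrite RInt_scal_cont, !RInt_plus_cont, !RInt_scal_cont by (intros; cont).
  assert (G := envelope_theta i n). assert (Hin : (93 * 2 ^ i <= n)%nat).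
  { assert (Q := Nat.pow_le_mono_r 2 i N ltac:(lia) Hi). lia. }
  specialize (G Hin). assert (O := oscillating_square i Hi). apply Rabs_le_between in O.
  assert (Ip : 0 < / INR L) by (apply Rinv_0_lt_compat; lra). assert (R1 := n_over_L). unfold Rdiv in R1.
  assert (Rb : forall x, Rabs (Rm x) <= 4 * (INR n * / INR L)).
  { intros x. unfold Rm. assert (S : Rabs (sin (INR L * x)) <= 1) by (apply Rabs_le, SIN_bound). assert (C : Rabs (cos (INR L * x)) <= 1) by (apply Rabs_le, COS_bound).
    assert (A := amp_g_bound x). assert (E : Rabs (envelope n x) <= 3 / 2) by (assert (H := envelope_between n x); apply Rabs_le; lra).
    assert (W : Rabs (/ INR L * (sin (INR L * x) * (amp * g x))) <= INR n * / INR L).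
    { rewrite !(Rabs_mult (/ INR L)), (Rabs_mult (sin _)), (Rabs_pos_eq (/ INR L)), Rmult_comm by lra.
      apply Rmult_le_compat_r; [lra|]. rewrite <- (Rmult_1_l (INR n)). apply Rmult_le_compat; auto using Rabs_pos. }
    eapply Rle_trans; [apply Rabs_triang|].
    replace (4 * (INR n * / INR L)) with (2 * (1 * (3 / 2) * (INR n * / INR L)) + 1 * (INR n * / INR L)) by lra.
    apply Rplus_le_compat.
    - replace (/ INR L * (cos (INR L * x) * sin (INR L * x) * envelope n x * (amp * g x)))
        with (cos (INR L * x) * envelope n x * (/ INR L * (sin (INR L * x) * (amp * g x)))) by ring.
      rewrite (Rabs_mult 2), (Rabs_pos_eq 2) by lra. apply Rmult_le_compat_l; [lra|].
      rewrite (Rabs_mult (cos (INR L * x) * envelope n x)). apply Rmult_le_compat; auto using Rabs_pos.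
      rewrite Rabs_mult. apply Rmult_le_compat; auto using Rabs_pos.
    - rewrite <- RPow_abs. simpl. rewrite Rmult_1_r. apply Rmult_le_compat; auto using Rabs_pos. lra. }
  assert (Er : Rabs (RInt (fun x => Rm x * theta i x) (- PI) PI) <= 4 * (INR n * / INR L) * INR n * (2 * PI)).
  { replace (2 * PI) with (Rabs (PI - - PI)) by (rewrite Rabs_pos_eq; lra). apply RInt_abs_le; [intros; cont|].
    intros x _. rewrite Rabs_mult. destruct (theta_crude i x) as [T1 _]. apply Rmult_le_compat; auto using Rabs_pos. lra. }
  apply Rabs_le_between in Er. unfold Rdiv in O.
  assert (NL : 2000 * (INR n ^ 2 * / INR L) <= gain).
  { apply Rmult_le_reg_r with (INR L); [lra|]. replace (2000 * (INR n ^ 2 * / INR L) * INR L) with (2000 * INR n ^ 2) by (field; lra). lra. }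
  assert (Q0 : 0 <= INR n ^ 2 * / INR L) by (apply Rmult_le_pos; [apply pow2_ge_0|lra]).
  assert (Er' : 4 * (INR n * / INR L) * INR n * (2 * PI) <= 32 * (INR n ^ 2 * / INR L)).
  { replace (4 * (INR n * / INR L) * INR n * (2 * PI)) with (8 * PI * (INR n ^ 2 * / INR L)) by ring. nra. }
  apply Rmult_le_compat_l; [apply pow2_ge_0|]. lra.
Qed.

End Datum.

Lemma pow2_unbounded X : exists K : nat, X <= 2 ^ K.
Proof.
  assert (H : forall K, INR K <= 2 ^ K).
  { induction K as [|K IH]; [simpl; lra|]. rewrite S_INR. simpl. assert (1 <= 2 ^ K) by (apply pow_R1_Rle; lra). lra. }
  destruct (nfloor_ex (Rmax 0 X)) as [K [_ HK]]; [apply Rmax_l|]. exists (S K).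
  eapply Rle_trans; [|apply H]. rewrite S_INR. assert (M := Rmax_r 0 X). lra.
Qed.

(** The carrier [11 * 2 ^ K] lies in the band of order [K + 3], from [32 / 3 * 2 ^ K] to
    [12 * 2 ^ K], and [4 * n <= 2 ^ K] keeps the side frequencies [L - n] to [L + n] inside it. Only
    one block is nonzero, whatever the number of modes of the sawtooth. *)
Lemma datum_besov chi eps K n N : admissible_chi chi -> 0 < eps -> n = (93 * 2 ^ N)%nat -> (4 * n <= 2 ^ K)%nat ->
  Rbar_le (besov_1_inf_1 chi (datum eps (11 * 2 ^ K) n)) (Finite (2 * eps)).
Proof.
  intros Hchi He En Hn. set (L := (11 * 2 ^ K)%nat).
  assert (HnL : (n <= L)%nat) by (unfold L; lia). assert (HL := L_ge_1 L n N En HnL).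
  assert (EL : INR L = 11 * 2 ^ K). { unfold L. rewrite mult_INR, INR_pow2. f_equal. simpl; ring. }
  assert (P := two_pow_pos K).
  set (B := 3 / 2 * eps / INR L). assert (HB : 0 <= B) by (unfold B; pos).
  eapply Rbar_le_trans; [apply (besov_upper_single chi _ (K + 3) B HB)|].
  - intros k. apply Linf_norm_between. intros x.
    rewrite (block_trig chi k (if Nat.eq_dec k (S (K + 3)) then 1 else 0) (L - n) (L + n)).
    + rewrite Cmod_R. assert (D := datum_bound eps L n N He En HnL x). fold B in D.
      destruct Nat.eq_dec; [rewrite Rmult_1_l; exact D|rewrite Rmult_0_l, Rabs_R0; lra].
    + intros m [Hm1 Hm2]. apply band_mult_const; auto. rewrite pow_add. simpl (2 ^ 3).
      apply le_INR in Hm1. apply le_INR in Hm2. rewrite minus_INR in Hm1 by lia. rewrite plus_INR in Hm2.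
      apply le_INR in Hn. rewrite mult_INR, INR_pow2 in Hn. replace (INR 4) with 4 in Hn by (simpl; ring). lra.
    + now apply datum_trig with N.
  - simpl. unfold B. rewrite EL, pow_add. simpl (2 ^ 3).
    replace (2 ^ K * (2 * (2 * (2 * 1))) * (3 / 2 * eps / (11 * 2 ^ K))) with (12 / 11 * eps) by (field; lra). lra.
Qed.

(** The constants are fixed in the order [kap], [i0], [m], [N], [n], [K]. Because [eps] and [t] are
    given before the number of modes, any target [A] is reached by taking enough blocks. *)
Theorem norm_inflation chi : admissible_chi chi -> exists kap, 0 < kap /\
  forall eps t A, 0 < eps <= / 36 -> 0 < t <= / 2 -> eps * t <= kap ->
  exists u0, H_infty u0 /\ Rbar_le (besov_1_inf_1 chi u0) (Finite (2 * eps)) /\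
  exists u, CH_solution 1 u0 u /\ Rbar_le (Finite A) (besov_1_inf_1 chi (u t)).
Proof.
  intros Hchi. assert (PIpos := PI_RGT_0). assert (HK := Kth_pos). assert (Hg := gain_pos).
  set (KP := Kth * PI). assert (HKP : 0 < KP) by (unfold KP; nra).
  (* With [k = 8 * eps], the first bound gives [8 * (k * t) <= 1]; the second controls the cubic
     error, as [600000] exceeds [32 * 36 * 8 ^ 3]. *)
  exists (Rmin (/ 64) (gain / (600000 * KP))). split.
  { apply Rmin_glb_lt; [lra|pos]. }
  intros eps t A He Ht Het.
  assert (Het1 : eps * t <= / 64) by (eapply Rle_trans; [exact Het|apply Rmin_l]).
  assert (Het2 : 600000 * KP * (eps * t) <= gain).
  { apply Rle_trans with (600000 * KP * (gain / (600000 * KP))).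
    - apply Rmult_le_compat_l; [lra|]. eapply Rle_trans; [exact Het|apply Rmin_r].
    - right. field. lra. }
  (* [163840 = 32 * 80 * 8 ^ 2]: from the index [i0] on, the Lipschitz error is at most a 32nd of
     [t * eps ^ 2 * gain]. The finitely many earlier blocks are given up. *)
  destruct (half_pow_small (163840 * KP) gain Hg) as [i0 Hi0].
  (* The contribution guaranteed by each block with index between [i0] and [N]; the next line takes
     enough of them to exceed [Rabs A]. *)
  set (c := t * eps ^ 2 * gain / 32 / KP). assert (Hc : 0 < c) by (unfold c; pos).
  destruct (nfloor_ex (Rabs A / c)) as [m [_ Hm]]. { apply Rdiv_le_0_compat; [apply Rabs_pos|lra]. }
  set (N := (i0 + S m)%nat). set (n := (93 * 2 ^ N)%nat).
  (* The first summand meets the hypothesis of [datum_square_lower]; the second makes the linear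
     term a 32nd of the main quantity, with [72000 = 32 * 1500 * (3 / 2)]. *)
  set (X := 2000 * INR n ^ 2 / gain + 72000 * INR n ^ 2 / (t * eps * gain)).
  destruct (pow2_unbounded (X + 4 * INR n)) as [K HX].
  set (L := (11 * 2 ^ K)%nat).
  assert (Pn : 0 < INR n) by (apply lt_0_INR; unfold n; assert (H := pow2_nat_pos N); lia).
  assert (X1 : 0 <= 2000 * INR n ^ 2 / gain) by pos.
  assert (Hteg : 0 < t * eps * gain) by pos.
  assert (X2 : 0 <= 72000 * INR n ^ 2 / (t * eps * gain)) by pos.
  assert (EL : INR L = 11 * 2 ^ K). { unfold L. rewrite mult_INR, INR_pow2. f_equal. simpl; ring. }
  assert (P := two_pow_pos K).
  assert (Hn4 : (4 * n <= 2 ^ K)%nat).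
  { apply INR_le. rewrite mult_INR, INR_pow2. replace (INR 4) with 4 by (simpl; ring). unfold X in HX. lra. }
  assert (HnL : (n <= L)%nat) by (unfold L; lia).
  assert (L1 : 2000 * INR n ^ 2 <= gain * INR L).
  { apply Rle_trans with (gain * (2000 * INR n ^ 2 / gain)); [right; field; lra|]. apply Rmult_le_compat_l; [lra|]. unfold X in HX. lra. }
  assert (L2 : 72000 * INR n ^ 2 <= t * eps * gain * INR L).
  { apply Rle_trans with (t * eps * gain * (72000 * INR n ^ 2 / (t * eps * gain))); [right; field; lra|].
    apply Rmult_le_compat_l; [lra|]. unfold X in HX. lra. }
  assert (En : n = (93 * 2 ^ N)%nat) by reflexivity.
  assert (eps_pos : 0 < eps) by lra.
  assert (HL1 := L_ge_1 L n N En HnL).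
  set (u0 := datum eps L n).
  assert (Tu := datum_trig eps L n N En HnL). fold u0 in Tu.
  destruct (trig_derive _ _ _ Tu) as [d [Td Dd]]. destruct (trig_derive _ _ _ Td) as [dd [Tdd Ddd]].
  destruct (saw_deriv n) as [g [Dg Bg]].
  assert (Cg : forall x : R, continuous g x).
  { destruct (trig_derive _ _ _ (saw_trig n)) as [g' [Tg Dg']]. intros x. apply (continuous_ext g').
    - intros y. rewrite <- (is_derive_unique _ _ _ (Dg' y)). now apply is_derive_unique.
    - eapply trig_cont, Tg. }
  assert (Bu := datum_bound eps L n N eps_pos En HnL). fold u0 in Bu.
  assert (Bd := datum_deriv_bound eps L n N eps_pos En HnL g d Dg Bg Dd).
  exists u0. split; [split; [eapply trig_periodic, Tu|eapply trig_smooth, Tu]|].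
  split; [now apply datum_besov with N|].
  assert (Init : forall x, Rabs (u0 x) + Rabs (d x) <= 4 * eps).
  { intros x. specialize (Bu x). specialize (Bd x).
    assert (3 / 2 * eps / INR L <= 3 / 2 * eps).
    { unfold Rdiv at 1. rewrite <- (Rmult_1_r (3 / 2 * eps)) at 2. apply Rmult_le_compat_l; [lra|].
      rewrite <- Rinv_1. apply Rinv_le_contravar; lra. }
    lra. }
  set (m0 := fun x => u0 x - dd x).
  assert (Pu := trig_periodic _ _ _ Tu). assert (Pd := trig_periodic _ _ _ Td). assert (Pdd := trig_periodic _ _ _ Tdd).
  assert (Cdd : forall x : R, continuous dd x) by (intros; eapply trig_cont, Tdd).
  (* The size [4 * eps] with [eps <= / 36] is exactly what a flow up to time 1 requires. *)
  destruct (flow_exists u0 d dd Pu Pd Pdd Dd Ddd Cdd 1 (4 * eps) ltac:(lra) ltac:(lra) ltac:(lra) Init) as [r HF].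
  fold m0 in HF.
  destruct (flow_bounds u0 d dd Pu Pd Dd Ddd 1 (4 * eps) ltac:(lra) ltac:(lra) Init 1 r ltac:(lra) HF) as [Bab Br].
  fold m0 in Bab.
  assert (Br1 : forall t x, Rabs (r t x) <= 1) by (intros s x; specialize (Br s x); lra).
  assert (Sm : smooth m0).
  { apply (trig_smooth (L - n) (L + n)). apply trig_ext with (fun x => u0 x + (-1) * dd x); [intros; unfold m0; ring|].
    apply trig_plus; [exact Tu|now apply trig_scal]. }
  assert (m0_spec : forall x, m0 x = u0 x - dd x) by reflexivity.
  assert (U0 := lU_0 1 m0 r HF u0 d dd Pu Pd Dd Ddd m0_spec).
  assert (V0 := lV_0 1 m0 r HF u0 d dd Pu Pd Dd Ddd m0_spec).
  set (u := euler 1 m0 r HF Br1 (lU m0 r)).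
  exists u. split; [now apply euler_solution|].
  assert (Bab' : forall s x, 0 <= s <= 1 -> Rabs (la m0 r s x) <= 8 * eps /\ Rabs (lb m0 r s x) <= 8 * eps).
  { intros s x Hs. destruct (Bab s x Hs). lra. }
  assert (Per_i : forall i, (i0 <= i < N)%nat -> c <= 2 ^ (i + 6) * Linf_norm (dyadic_block chi (S (i + 6)) (u t))).
  { intros i Hi.
    assert (FP := flow_pairing 1 m0 r HF Br1 (8 * eps) t ltac:(lra) Bab' ltac:(lra) ltac:(lra) u0 d (3 / 2 * eps / INR L) V0 Pu Dd
       (fun x => trig_cont _ _ _ x Td) Bu i).
    assert (DS := datum_square_lower eps L n N En HnL g d Dg Cg Bg Dd i ltac:(lia) L1).
    assert (BL := block_lower chi i (u t) (euler 1 m0 r HF Br1 (lV m0 r) t) (psi 1 m0 r t 0) Hchi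
      (euler_periodic 1 m0 r HF Br1 (lU m0 r) t (lU_periodic 1 m0 r HF t))
      (fun x => euler_lU_dz 1 m0 r HF Br1 t x)).
    assert (Cdw : forall z : R, continuous (euler 1 m0 r HF Br1 (lV m0 r) t) z).
    { intros z. apply (cont2_slice (fun t z => lV m0 r t (inv_psi 1 m0 r HF Br1 t z))).
      exact (cont2_comp2 (lV m0 r) (fun t _ => t) _ (lV_cont2 1 m0 r HF) cont2_fst (inv_psi_cont2 1 m0 r HF Br1)). }
    specialize (BL Cdw).
    set (I := RInt _ 0 (2 * PI)) in FP, BL. set (D := RInt _ (- PI) PI) in FP, DS. fold KP in BL.
    replace (36 * Kth * PI) with (36 * KP) in FP by (unfold KP; ring). replace (80 * Kth * PI) with (80 * KP) in FP by (unfold KP; ring).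
    destruct (pow2_le_n L n N En HnL i ltac:(lia)) as [_ P4].
    set (W := t * eps ^ 2 * gain) in *. assert (HW : 0 < W) by (unfold W; pos).
    assert (T1 : 1500 * 4 ^ i * (3 / 2 * eps / INR L) <= W / 32).
    { apply Rle_trans with (1500 * INR n ^ 2 * (3 / 2 * eps / INR L)).
      - apply Rmult_le_compat_r; [pos|lra].
      - apply Rmult_le_reg_r with (INR L); [lra|].
        replace (1500 * INR n ^ 2 * (3 / 2 * eps / INR L) * INR L) with (eps / 32 * (72000 * INR n ^ 2)) by (field; lra).
        apply Rle_trans with (eps / 32 * (t * eps * gain * INR L)); [apply Rmult_le_compat_l; lra|]. right. unfold W. field. }
    assert (T2 : 36 * KP * ((8 * eps) ^ 3 * t ^ 2) <= W / 32).
    { replace (36 * KP * ((8 * eps) ^ 3 * t ^ 2)) with (t * eps ^ 2 / 32 * (589824 * KP * (eps * t))) by field.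
      replace (W / 32) with (t * eps ^ 2 / 32 * gain) by (unfold W; field). apply Rmult_le_compat_l; [pos|].
      assert (0 <= KP * (eps * t)) by pos. lra. }
    assert (T3 : 80 * KP * ((8 * eps) ^ 2 * t * / 2 ^ i) <= W / 32).
    { replace (80 * KP * ((8 * eps) ^ 2 * t * / 2 ^ i)) with (t * eps ^ 2 / 32 * (163840 * KP * / 2 ^ i)) by (field; apply Rgt_not_eq, two_pow_pos).
      replace (W / 32) with (t * eps ^ 2 / 32 * gain) by (unfold W; field). apply Rmult_le_compat_l; [pos|].
      specialize (Hi0 i ltac:(lia)). rewrite pow_inv in Hi0. lra. }
    assert (T4 : W / 8 <= t / 2 * D).
    { replace (W / 8) with (t / 2 * (eps ^ 2 * (gain / 4))) by (unfold W; field). apply Rmult_le_compat_l; lra. }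
    (* The main term is at least [W / 8] and the three errors are at most [W / 32] each. *)
    assert (IL : W / 32 <= Rabs I).
    { apply Rabs_le_between in FP. apply Rle_trans with I; [lra|apply Rle_abs]. }
    apply Rmult_le_reg_l with KP; [exact HKP|]. replace (KP * c) with (W / 32) by (unfold c, W; field; lra). lra. }
  eapply Rbar_le_trans; [|apply (besov_lower_sum chi (u t) c i0 N ltac:(lra) Per_i)].
  simpl. replace (N - i0)%nat with (S m) by (unfold N; lia). rewrite S_INR.
  assert (E : Rabs A / c * c = Rabs A) by (field; lra). assert (HA := Rle_abs A).
  assert (Rabs A / c * c <= (INR m + 1) * c) by (apply Rmult_le_compat_r; lra). lra.
Qed.

Lemma ln_ln_large X : exists N : nat, forall n, (N <= n)%nat -> X <= ln (ln (INR n)) /\ ln (ln (INR n)) <= ln (INR n).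
Proof.
  destruct (nfloor_ex (exp (exp X))) as [N [_ HN]]; [left; apply exp_pos|]. exists (S N). intros n Hn.
  apply le_INR in Hn. rewrite S_INR in Hn.
  assert (Hx := exp_pos X). assert (Hxx := exp_pos (exp X)).
  assert (H1 : exp X <= ln (INR n)). { rewrite <- (ln_exp (exp X)). apply ln_le; lra. }
  assert (H2 : X <= ln (ln (INR n))). { rewrite <- (ln_exp X). apply ln_le; lra. }
  split; [exact H2|].
  assert (E := exp_ineq1_le (ln (ln (INR n)))). rewrite exp_ln in E by lra. lra.
Qed.

Theorem theorem1p1 :
  forall chi : R -> R, admissible_chi chi ->
  exists N : nat, forall n : nat, (N <= n)%nat ->
    exists u0 : R -> R,
      H_infty u0 /\
      Rbar_le (besov_1_inf_1 chi u0) (Finite (/ ln (ln (INR n)))) /\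
      exists T t0 : R,
        0 < t0 <= / ln (INR n) /\ t0 < T /\
        (exists u, CH_solution T u0 u) /\
        (forall u, CH_solution T u0 u ->
           Rbar_le (Finite (ln (ln (INR n)))) (besov_1_inf_1 chi (u t0))).
Proof.
  intros chi Hchi. destruct (norm_inflation chi Hchi) as [kap [Hk NI]].
  (* The bound 18 gives [eps <= / 36] for [eps = / (2 * ll)], and [/ kap] gives [eps * t <= kap] for
     [t = / l], since [l >= ll]. *)
  destruct (ln_ln_large (Rmax 18 (/ kap))) as [N HN]. exists N. intros n Hn.
  destruct (HN n Hn) as [H1 H2]. clear HN. set (l := ln (INR n)) in *. set (ll := ln l) in *.
  assert (M1 := Rmax_l 18 (/ kap)). assert (M2 := Rmax_r 18 (/ kap)).
  assert (E1 : / (2 * ll) <= / 36) by (apply Rinv_le_contravar; lra).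
  assert (P1 : 0 < / (2 * ll)) by (apply Rinv_0_lt_compat; lra).
  assert (E2 : / l <= / 2) by (apply Rinv_le_contravar; lra).
  assert (P2 : 0 < / l) by (apply Rinv_0_lt_compat; lra).
  assert (E3 : / l <= kap).
  { rewrite <- (Rinv_inv kap). apply Rinv_le_contravar; [now apply Rinv_0_lt_compat|lra]. }
  assert (E4 : / (2 * ll) * / l <= kap).
  { apply Rle_trans with (1 * / l); [apply Rmult_le_compat_r|]; lra. }
  (* The datum has norm at most [2 * eps = / ll], and the target [A] is [ll] itself. *)
  destruct (NI (/ (2 * ll)) (/ l) ll (conj P1 E1) (conj P2 E2) E4) as [u0 [Hu0 [B0 [u [Hu Bu]]]]].
  exists u0. split; [exact Hu0|]. split.
  { replace (/ ll) with (2 * / (2 * ll)) by (field; lra). exact B0. }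
  exists 1, (/ l). split; [lra|]. split; [lra|]. split; [now exists u|].
  (* The lower bound is known for the constructed solution; uniqueness transfers it to any other
     solution on [[0, 1)]. *)
  intros w Hw. replace (w (/ l)) with (u (/ l)); [exact Bu|].
  apply functional_extensionality. intros x. apply (CH_unique 1 u0 u w (/ l) Hu Hw). lra.
Qed.
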